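(* Let $\mathbb{G}_1$ be a uniform random variable on $[0,1]$ and let $(\Gamma_t(\mathbb{G}_1),\,t\ge0)$ be the subordinator characterized by $$E(e^{-\lambda\Gamma_t(\mathbb{G}_1)})=\exp\left\{-t\int_0^\infty(1-e^{-\lambda x})\frac{dx}{x}E(e^{-x\mathbb{G}_1})\right\}\qquad(\lambda,t\ge0).$$ Then: 1. (Laplace transform) For $\lambda,t\ge0$ (with $0^0=1$), $$E(e^{-\lambda\Gamma_t(\mathbb{G}_1)})=\left(\frac{\lambda^\lambda}{(1+\lambda)^{1+\lambda}}\right)^t .$$ 2. (Laws) The densities of $\Gamma_1(\mathbb{G}_1)$ and $D_1(\mathbb{G}_1)$ are $$f_{\Gamma_1(\mathbb{G}_1)}(x)=\frac1\pi\left(\int_0^1e^{-xy}\frac{\sin(\pi y)\,dy}{y^y(1-y)^{1-y}}\right)1_{[0,\infty[}(x),\qquad f_{D_1(\mathbb{G}_1)}(x)=\frac{\sin\left(\frac\pi x\right)}{\pi(x-1)^{1-\frac1x}}\,1_{[1,\infty[}(x).$$ 3. (Wiener-Gamma representation) For every $t>0$, $$\Gamma_t(\mathbb{G}_1)\stackrel{(law)}{=}t\int_0^t\frac{d\gamma_u}{u}\stackrel{(law)}{=}t\int_0^t\frac{d\gamma_u}{t-u} .$$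
   Context: $(\gamma_t,\,t\ge0)$ is the standard gamma process, i.e. the subordinator without drift and with Lévy measure $\frac{dx}{x}e^{-x}$, $x>0$. For fixed $t>0$, $\gamma_t$ is a gamma variable with density $e^{-a}a^{t-1}/\Gamma(t)$ on $(0,\infty)$. Integrals $\int_0^th(u)\,d\gamma_u$ with $h\ge0$ are pathwise Stieltjes integrals. $D_1(\mathbb{G}_1)$ is the random variable whose law is characterized by $\Gamma_1(\mathbb{G}_1)\stackrel{(law)}{=}\gamma_1\cdot D_1(\mathbb{G}_1)$, with $\gamma_1$ a standard exponential variable independent of $D_1(\mathbb{G}_1)$. *)

(* Defs.v *)
From HB Require Import structures.
From mathcomp Require Import all_boot all_order all_algebra.
From mathcomp Require Import all_classical all_reals all_analysis.
From mathcomp Require Import measurable_realfun.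

Set Implicit Arguments.
Unset Strict Implicit.
Unset Printing Implicit Defensive.

Import Order.TTheory GRing.Theory Num.Theory.
Import numFieldNormedType.Exports.

Local Open Scope classical_set_scope.
Local Open Scope ring_scope.

Section laws.
Context {R : realType} {d : measure_display} {T : measurableType d}.
Variable P : probability T R.

Definition has_law {d' : measure_display} {U : measurableType d'}
    (X : T -> U) (nu : set U -> \bar R) : Prop :=
  measurable_fun setT X /\
  forall A, measurable A -> P (X @^-1` A) = nu A.

Definition has_density (X : T -> R) (f : R -> R) : Prop :=
  [/\ measurable_fun setT f,
      forall x, 0 <= f x &
      has_law X (fun A => (\int[lebesgue_measure]_(x in A) (f x)%:E)%E)].

(* The full sets are allowed among the [A i], so the product rule below covers
   every subfamily. *)
Definition independent_RVs (n : nat) (X : 'I_n -> T -> R) : Prop :=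
  forall A : 'I_n -> set R, (forall i, measurable (A i)) ->
    P (\bigcap_(i in [set: 'I_n]) X i @^-1` A i) =
    (\prod_(i < n) P (X i @^-1` A i))%E.

Definition independent_pair (X Y : T -> R) : Prop :=
  forall A B : set R, measurable A -> measurable B ->
    P (X @^-1` A `&` Y @^-1` B) = (P (X @^-1` A) * P (Y @^-1` B))%E.

End laws.

(* The two variables may live on different probability spaces. *)
Definition same_law {R : realType} {d1 d2 d' : measure_display}
    {T1 : measurableType d1} {T2 : measurableType d2} {U : measurableType d'}
    (P1 : probability T1 R) (X1 : T1 -> U)
    (P2 : probability T2 R) (X2 : T2 -> U) : Prop :=
  [/\ measurable_fun setT X1, measurable_fun setT X2 &
      forall A, measurable A -> P1 (X1 @^-1` A) = P2 (X2 @^-1` A)].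

(* Time is indexed by [R], but only the values at times t >= 0 are
   constrained. *)
Record subordinator {R : realType} {d : measure_display} {T : measurableType d}
    (P : probability T R) := Subordinator {
  sub_val :> R -> T -> R ;
  sub_measurable : forall t, 0 <= t -> measurable_fun setT (sub_val t) ;
  sub_start : forall w, sub_val 0 w = 0 ;
  sub_nondecreasing : forall w s t, 0 <= s -> s <= t ->
    sub_val s w <= sub_val t w ;
  sub_right_continuous : forall w t, 0 <= t ->
    sub_val s w @[s --> t^'+] --> sub_val t w ;
  sub_stationary : forall s t, 0 <= s -> 0 <= t ->
    same_law P (fun w => sub_val (s + t) w - sub_val s w) P (sub_val t) ;
  sub_independent : forall (n : nat) (t : nat -> R),
    0 <= t 0%N -> nondecreasing_seq t ->
    independent_RVs P
      (fun (i : 'I_n) w => sub_val (t i.+1) w - sub_val (t i) w) }.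

(* Levy-Khintchine formula with zero drift and Levy measure [ell x dx] on
   ]0, +oo[; for a subordinator it determines the law of the whole process. *)
Definition driftless_with_levy_density {R : realType} {d : measure_display}
    {T : measurableType d} (P : probability T R) (X : R -> T -> R)
    (ell : R -> \bar R) : Prop :=
  forall lambda t : R, 0 <= lambda -> 0 <= t ->
    'E_P[fun w => expR (- lambda * X t w)]%E =
    expeR (- (t%:E * \int[lebesgue_measure]_(x in `]0%R, +oo[)
                       ((1 - expR (- lambda * x))%:E * ell x)))%E.

Definition standard_gamma_process {R : realType} {d : measure_display}
    {T : measurableType d} (P : probability T R) (X : subordinator P) : Prop :=
  driftless_with_levy_density P X (fun x : R => (expR (- x) / x)%:E).

Section pathwise_integral.
Context {R : realType} {d : measure_display} {T : measurableType d}.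
Context {P : probability T R}.

(* The path of [X], extended by [X 0 w = 0] to negative times; it thus has no
   jump at 0. *)
Definition sub_path (X : subordinator P) (w : T) : R -> R :=
  fun u => X (Num.max 0 u) w.

Section cumulative_path.
Variables (X : subordinator P) (w : T).

Let sub_path_nd : nondecreasing (sub_path X w).
Proof.
move=> s t st; apply: sub_nondecreasing; first by rewrite le_max lexx.
by rewrite ge_max !le_max lexx st orbT.
Qed.

Let sub_path_rc : right_continuous (sub_path X w).
Proof.
move=> t; rewrite /sub_path; have [t0|t0] := leP 0 t.
- apply: cvg_trans (@sub_right_continuous _ _ _ _ X w t t0).
  apply: near_eq_cvg; near=> s; congr (X _ w); apply/esym/max_idPr.
  apply: (le_trans t0); apply: ltW; near: s; exact: nbhs_right_gt.
- have c0 : X 0 w @[_ --> t^'+] --> X 0 w by exact: cvg_cst.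
  apply: cvg_trans c0.
  apply: near_eq_cvg; near=> s; congr (X _ w); apply/esym/max_idPl.
  apply: ltW; near: s; exact: nbhs_right_lt.
Unshelve. all: end_near. Qed.

HB.instance Definition _ :=
  isCumulative.Build R _ R (sub_path X w) sub_path_nd sub_path_rc.

End cumulative_path.

(* \int_0^t h(u) dX_u, over ]0, t]; it may take the value +oo. *)
Definition stieltjes_integral (X : subordinator P) (h : R -> \bar R) (t : R)
    (w : T) : \bar R :=
  (\int[lebesgue_stieltjes_measure (sub_path X w)]_(u in `]0%R, t]) h u)%E.

End pathwise_integral.

(* Main.v *)
Require Import Defs.
From HB Require Import structures.
From mathcomp Require Import all_boot all_order all_algebra.
From mathcomp Require Import all_classical all_reals all_analysis.
From mathcomp Require Import measurable_realfun ring lra.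

Set Implicit Arguments.
Unset Strict Implicit.
Unset Printing Implicit Defensive.

Import Order.TTheory GRing.Theory Num.Theory.
Import numFieldNormedType.Exports.

Local Open Scope classical_set_scope.
Local Open Scope ring_scope.

(** Write [F l] for [l^l / (1 + l)^(1 + l)] and [rho s] for
    [sin (pi s) / (s^s (1 - s)^(1 - s))].

    Laplace transform. The Levy exponent contains the mean of [exp (- x G)] over
    a uniform [G]. Exchanging the integrals in [x] and in the value [g] of [G],
    Frullani's formula ([frullani]) turns the inner one into [ln (1 + l / g)],
    and the integral of this over the unit interval is
    [(1 + l) ln (1 + l) - l ln l] ([integral_ln1Dl]).

    Density of [Gamma_1]. Everything rests on the representation
    [F l = pi^-1 * int_0^1 rho s / (l + s) ds] ([stieltjes_rho]): writing
    [1 / (l + s)] as the Laplace transform at [l] of [exp (- s x)], it says that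
    the announced density has Laplace transform [F], and a finite measure on the
    half-line is determined by its Laplace transform ([laplace_unique]). To prove
    it, extend [F] to the holomorphic function
    [exp (z log z - (1 + z) log (1 + z))] on the upper half-plane. It is real at
    the boundary, except above the segment from -1 to 0, where its imaginary part
    tends to [- rho (- x)]. Consider the integral of its real part over the half
    circle of centre [l] and radius [l + s]. By the Cauchy-Riemann equations the
    derivative of this integral in [s] is the difference of the imaginary parts
    at the two end points divided by [l + s], which is [- rho s / (l + s)] for
    [s] between 0 and 1 and zero otherwise. When the radius goes from 0 to
    infinity the integral itself goes from [pi * F l] to 0. Only real calculus,
    Fubini and bounded convergence are needed.

    Density of [D]. Conditioning on [D], the probability of [E * D > x] is the mean of
    [exp (- x / D)] over the event [D > 0]; integrating the density of [Gamma_1],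
    it is the Laplace transform at [x] of [rho y / (pi y)] on the unit interval.
    By uniqueness this is the density of [1 / D], and the law of [D]
    follows by a change of variable.

    Wiener-Gamma representation. Along the dyadic partitions of [0, t], the
    Riemann-Stieltjes sums of [1 / u] taken at right end points, and those of
    [1 / (t - u)] taken at left end points, increase to the pathwise integrals
    ([cvg_dyadic_sums]). The increments of the gamma process being independent
    and stationary, the Laplace transform of a sum is a finite product
    ([dyadic_sum_laplace]). The two integrands produce the same factors in
    opposite orders, and the logarithm of the product is [- t] times a Riemann
    sum of the integral of [ln (1 + l / v)] over the unit interval. In the limit
    both integrals have the Laplace transform of [Gamma_t]; in particular they
    are almost surely finite, and uniqueness applies again. *)

(** * Uniqueness of Laplace transforms *)

Lemma bounded_cvg_integral (R : realType) (d : measure_display)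
    (T : measurableType d) (mu : {measure set T -> \bar R}) (D : set T)
    (f_ : nat -> T -> R) (f : T -> R) (M : R) :
  measurable D -> (mu D < +oo)%E ->
  (forall n, measurable_fun D (f_ n)) -> measurable_fun D f ->
  (forall n x, D x -> `|f_ n x| <= M) ->
  {ae mu, forall x, D x -> f_ ^~ x @ \oo --> f x} ->
  (\int[mu]_(x in D) (f_ n x)%:E)%E @[n --> \oo] -->
  (\int[mu]_(x in D) (f x)%:E)%E.
Proof.
move=> mD Dfin mf_ mf fM ff.
have := @dominated_convergence _ _ _ mu D mD (fun n x => (f_ n x)%:E)
  (fun x => (f x)%:E) (cst M%:E).
case.
- by move=> n; exact/measurable_EFinP.
- exact/measurable_EFinP.
- move: ff; apply: filterS => x fx Dx; apply: cvg_EFin; first exact: nearW.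
  exact: fx.
- apply/integrableP; split; first exact: measurable_cst.
  by rewrite integral_cst//= lte_mul_pinfty// lee_fin.
- by apply/aeW => x n Dx; rewrite /= lee_fin fM.
- by [].
Qed.

Lemma bounded_integrable (R : realType) (d : measure_display)
    (T : measurableType d) (mu : {measure set T -> \bar R}) (D : set T)
    (f : T -> R) (M : R) :
  measurable D -> (mu D < +oo)%E -> measurable_fun D f ->
  (forall x, D x -> `|f x| <= M) -> mu.-integrable D (EFin \o f).
Proof.
move=> mD Dfin mf fM; apply: measurable_bounded_integrable => //.
exists M; split; first exact: num_real.
by move=> y My x Dx; exact: le_trans (fM _ Dx) (ltW My).
Qed.


Section laplace_uniqueness.
Context {R : realType}.
Implicit Types (x a s : R) (n m : nat).

Let p a n := Num.truncn (n%:R * expR (n%:R * a)).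

(** [(1 - exp (- n x))^p] with [p] close to [n * exp (n a)] is close to
    [exp (- n * exp (n (a - x)))], hence tends to the indicator of [x > a]; the
    damping factor makes it a combination of exponentials with positive rates,
    the only ones whose integrals are assumed to agree. *)
Definition laplace_test a n x : R :=
  expR (- (n%:R^-1 * x)) * (1 - expR (- (n%:R * x))) ^+ p a n.

Lemma laplace_test_ge0_le1 a n x : 0 <= x -> 0 <= laplace_test a n x <= 1.
Proof.
move=> x0; rewrite /laplace_test.
have q0 : 0 <= 1 - expR (- (n%:R * x)).
  by rewrite subr_ge0 expR_le1 oppr_le0 mulr_ge0.
rewrite mulr_ge0 ?expR_ge0 ?exprn_ge0//= mulr_ile1 ?expR_ge0 ?exprn_ge0//.
  by rewrite expR_le1 oppr_le0 mulr_ge0 ?invr_ge0.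
by rewrite exprn_ile1// gerBl expR_ge0.
Qed.

Lemma bernoulli_ge m (q : R) : 0 <= q <= 1 -> 1 - m%:R * q <= (1 - q) ^+ m.
Proof.
move=> /andP[q0 q1]; elim: m => [|m ih]; first by rewrite mul0r subr0 expr0.
rewrite exprS -natr1.
have : (1 - q) * (1 - m%:R * q) <= (1 - q) * (1 - q) ^+ m.
  by rewrite ler_wpM2l// subr_ge0.
apply: le_trans.
have : 0 <= m%:R * (q * q) :> R by rewrite !mulr_ge0.
lra.
Qed.

Lemma cvg_natr_expN (c : R) : 0 < c ->
  n%:R * expR (- (n%:R * c)) @[n --> \oo] --> (0 : R).
Proof.
move=> c0.
apply/cvgrPdist_le => e e0.
near=> n.
have n0 : 0 < n%:R :> R by rewrite ltr0n; near: n; exact: nbhs_infty_gt.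
rewrite sub0r normrN ger0_norm ?mulr_ge0 ?expR_ge0//.
rewrite expRN ler_pdivrMr ?expR_gt0//.
have h : n%:R <= e * ((n%:R * c) ^+ 2 / 2).
  have -> : e * ((n%:R * c) ^+ 2 / 2) = n%:R * (e * c * c / 2 * n%:R) by field.
  rewrite ler_peMr//.
  rewrite -ler_pdivrMl ?mulr1; last by rewrite !(mulr_gt0, invr_gt0).
  near: n; exact: nbhs_infty_ger.
apply: (le_trans h); rewrite ler_pM2l//.
have := @expR_ge1Dxn R (n%:R * c) 1 (mulr_ge0 (ltW n0) (ltW c0)).
rewrite (_ : 2`! = 2)%N//; apply: le_trans; lra.
Unshelve. all: end_near. Qed.

Lemma cvg_laplace_test a x : 0 <= x ->
  laplace_test a n x @[n --> \oo] --> ((a < x)%R%:R : R).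
Proof.
move=> x0; rewrite /laplace_test.
have c1 : expR (- (n%:R^-1 * x)) @[n --> \oo] --> (1 : R).
  rewrite -[X in _ --> X](expR0); apply: continuous_cvg.
    exact: continuous_expR.
  rewrite -oppr0; apply: cvgN; rewrite -[X in _ --> X](mul0r x).
  apply: cvgMl; apply/gtr0_cvgV0; last exact: cvgr_idn.
  by near=> n; rewrite ltr0n; near: n; exact: nbhs_infty_gt.
rewrite -[X in _ --> X]mul1r; apply: cvgM => //.
have q01 n : 0 <= expR (- (n%:R * x)) <= 1.
  by rewrite expR_ge0 expR_le1 oppr_le0 mulr_ge0.
have [ax|xa] := ltP a x.
- apply: (@squeeze_cvgr _ _ _ _
    (fun n => 1 - n%:R * expR (- (n%:R * (x - a)))) (cst 1)).
  + apply: nearW => n; apply/andP; split; last first.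
      have /andP[? ?] := q01 n.
      by rewrite exprn_ile1 ?subr_ge0// gerBl.
    apply: le_trans (bernoulli_ge (p a n) (q01 n)).
    rewrite lerB//.
    have : (p a n)%:R <= n%:R * expR (n%:R * a).
      by rewrite /p truncn_le// mulr_ge0// expR_ge0.
    move=> /(ler_wpM2r (expR_ge0 (- (n%:R * x)))) /le_trans; apply.
    by rewrite -mulrA -expRD mulrBr opprB addrC.
  + rewrite -[X in _ --> X]subr0; apply: cvgB; first exact: cvg_cst.
    by apply: cvg_natr_expN; rewrite subr_gt0.
  + exact: cvg_cst.
- apply: (@squeeze_cvgr _ _ _ _ (cst 0) (fun n => expR 1 * expR (- n%:R))).
  + apply: nearW => n; have /andP[q0 q1] := q01 n.
    rewrite exprn_ge0 ?subr_ge0//=.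
    set q := expR (- (n%:R * x)) in q0 q1 *.
    have e1 : (1 - q) ^+ p a n <= expR (- q) ^+ p a n.
      by rewrite lerXn2r ?nnegrE ?expR_ge0 ?subr_ge0// expR_ge1Dx.
    apply: (le_trans e1); rewrite -expRM_natl -expRD ler_expR.
    have : n%:R * expR (n%:R * a) < (p a n)%:R + 1.
      by rewrite natr1 /p truncnS_gt.
    move=> /ltW /(ler_wpM2r q0); rewrite -mulrA -expRD mulrDl mul1r => h.
    have : n%:R <= n%:R * expR (n%:R * a - n%:R * x).
      rewrite ler_peMr// -expR0 ler_expR -mulrBr mulr_ge0// subr_ge0//.
    lra.
  + exact: cvg_cst.
  + by rewrite -[X in _ --> X](mulr0 (expR 1)); apply: cvgMr; exact: cvgn_expR.
Unshelve. all: end_near. Qed.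

Variables mu nu : {measure set (measurableTypeR R) -> \bar R}.
Hypothesis mufin : (mu setT < +oo)%E.
Hypothesis nufin : (nu setT < +oo)%E.
Hypothesis mu0 : mu `]-oo, 0[%classic = 0%E.
Hypothesis nu0 : nu `]-oo, 0[%classic = 0%E.
Hypothesis munu : forall l : R, 0 < l ->
  (\int[mu]_(x in `[0%R, +oo[) (expR (- (l * x)))%:E =
   \int[nu]_(x in `[0%R, +oo[) (expR (- (l * x)))%:E)%E.

Let fun_int (m : {measure set (measurableTypeR R) -> \bar R}) (h : R -> R) :
  (m setT < +oo)%E -> measurable_fun setT h ->
  (forall x, 0 <= x -> `|h x| <= 1) -> m.-integrable `[0%R, +oo[ (EFin \o h).
Proof.
move=> mfin mh h1; apply: (@bounded_integrable _ _ _ _ _ _ 1) => //.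
- by apply: le_lt_trans mfin; apply: le_measure => //; rewrite inE.
- exact: measurable_funTS.
- by move=> x; rewrite /= in_itv/= andbT; exact: h1.
Qed.

Let mpoly (l : R) n m : measurable_fun setT
  (fun x => expR (- (l * x)) * (1 - expR (- (n%:R * x))) ^+ m).
Proof.
apply: measurable_funM.
  by apply: measurableT_comp => //; apply: measurableT_comp => //;
    exact: measurable_funM.
apply: measurable_funX; apply: measurable_funB => //.
by apply: measurableT_comp => //; apply: measurableT_comp => //;
  exact: measurable_funM.
Qed.

(** Induction on the power [m], the rate [l] varying: one more factor
    [1 - exp (- n x)] is the difference of the integrands of rates [l] and
    [l + n]. *)
Lemma laplace_eq_poly (l : R) n m : 0 < l ->
  (\int[mu]_(x in `[0%R, +oo[) (expR (- (l * x)) * (1 - expR (- (n%:R * x))) ^+ m)%:E =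
   \int[nu]_(x in `[0%R, +oo[) (expR (- (l * x)) * (1 - expR (- (n%:R * x))) ^+ m)%:E)%E.
Proof.
have bd (l' : R) k x : 0 < l' -> 0 <= x ->
    `|expR (- (l' * x)) * (1 - expR (- (n%:R * x))) ^+ k| <= 1.
  move=> l0 x0.
  have q0 : 0 <= 1 - expR (- (n%:R * x)).
    by rewrite subr_ge0 expR_le1 oppr_le0 mulr_ge0.
  rewrite ger0_norm ?mulr_ge0 ?expR_ge0 ?exprn_ge0//.
  rewrite mulr_ile1 ?expR_ge0 ?exprn_ge0//.
    by rewrite expR_le1 oppr_le0 mulr_ge0// ltW.
  by rewrite exprn_ile1// gerBl expR_ge0.
elim: m l => [|m ih] l l0.
  under eq_integral do rewrite expr0 mulr1.
  by under [in RHS]eq_integral do rewrite expr0 mulr1; exact: munu.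
have E x : (expR (- (l * x)) * (1 - expR (- (n%:R * x))) ^+ m.+1)%:E =
  ((expR (- (l * x)) * (1 - expR (- (n%:R * x))) ^+ m)%:E -
   (expR (- ((l + n%:R) * x)) * (1 - expR (- (n%:R * x))) ^+ m)%:E)%E.
  rewrite -EFinB (_ : - ((l + n%:R) * x) = - (l * x) + - (n%:R * x)); last by ring.
  by rewrite expRD exprS; congr EFin; ring.
have ln0 : 0 < l + n%:R by rewrite ltr_pwDl.
under eq_integral do rewrite E.
under [in RHS]eq_integral do rewrite E.
rewrite !integralB_EFin//.
- by rewrite ih// ih.
- by apply: fun_int => // x x0; exact: bd.
- by apply: fun_int => // x x0; exact: bd.
- by apply: fun_int => // x x0; exact: bd.
- by apply: fun_int => // x x0; exact: bd.
Qed.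

Let mu_ray (m : {measure set (measurableTypeR R) -> \bar R}) a : (m setT < +oo)%E ->
  (\int[m]_(x in `[0%R, +oo[) (laplace_test a n x)%:E)%E @[n --> \oo] -->
  m (`[0%R, +oo[ `&` `]a, +oo[).
Proof.
move=> mfin.
rewrite setIC -[X in _ --> X](integral_indic _)//.
apply: (@bounded_cvg_integral _ _ _ m `[0%R, +oo[ _ _ 1) => //.
- by apply: le_lt_trans mfin; apply: le_measure => //; rewrite inE.
- by move=> n; apply: measurable_funTS; exact: mpoly.
- move=> n x; rewrite /= in_itv/= andbT => /(laplace_test_ge0_le1 a n) /andP[? ?].
  by rewrite ger0_norm.
- apply/aeW => x; rewrite /= in_itv/= andbT => x0.
  by rewrite indicE mem_setE in_itv/= andbT; exact: cvg_laplace_test.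
Qed.

(** The test functions give the masses of all rays, which generate the Borel
    sets. *)
Lemma laplace_unique (A : set (measurableTypeR R)) : measurable A -> mu A = nu A.
Proof.
have rayE a : mu (`[0%R, +oo[ `&` `]a, +oo[) = nu (`[0%R, +oo[ `&` `]a, +oo[).
  have h1 := @mu_ray mu a mufin.
  have h2 := @mu_ray nu a nufin.
  apply: cvg_unique h1 _; first exact: ereal_hausdorff.
  apply: cvg_trans h2; apply: near_eq_cvg; near=> n.
  rewrite /laplace_test; apply/esym/laplace_eq_poly.
  by rewrite invr_gt0 ltr0n; near: n; exact: nbhs_infty_gt.
have splitE (m : {measure set (measurableTypeR R) -> \bar R}) (B : set R) : measurable B ->
    m `]-oo, 0[%classic = 0%E -> m B = m (`[0%R, +oo[ `&` B).
  move=> mB m0.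
  rewrite {1}(_ : B = (`[0%R, +oo[ `&` B) `|` (`]-oo, 0[ `&` B)); last first.
    by rewrite -setIUl setUC itv_setU_setT setTI.
  rewrite measureU//; [|exact: measurableI|exact: measurableI|]; last first.
    rewrite -subset0 => x [[/= + _] [/= + _]]; rewrite !in_itv/=.
    by case: ltgtP.
  rewrite [X in (_ + X)%E](_ : _ = 0%E) ?adde0//.
  by apply: (@subset_measure0 _ _ _ m _ `]-oo, 0[%classic) => //; exact: measurableI.
have rayE' a : mu `]a, +oo[%classic = nu `]a, +oo[%classic.
  by rewrite (splitE mu)// (splitE nu)// rayE.
move=> mA.
apply: (@measure_unique _ R (measurableTypeR R) (@RGenOInfty.G R)
  (fun k : nat => `]- k%:R, +oo[%classic) (@RGenOInfty.measurableE R)) => //.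
- move=> _ _ [a ->] [b ->]; exists (Num.max a b).
  by apply/seteqP; split => x /=; rewrite !in_itv/= !andbT gt_max => /andP.
- by move=> k; eexists.
- rewrite -subTset => x _; exists (Num.truncn `|x|).+1 => //=.
  rewrite in_itv/= andbT ltrNl.
  by apply: le_lt_trans (truncnS_gt `|x|); rewrite -normrN ler_norm.
- by move=> _ [a ->]; exact: rayE'.
- by move=> k; apply: le_lt_trans mufin; apply: le_measure => //; rewrite inE.
Unshelve. all: end_near. Qed.

End laplace_uniqueness.

(** * Measures with a density, and calculus on the line *)

Section density_measure.
Local Open Scope ereal_scope.
Context {d : measure_display} {T : measurableType d} {R : realType}.
Variables (mu : {measure set T -> \bar R}) (g : T -> R).
Hypothesis mg : measurable_fun setT g.
Hypothesis g0 : forall x, (0 <= g x)%R.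

Definition density_measure (_ : measurable_fun setT g)
  (_ : forall x, (0 <= g x)%R) (A : set T) : \bar R := \int[mu]_(x in A) (g x)%:E.

Local Notation nu := (density_measure mg g0).

Let mEg : measurable_fun setT (EFin \o g). Proof. exact/measurable_EFinP. Qed.

Let g0E x : 0 <= (g x)%:E. Proof. by rewrite lee_fin. Qed.

Let nu0 : nu set0 = 0. Proof. by rewrite /density_measure integral_set0. Qed.

Let nu_ge0 A : 0 <= nu A. Proof. by apply: integral_ge0 => x _; exact: g0E. Qed.

Let nu_sigma_additive : semi_sigma_additive nu.
Proof. exact: semi_sigma_additive_nng_induced. Qed.

HB.instance Definition _ :=
  isMeasure.Build _ _ _ nu nu0 nu_ge0 nu_sigma_additive.

Import HBNNSimple.

Let integral_density_nnsfun (f : {nnsfun T >-> R}) :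
  \int[nu]_x (f x)%:E = \int[mu]_x ((f x)%:E * (g x)%:E).
Proof.
under [LHS]eq_integral do rewrite fimfunE -fsumEFin//.
rewrite [LHS]ge0_integral_fsum//; last 2 first.
  - by move=> r; exact/measurable_EFinP/measurableT_comp.
  - by move=> n x _; rewrite EFinM nnfun_muleindic_ge0.
under [RHS]eq_integral.
  move=> x xD; rewrite fimfunE -fsumEFin// ge0_mule_fsuml; last first.
    by move=> r; rewrite EFinM nnfun_muleindic_ge0.
  over.
rewrite [RHS]ge0_integral_fsum//; last 2 first.
  - move=> r; apply: emeasurable_funM => //.
    by apply/measurable_EFinP; apply/measurableT_comp => //.
  - by move=> n x _; rewrite mule_ge0// EFinM nnfun_muleindic_ge0.
apply: eq_fsbigr => r; rewrite inE => -[t _ <-].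
rewrite integralZl_indic_nnsfun//= integral_indic// setIT.
rewrite /density_measure [X in (_ * X)%E]integral_mkcond.
rewrite -ge0_integralZl ?lee_fin//; last 2 first.
- by apply/(measurable_restrictT _ _).1 => //; exact: measurable_funTS.
- by move=> x _; rewrite patchE; case: ifP.
apply: eq_integral => x _; rewrite patchE indicE.
by case: ifPn => _; rewrite ?mulr1 ?mulr0 ?mule0 ?mul0e.
Qed.

Let ge0_integral_densityT (f : T -> \bar R) :
  measurable_fun setT f -> (forall x, 0 <= f x) ->
  \int[nu]_x f x = \int[mu]_x (f x * (g x)%:E).
Proof.
move=> mf f0; pose f_ := nnsfun_approx measurableT mf.
transitivity (lim (\int[nu]_x (f_ n x)%:E @[n --> \oo])).
  rewrite -monotone_convergence//=.
  - apply: eq_integral => ? /[!inE] xD; apply/esym/cvg_lim => //=.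
    exact: cvg_nnsfun_approx.
  - by move=> n; exact/measurable_EFinP/measurable_funTS.
  - by move=> n ? _; rewrite lee_fin.
  - by move=> ? _ ? ? mn; rewrite lee_fin; exact/lefP/nd_nnsfun_approx.
under eq_fun do rewrite integral_density_nnsfun.
rewrite -monotone_convergence//=.
- apply: eq_integral => x /[!inE] xD; apply/cvg_lim => //=.
  apply: cvgeZr => //; exact: cvg_nnsfun_approx.
- move=> n; apply: emeasurable_funM => //.
  exact/measurable_EFinP/measurable_funTS.
- by move=> n x _; rewrite mule_ge0 ?lee_fin.
- move=> x _ m n mn; apply: lee_wpmul2r => //.
  by rewrite lee_fin; exact/lefP/nd_nnsfun_approx.
Qed.

Lemma ge0_integral_density (D : set T) (f : T -> \bar R) :
  measurable D -> measurable_fun D f -> (forall x, D x -> 0 <= f x) ->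
  \int[nu]_(x in D) f x = \int[mu]_(x in D) (f x * (g x)%:E).
Proof.
move=> mD mf f0; rewrite [LHS]integral_mkcond.
rewrite (ge0_integral_densityT (f := f \_ D)).
- rewrite [RHS]integral_mkcond; apply: eq_integral => x _.
  by rewrite !patchE; case: ifP => //; rewrite mul0e.
- exact/(measurable_restrictT _ _).1.
- by move=> x; rewrite patchE; case: ifPn => //; rewrite inE => /f0.
Qed.

End density_measure.

(** The rules below state derivatives of explicit functions [fun y => ...] at a
    point, so that the derivative of a composite formula is a term built from
    them and not a goal to be solved by unification. *)
Section pointwise_calculus.
Context {R : realType}.
Implicit Types (f g : R -> R) (x a b c : R).

Lemma is_deriveD_pt f g x a b : is_derive x 1 f a -> is_derive x 1 g b ->
  is_derive x 1 (fun y => f y + g y) (a + b).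
Proof. by move=> fa gb; exact: is_deriveD. Qed.

Lemma is_deriveB_pt f g x a b : is_derive x 1 f a -> is_derive x 1 g b ->
  is_derive x 1 (fun y => f y - g y) (a - b).
Proof. by move=> fa gb; exact: is_deriveB. Qed.

Lemma is_deriveN_pt f x a : is_derive x 1 f a ->
  is_derive x 1 (fun y => - f y) (- a).
Proof. by move=> fa; exact: is_deriveN. Qed.

Lemma is_deriveM_pt f g x a b : is_derive x 1 f a -> is_derive x 1 g b ->
  is_derive x 1 (fun y => f y * g y) (a * g x + f x * b).
Proof.
move=> fa gb; apply: (is_derive_eq (is_deriveM fa gb)).
by rewrite /GRing.scale/= addrC mulrC.
Qed.

Lemma is_deriveZ_pt c f x a : is_derive x 1 f a ->
  is_derive x 1 (fun y => c * f y) (c * a).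
Proof. by move=> fa; exact: (@is_deriveZ _ _ R^o). Qed.

Lemma is_deriveV_pt f x a : f x != 0 -> is_derive x 1 f a ->
  is_derive x 1 (fun y => (f y)^-1) (- a / f x ^+ 2).
Proof.
move=> fx0 fa; apply: (is_derive_eq (is_deriveV fx0 fa)).
by rewrite /GRing.scale/= mulNr mulNr mulrC.
Qed.

Lemma is_derive_exp_pt f x a : is_derive x 1 f a ->
  is_derive x 1 (fun y => expR (f y)) (a * expR (f x)).
Proof.
move=> fa; rewrite mulrC.
exact: (is_derive1_comp (f := expR) (is_derive_expR _) fa).
Qed.

Lemma is_derive_ln_pt f x a : 0 < f x -> is_derive x 1 f a ->
  is_derive x 1 (fun y => ln (f y)) (a / f x).
Proof.
move=> fx fa; rewrite mulrC.
exact: (is_derive1_comp (f := @ln R) (is_derive1_ln fx) fa).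
Qed.

Lemma is_derive_cos_pt f x a : is_derive x 1 f a ->
  is_derive x 1 (fun y => cos (f y)) (- (a * sin (f x))).
Proof.
move=> fa; rewrite -mulrN mulrC.
exact: (is_derive1_comp (f := @cos R) (is_derive_cos _) fa).
Qed.

Lemma is_derive_sin_pt f x a : is_derive x 1 f a ->
  is_derive x 1 (fun y => sin (f y)) (a * cos (f x)).
Proof.
move=> fa; rewrite mulrC.
exact: (is_derive1_comp (f := @sin R) (is_derive_sin _) fa).
Qed.

Lemma is_derive_atan_pt f x a : is_derive x 1 f a ->
  is_derive x 1 (fun y => atan (f y)) (a / (1 + f x ^+ 2)).
Proof.
move=> fa; rewrite mulrC.
exact: (is_derive1_comp (f := @atan R) (is_derive1_atan _) fa).
Qed.

Lemma is_derive_continuous f x a : is_derive x 1 f a -> {for x, continuous f}.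
Proof.
by move=> fa; apply/differentiable_continuous/derivable1_diffP; case: fa.
Qed.

(** A form of the second fundamental theorem in which the continuity of the
    primitive comes for free. *)
Lemma integral_is_derive (f df : R -> R) (a b : R) : a < b ->
  (forall x, a <= x <= b -> is_derive x 1 f (df x)) ->
  (forall x, a <= x <= b -> {for x, continuous df}) ->
  (\int[lebesgue_measure]_(x in `[a, b]) (df x)%:E = (f b - f a)%:E)%E.
Proof.
move=> ab fdf cdf; rewrite EFinB; apply: continuous_FTC2 => //.
- apply: continuous_in_subspaceT => x; rewrite inE/= in_itv/= => xab.
  exact: cdf.
- split.
  + move=> x; rewrite in_itv/= => /andP[ax xb].
    by case: (fdf x) => //; rewrite !ltW.
  + by apply/cvg_at_right_filter/(is_derive_continuous (fdf a _));
      rewrite lexx ltW.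
  + by apply/cvg_at_left_filter/(is_derive_continuous (fdf b _));
      rewrite lexx ltW.
- move=> x; rewrite in_itv/= => /andP[ax xb].
  by rewrite derive1E; apply: derive_val; apply: fdf; rewrite !ltW.
Qed.

End pointwise_calculus.

(** The inverse is [x * (x^2)^(-1)], also at 0, and powers of nonnegative numbers
    are measurable. *)
Lemma measurable_inv {R : realType} {d : measure_display} {T : measurableType d}
    (D : set T) (f : T -> R) :
  measurable_fun D f -> measurable_fun D (fun x => (f x)^-1).
Proof.
move=> mf; rewrite (_ : (fun x => _) = (fun x => f x * (f x ^+ 2) `^ (-1))).
  apply: measurable_funM => //.
  apply: (measurableT_comp (f := (@powR R)^~ (-1))) => //.
  exact: measurable_funX.
apply/funext => x; rewrite powR_inv1 ?sqr_ge0//.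
have [->|fx0] := eqVneq (f x) 0; first by rewrite invr0 mul0r.
by field.
Qed.

Lemma ge0_fubini_setM {d1 d2 : measure_display} {T1 : measurableType d1}
    {T2 : measurableType d2} {R : realType}
    (m1 : {sigma_finite_measure set T1 -> \bar R})
    (m2 : {sigma_finite_measure set T2 -> \bar R})
    (A : set T1) (B : set T2) (f : T1 -> T2 -> \bar R) :
  measurable A -> measurable B ->
  measurable_fun (A `*` B) (fun z => f z.1 z.2) ->
  (forall x y, A x -> B y -> (0 <= f x y)%E) ->
  (\int[m1]_(x in A) \int[m2]_(y in B) f x y =
   \int[m2]_(y in B) \int[m1]_(x in A) f x y)%E.
Proof.
move=> mA mB mf f0.
pose F := (fun z => f z.1 z.2) \_ (A `*` B).
have mF : measurable_fun setT F.
  by apply/(measurable_restrictT _ _).1 => //; exact: measurableX.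
have F0 z : (0 <= F z)%E.
  by rewrite /F patchE; case: ifPn => //; rewrite inE => -[]; exact: f0.
transitivity (\int[m1]_x \int[m2]_y F (x, y))%E; last first.
  rewrite (fubini_tonelli F mF F0).
  rewrite [RHS]integral_mkcond; apply: eq_integral => y _.
  rewrite patchE; case: ifPn => [yB|yB].
    rewrite [RHS]integral_mkcond; apply: eq_integral => x _.
    rewrite /F !patchE; congr (if _ then _ else _).
    by apply/idP/idP; rewrite !inE => // xA; [case: xA|split => //=; rewrite inE in yB].
  rewrite integral0_eq// => x _; rewrite /F patchE memNset// => -[/= _ By].
  by rewrite notin_setE in yB.
rewrite [LHS]integral_mkcond; apply: eq_integral => x _.
rewrite patchE; case: ifPn => [xA|xA].
  rewrite integral_mkcond; apply: eq_integral => y _.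
  rewrite /F !patchE; congr (if _ then _ else _).
  by apply/idP/idP; rewrite !inE => // yB; [split => //=; rewrite inE in xA|case: yB].
rewrite integral0_eq// => y _; rewrite /F patchE memNset// => -[/= Ax _].
by rewrite notin_setE in xA.
Qed.

(** * The Levy exponent: a Frullani integral *)

Section frullani.
Context {R : realType}.
Notation mu := (@lebesgue_measure R).

Lemma integral_expRN_tail (x y : R) : 0 < y ->
  (\int[mu]_(u in `]x, +oo[) (expR (- (u * y)))%:E = (expR (- (x * y)) / y)%:E)%E.
Proof.
move=> y0; have me : measurable_fun setT (fun u : R => (expR (- (u * y)))%:E).
  apply/measurable_EFinP; apply: measurableT_comp => //.
  by apply: measurableT_comp => //; exact: measurable_funM.
rewrite integral_itv_obnd_cbnd; last exact: measurable_funTS.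
have dF (u : R) : is_derive u 1 (fun u => - y^-1 * expR (- (u * y))) (expR (- (u * y))).
  have D := is_deriveZ_pt (- y^-1) (is_derive_exp_pt (is_deriveN_pt
    (is_deriveM_pt (is_derive_id u 1) (is_derive_cst y u 1)))).
  by apply: (is_derive_eq D); rewrite /cst; field; rewrite gt_eqF.
rewrite (@ge0_continuous_FTC2y _ _ (fun u => - y^-1 * expR (- (u * y))) x 0).
- by rewrite -EFinB sub0r mulNr opprK mulrC.
- by move=> u _; exact: expR_ge0.
- apply: continuous_subspaceT => u; apply: is_derive_continuous.
- rewrite -[X in _ --> X](mulr0 (- y^-1)); apply: cvgMr.
  have h : (expR (- x) @[x --> +oo] --> (0:R)) by exact: cvgr_expR.
  apply: (cvg_comp (fun x => x * y) (fun x => expR (- x))) h.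
  exact: gt0_cvgMly.
- by move=> u _; case: (dF u).
- exact/cvg_at_right_filter/(is_derive_continuous (dF x)).
- by move=> u _ /=; rewrite derive1E; apply: derive_val; exact: dF.
Qed.

Lemma integral_expRN_itvy (c : R) : 0 < c ->
  (\int[mu]_(x in `[0%R, +oo[) (expR (- (c * x)))%:E)%E = (c^-1)%:E.
Proof.
move=> c0; rewrite -integral_itv_obnd_cbnd.
  under eq_integral do rewrite mulrC.
  by rewrite integral_expRN_tail// mul0r oppr0 expR0 mul1r.
apply/measurable_EFinP; apply: measurable_funTS.
apply: measurableT_comp => //; apply: measurableT_comp => //.
Qed.

(** [(1 - exp (- l x)) / x] is the integral of [exp (- x s)] over [0, l]; by
    Tonelli the integral in [x] can be taken first. *)
Lemma frullani (l g : R) : 0 <= l -> 0 < g ->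
  (\int[mu]_(x in `]0%R, +oo[) ((1 - expR (- (l * x))) * x^-1 * expR (- (x * g)))%:E
   = (ln (1 + l / g))%:E)%E.
Proof.
rewrite le_eqVlt => /predU1P[<-|l0] g0.
  rewrite mul0r addr0 ln1 integral0_eq// => x _.
  by rewrite mul0r oppr0 expR0 subrr !mul0r.
transitivity (\int[mu]_(x in `]0%R, +oo[) \int[mu]_(s in `[0%R, l])
    (expR (- (x * (s + g))))%:E)%E.
  apply: eq_integral => x; rewrite inE/= in_itv/= andbT => x0.
  have dF (s : R) : is_derive s 1 (fun s => - x^-1 * expR (- (x * (s + g))))
      (expR (- (x * (s + g)))).
    by apply: is_derive_eq; rewrite /GRing.scale/=; field; rewrite gt_eqF.
  rewrite (integral_is_derive l0 (fun s _ => dF s)); last first.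
    by move=> s _; apply: is_derive_continuous.
  rewrite add0r mulrDr opprD expRD (mulrC x l); congr EFin; ring.
etransitivity.
  apply: (@ge0_fubini_setM _ _ _ _ _ mu mu _ _
    (fun x s => (expR (- ((x : R) * ((s : R) + g))))%:E)) => //.
- apply/measurable_EFinP; apply: measurable_funTS.
  apply: measurableT_comp => //; apply: measurableT_comp => //.
  by apply: measurable_funM => //; apply: measurable_funD.
transitivity (\int[mu]_(s in `[0%R, l]) ((s + g)^-1)%:E)%E.
  apply: eq_integral => s; rewrite inE/= in_itv/= => /andP[s0 _].
  rewrite integral_itv_obnd_cbnd; last first.
    apply/measurable_EFinP/measurable_funTS.
    apply: measurableT_comp => //; apply: measurableT_comp => //.
    by apply: measurable_funM.
  under eq_integral do rewrite mulrC.
  by rewrite integral_expRN_itvy// ltr_wpDl.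
have dF (s : R) : 0 <= s <= l -> is_derive s 1 (fun s => ln (s + g)) (s + g)^-1.
  move=> /andP[s0 _]; apply: is_derive_eq.
    by apply: is_derive_ln_pt; rewrite ltr_wpDl.
  by rewrite addr0 mul1r.
rewrite (integral_is_derive l0 dF).
- by rewrite add0r -ln_div ?posrE ?addr_gt0// mulrDl divff ?gt_eqF// addrC.
- move=> s /andP[s0 _]; apply: is_derive_continuous.
  by apply: is_deriveV_pt; rewrite gt_eqF// ltr_wpDl.
Qed.

Lemma cvge_S (u : nat -> \bar R) (a : \bar R) :
  u n @[n --> \oo] --> a -> u n.+1 @[n --> \oo] --> a.
Proof. by rewrite cvg_shiftS. Qed.

Definition xlnx (x : R) := x * ln x.

(** The primitive [(l + v) ln (l + v) - v ln v] is differentiable away from 0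
    only. Cutting at [exp (- n)] makes the remaining limit
    [n * exp (- n)] explicit. *)
Lemma integral_ln1Dl (l : R) : 0 <= l ->
  (\int[mu]_(v in `]0%R, 1%R]) (ln (1 + l / v))%:E =
   (xlnx (1 + l) - xlnx l)%:E)%E.
Proof.
rewrite le_eqVlt => /predU1P[<-|l0].
  rewrite /xlnx mul0r addr0 ln1 mulr0 subrr integral0_eq// => x _.
  by rewrite mul0r addr0 ln1.
have ln0 (v : R) : 0 < v -> 0 <= ln (1 + l / v).
  by move=> v0; rewrite ln_ge0// lerDl divr_ge0// ltW.
pose F (v : R) := xlnx (l + v) - xlnx v.
have dF (v : R) : 0 < v -> is_derive v 1 F (ln (1 + l / v)).
  move=> v0; apply: is_derive_eq.
    apply: is_deriveB_pt; apply: is_deriveM_pt.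
    - by apply: is_derive_ln_pt; rewrite addr_gt0.
    - exact: is_derive1_ln.
  rewrite (_ : 1 + l / v = (l + v) / v); last by field; rewrite gt_eqF.
  rewrite ln_div ?posrE ?addr_gt0//; field.
  by rewrite !gt_eqF// addr_gt0.
have e1 (n : nat) : expR (- n%:R) <= 1 :> R by rewrite expR_le1 oppr_le0.
have cvg1 : (\int[mu]_(v in `[expR (- n%:R), 1%R]) (ln (1 + l / v))%:E)%E
    @[n --> \oo] --> (\int[mu]_(v in `]0%R, 1%R]) (ln (1 + l / v))%:E)%E.
  rewrite (_ : `]0, 1]%classic = \bigcup_n (`[expR (- n%:R), 1]%classic : set R)).
    apply: ge0_nondecreasing_set_cvg_integral => //.
    - apply/nondecreasing_seqP => n; rewrite subsetEset => v /=.
      rewrite !in_itv/= => /andP[nv ->]; rewrite andbT; apply: le_trans nv.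
      by rewrite ler_expR lerN2 ler_nat.
    - move=> n; apply/measurable_EFinP; apply: measurable_funTS.
      apply: measurableT_comp => //; apply: measurable_funD => //.
      by apply: measurable_funM => //; exact: measurable_inv.
    - move=> n v; rewrite /= in_itv/= => /andP[nv _]; rewrite lee_fin ln0//.
      exact: lt_le_trans (expR_gt0 _) nv.
  apply/seteqP; split => [v /=|v [n _] /=]; rewrite !in_itv/= => /andP[v0 v1].
    exists (Num.truncn (- ln v)).+1 => //=; rewrite in_itv/= v1 andbT.
    rewrite -[leRHS](lnK (x := v)) ?posrE// ler_expR lerNl.
    exact/ltW/truncnS_gt.
  by rewrite v1 andbT; exact: lt_le_trans (expR_gt0 _) v0.
have cvg2 : (F 1 - F (expR (- n%:R)))%:E @[n --> \oo] -->
    (xlnx (1 + l) - xlnx l)%:E.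
  apply: cvg_EFin; first exact: nearW.
  rewrite /F {2}/xlnx ln1 mulr0 subr0 addrC.
  apply: cvgB; first exact: cvg_cst.
  rewrite -[X in _ --> X]subr0; apply: cvgB.
    have e0 : expR (- n%:R) @[n --> \oo] --> (0 : R) by exact: cvgn_expR.
    apply: continuous_cvg; last first.
      by rewrite -[X in _ --> X]addr0; apply: cvgD => //; exact: cvg_cst.
    apply: (is_derive_continuous (a := 1 * ln l + l * (1 / l))).
    by apply: is_deriveM_pt; apply: is_derive_ln_pt.
  rewrite (_ : (fun n => _) = (fun n => - (n%:R * expR (- (n%:R * 1))))).
    by rewrite -[X in _ --> X]oppr0; apply: cvgN; exact: cvg_natr_expN.
  by apply/funext => n; rewrite /xlnx expRK mulr1 mulrN mulrC.
(* The index is shifted so that the cut [exp (- n.+1)] is strictly below 1. *)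
have cvg1' : (\int[mu]_(v in `[expR (- n.+1%:R), 1%R]) (ln (1 + l / v))%:E)%E
    @[n --> \oo] --> (\int[mu]_(v in `]0%R, 1%R]) (ln (1 + l / v))%:E)%E.
  exact: (cvge_S (u := fun n => \int[mu]_(v in `[expR (- n%:R), 1%R]) (ln (1 + l / v))%:E))%E.
have cvg2' : (F 1 - F (expR (- n.+1%:R)))%:E @[n --> \oo] -->
    (xlnx (1 + l) - xlnx l)%:E.
  exact: (cvge_S (u := fun n => (F 1 - F (expR (- n%:R)))%:E)).
apply: (cvg_unique _ cvg1'); first exact: ereal_hausdorff.
apply: cvg_trans cvg2'; apply: near_eq_cvg; apply: nearW => n.
have dF' (v : R) : expR (- n.+1%:R) <= v <= 1 -> is_derive v 1 F (ln (1 + l / v)).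
  by move=> /andP[nv _]; apply: dF; exact: lt_le_trans (expR_gt0 _) nv.
rewrite (integral_is_derive _ dF')//.
move=> v /andP[nv _]; have v0 := lt_le_trans (expR_gt0 _) nv.
apply: is_derive_continuous; apply: is_derive_ln_pt.
  by rewrite addr_gt0// divr_gt0.
apply: is_deriveD_pt; apply: is_deriveZ_pt; apply: is_deriveV_pt.
by rewrite gt_eqF.
Qed.

End frullani.

(** * The function [exp (z log z - (1 + z) log (1 + z))] on the half-plane *)

Lemma bounded_fubini_setM {d1 d2 : measure_display} {T1 : measurableType d1}
    {T2 : measurableType d2} {R : realType}
    (m1 : {sigma_finite_measure set T1 -> \bar R})
    (m2 : {sigma_finite_measure set T2 -> \bar R})
    (A : set T1) (B : set T2) (f : T1 -> T2 -> R) (M : R) :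
  measurable A -> measurable B -> (m1 A < +oo)%E -> (m2 B < +oo)%E ->
  measurable_fun (A `*` B) (fun z => f z.1 z.2) ->
  (forall x y, A x -> B y -> `|f x y| <= M) ->
  (\int[m1]_(x in A) \int[m2]_(y in B) (f x y)%:E =
   \int[m2]_(y in B) \int[m1]_(x in A) (f x y)%:E)%E.
Proof.
move=> mA mB Afin Bfin mf fM.
pose F := (fun z => (f z.1 z.2)%:E) \_ (A `*` B).
have mAB : measurable (A `*` B) by exact: measurableX.
have iF : (m1 \x m2)%E.-integrable setT F.
  apply/(integrable_mkcond _ mAB).
  apply: (@bounded_integrable _ _ _ _ _ _ M) => //.
    rewrite /= product_measure1E// lte_mul_pinfty ?ge0_fin_numE//.
  by move=> [x y] [/= Ax By]; exact: fM.
transitivity (\int[m1]_x \int[m2]_y F (x, y))%E; last first.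
  rewrite (Fubini iF).
  rewrite [RHS]integral_mkcond; apply: eq_integral => y _.
  rewrite patchE; case: ifPn => [yB|yB].
    rewrite [RHS]integral_mkcond; apply: eq_integral => x _.
    rewrite /F !patchE; congr (if _ then _ else _).
    by apply/idP/idP; rewrite !inE => // xA; [case: xA|split => //=; rewrite inE in yB].
  rewrite integral0_eq// => x _; rewrite /F patchE memNset// => -[/= _ By].
  by rewrite notin_setE in yB.
rewrite [LHS]integral_mkcond; apply: eq_integral => x _.
rewrite patchE; case: ifPn => [xA|xA].
  rewrite integral_mkcond; apply: eq_integral => y _.
  rewrite /F !patchE; congr (if _ then _ else _).
  by apply/idP/idP; rewrite !inE => // yB; [split => //=; rewrite inE in xA|case: yB].
rewrite integral0_eq// => y _; rewrite /F patchE memNset// => -[/= Ax _].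
by rewrite notin_setE in xA.
Qed.

Section upper_half_plane.
Context {R : realType}.
Implicit Types (x y t : R).

(** For [z = x + i y] with [0 < y]: [lg] and [ag] are the real and imaginary
    parts of [log z], [Wre] and [Wim] those of
    [W = z log z - (1 + z) log (1 + z)], [U] and [V] those of [exp W], [pp] and
    [qq] those of [W' = log z - log (1 + z)], and [Ux] and [Vx] those of
    [(exp W)' = W' exp W]. The argument is written with [atan (x / y)], which is
    smooth on the whole open half-plane. *)
Definition lg x y : R := ln (x ^+ 2 + y ^+ 2) / 2.
Definition ag x y : R := pi / 2 - atan (x / y).

Definition Wre x y :=
  x * lg x y - y * ag x y - ((1 + x) * lg (1 + x) y - y * ag (1 + x) y).
Definition Wim x y :=
  y * lg x y + x * ag x y - (y * lg (1 + x) y + (1 + x) * ag (1 + x) y).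

Definition U x y := expR (Wre x y) * cos (Wim x y).
Definition V x y := expR (Wre x y) * sin (Wim x y).

Definition pp x y := lg x y - lg (1 + x) y.
Definition qq x y := ag x y - ag (1 + x) y.

Definition Ux x y := U x y * pp x y - V x y * qq x y.
Definition Vx x y := U x y * qq x y + V x y * pp x y.

Lemma sqrD_gt0 x y : 0 < y -> 0 < x ^+ 2 + y ^+ 2.
Proof. by move=> y0; rewrite ltr_wpDl ?sqr_ge0// exprn_gt0. Qed.

(** Derivatives are taken along an arbitrary curve [t |-> (x t, y t)], which
    yields at once the derivatives along radii and along half circles. *)
Section along_a_curve.
Variables (x y : R -> R) (t x' y' : R).
Hypothesis y0 : 0 < y t.
Hypothesis dx : is_derive t 1 x x'.
Hypothesis dy : is_derive t 1 y y'.

Lemma is_derive_lg : is_derive t 1 (fun t => lg (x t) (y t))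
  ((x t * x' + y t * y') / (x t ^+ 2 + y t ^+ 2)).
Proof.
have N0 := sqrD_gt0 (x t) y0.
have dxx := is_deriveM_pt dx dx; have dyy := is_deriveM_pt dy dy.
have dN := is_deriveD_pt dxx dyy.
have N0' : 0 < x t * x t + y t * y t by rewrite -!expr2.
have := is_deriveZ_pt (2^-1) (is_derive_ln_pt (f := fun t => x t * x t + y t * y t) N0' dN).
rewrite (_ : (fun _ => _) = (fun t => lg (x t) (y t))); last first.
  by apply/funext => s; rewrite /lg mulrC -!expr2.
by move=> D; apply: (is_derive_eq D); field; rewrite gt_eqF.
Qed.

Lemma is_derive_ag : is_derive t 1 (fun t => ag (x t) (y t))
  ((x t * y' - y t * x') / (x t ^+ 2 + y t ^+ 2)).
Proof.
have N0 := sqrD_gt0 (x t) y0.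
have D1 := is_deriveM_pt dx (is_deriveV_pt (lt0r_neq0 y0) dy).
have D2 := is_deriveB_pt (is_derive_cst (pi / 2) t 1) (is_derive_atan_pt D1).
apply: (is_derive_eq D2); field.
rewrite gt_eqF//= gt_eqF// (_ : _ + _ = x t ^+ 2 + y t ^+ 2)//.
Qed.

End along_a_curve.

Section along_a_curve_holomorphic.
Variables (x y : R -> R) (t x' y' : R).
Hypothesis y0 : 0 < y t.
Hypothesis dx : is_derive t 1 x x'.
Hypothesis dy : is_derive t 1 y y'.

Let dx1 : is_derive t 1 (fun t => 1 + x t) x'.
Proof. by rewrite -[x']add0r; apply: is_deriveD_pt. Qed.

Let dl := is_derive_lg y0 dx dy.
Let dl1 := is_derive_lg y0 dx1 dy.
Let da := is_derive_ag y0 dx dy.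
Let da1 := is_derive_ag y0 dx1 dy.

Lemma is_derive_Wre : is_derive t 1 (fun t => Wre (x t) (y t))
  (x' * pp (x t) (y t) - y' * qq (x t) (y t)).
Proof.
have N0 := sqrD_gt0 (x t) y0; have N1 := sqrD_gt0 (1 + x t) y0.
have D := is_deriveB_pt
  (is_deriveB_pt (is_deriveM_pt dx dl) (is_deriveM_pt dy da))
  (is_deriveB_pt (is_deriveM_pt dx1 dl1) (is_deriveM_pt dy da1)).
apply: (is_derive_eq D); rewrite /pp /qq.
move: (lg _ _) (lg _ _) (ag _ _) (ag _ _) => l l1 a a1.
by field; rewrite !gt_eqF.
Qed.

Lemma is_derive_Wim : is_derive t 1 (fun t => Wim (x t) (y t))
  (y' * pp (x t) (y t) + x' * qq (x t) (y t)).
Proof.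
have N0 := sqrD_gt0 (x t) y0; have N1 := sqrD_gt0 (1 + x t) y0.
have D := is_deriveB_pt
  (is_deriveD_pt (is_deriveM_pt dy dl) (is_deriveM_pt dx da))
  (is_deriveD_pt (is_deriveM_pt dy dl1) (is_deriveM_pt dx1 da1)).
apply: (is_derive_eq D); rewrite /pp /qq.
move: (lg _ _) (lg _ _) (ag _ _) (ag _ _) => l l1 a a1.
by field; rewrite !gt_eqF.
Qed.

(** This lemma and the next one are the Cauchy-Riemann equations for [exp W]. *)
Lemma is_derive_U : is_derive t 1 (fun t => U (x t) (y t))
  (x' * Ux (x t) (y t) - y' * Vx (x t) (y t)).
Proof.
have D := is_deriveM_pt (is_derive_exp_pt is_derive_Wre)
  (is_derive_cos_pt is_derive_Wim).
by apply: (is_derive_eq D); rewrite /Ux /Vx /U /V; ring.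
Qed.

Lemma is_derive_V : is_derive t 1 (fun t => V (x t) (y t))
  (x' * Vx (x t) (y t) + y' * Ux (x t) (y t)).
Proof.
have D := is_deriveM_pt (is_derive_exp_pt is_derive_Wre)
  (is_derive_sin_pt is_derive_Wim).
by apply: (is_derive_eq D); rewrite /Ux /Vx /U /V; ring.
Qed.

Lemma continuous_Ux : {for t, continuous (fun t => Ux (x t) (y t))}.
Proof.
have dp := is_deriveB_pt dl dl1; have dq := is_deriveB_pt da da1.
exact: is_derive_continuous (is_deriveB_pt (is_deriveM_pt is_derive_U dp)
  (is_deriveM_pt is_derive_V dq)).
Qed.

Lemma continuous_Vx : {for t, continuous (fun t => Vx (x t) (y t))}.
Proof.
have dp := is_deriveB_pt dl dl1; have dq := is_deriveB_pt da da1.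
exact: is_derive_continuous (is_deriveD_pt (is_deriveM_pt is_derive_U dq)
  (is_deriveM_pt is_derive_V dp)).
Qed.

End along_a_curve_holomorphic.

Lemma lgN x y : lg (- x) y = lg x y.
Proof. by rewrite /lg sqrrN. Qed.

Lemma le_lg x1 x2 y : 0 < y -> `|x1| <= `|x2| -> lg x1 y <= lg x2 y.
Proof.
move=> y0 x12; rewrite ler_pM2r ?invr_gt0// ler_ln ?posrE ?sqrD_gt0// lerD2r.
by rewrite -(real_normK (num_real x1)) -(real_normK (num_real x2)) lerXn2r// nnegrE.
Qed.

Lemma ln_le_lg x y : 0 < y -> ln y <= lg x y.
Proof.
move=> y0; rewrite ler_pdivlMr// mulr_natr -lnXn// ler_ln ?posrE ?sqrD_gt0 ?exprn_gt0//.
by rewrite lerDr sqr_ge0.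
Qed.

Lemma ln_le_lg' x y : 0 < x -> 0 < y -> ln x <= lg x y.
Proof.
by move=> x0 y0; rewrite (_ : lg x y = lg y x) ?ln_le_lg// /lg addrC.
Qed.

Lemma le_ag x1 x2 y : 0 < y -> x1 <= x2 -> ag x2 y <= ag x1 y.
Proof. by move=> y0 x12; rewrite lerB// le_atan// ler_pM2r// invr_gt0. Qed.

Lemma ag_ge0 x y : 0 <= ag x y.
Proof. by rewrite subr_ge0 ltW// atan_ltpi2. Qed.

Lemma ag_le_pi x y : ag x y <= pi.
Proof. have := atan_gtNpi2 (x / y); rewrite /ag; lra. Qed.

(** Since [ag] decreases along horizontal lines, the two arguments only lower
    the real part of [W]. *)
Lemma Wre_le x y : 0 < y -> Wre x y <= x * lg x y - (1 + x) * lg (1 + x) y.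
Proof.
move=> y0; have : y * ag (1 + x) y <= y * ag x y.
  by rewrite ler_pM2l// le_ag// lerDr.
rewrite /Wre; lra.
Qed.

Lemma xlnx_geN x : 0 < x -> x - 1 <= xlnx x.
Proof.
move=> x0; have := le_ln1Dx (x := x^-1 - 1).
rewrite (addrC 1) subrK lnV ?posrE// => h.
have : - ln x <= x^-1 - 1 by apply: h; rewrite ltrBrDr addNr invr_gt0.
move=> /(ler_wpM2l (ltW x0)); rewrite mulrBr mulfV ?gt_eqF// /xlnx; lra.
Qed.

(** For [0 <= x] both bounds come from monotonicity of [lg], and the part
    [x <= -1] is the reflection of this one in the line [x = -1/2]. For
    [-1 < x < 0] the combination [- x * lg x y + (1 + x) * lg (1 + x) y] has
    positive weights of sum 1, so it is at least [ln y]; it is at least -1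
    because [t - 1 <= t ln t]. The first bound makes bounded convergence
    applicable, the second one gives decay at infinity. *)
Lemma Wre_bounds x y : 0 < y -> Wre x y <= 1 /\ Wre x y <= - ln y.
Proof.
move=> y0; have W := Wre_le x y0.
have pos (z : R) : 0 <= z ->
    z * lg z y - (1 + z) * lg (1 + z) y <= 0 /\
    z * lg z y - (1 + z) * lg (1 + z) y <= - ln y.
  move=> z0.
  have h1 : z * lg z y <= z * lg (1 + z) y.
    rewrite ler_wpM2l// le_lg// !ger0_norm ?addr_ge0//.
    by rewrite lerDr.
  have h2 := ln_le_lg (1 + z) y0.
  have h3 : 0 <= lg (1 + z) y.
    rewrite -(ln1 R); apply: (@le_trans _ _ (ln (1 + z))).
      by rewrite ler_ln ?posrE ?lerDl// ltr_wpDr.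
    by rewrite ln_le_lg'// ltr_wpDr.
  by split; lra.
have [x0|x0] := leP 0 x; first by have [h1 h2] := pos _ x0; split; lra.
have [x1|x1] := leP x (-1).
  have [|h1 h2] := pos (- (1 + x)); first lra.
  move: h1 h2; rewrite lgN (_ : 1 - (1 + x) = - x); last by ring.
  by rewrite lgN => h1 h2; split; lra.
have y1 := ln_le_lg x y0; have y2 := ln_le_lg (1 + x) y0.
have h1 : - x * ln y <= - x * lg x y by rewrite ler_wpM2l//; lra.
have h2 : (1 + x) * ln y <= (1 + x) * lg (1 + x) y by rewrite ler_wpM2l//; lra.
split; last lra.
have h3 : - x * ln (- x) <= - x * lg x y.
  by rewrite ler_wpM2l//; [lra|rewrite -(lgN x); apply: ln_le_lg'; lra].
have h4 : (1 + x) * ln (1 + x) <= (1 + x) * lg (1 + x) y.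
  by rewrite ler_wpM2l//; [lra|apply: ln_le_lg'; lra].
have h5 := @xlnx_geN (- x); have h6 := @xlnx_geN (1 + x).
have : - x - 1 <= xlnx (- x) by apply: h5; lra.
have : 1 + x - 1 <= xlnx (1 + x) by apply: h6; lra.
rewrite /xlnx; lra.
Qed.

Lemma normU_le x y : 0 < y -> `|U x y| <= expR 1.
Proof.
move=> y0; rewrite /U normrM ger0_norm ?expR_ge0// -[leRHS]mulr1 ler_pM ?expR_ge0//.
  by rewrite ler_expR; case: (Wre_bounds x y0).
by rewrite cos_max.
Qed.

Lemma normV_le x y : 0 < y -> `|V x y| <= expR 1.
Proof.
move=> y0; rewrite /V normrM ger0_norm ?expR_ge0// -[leRHS]mulr1 ler_pM ?expR_ge0//.
  by rewrite ler_expR; case: (Wre_bounds x y0).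
by rewrite sin_max.
Qed.

Lemma normU_le_inv x y : 0 < y -> `|U x y| <= y^-1.
Proof.
move=> y0; rewrite /U normrM ger0_norm ?expR_ge0// -[leRHS]mulr1 ler_pM ?expR_ge0//.
  rewrite -[leRHS]lnK ?posrE ?invr_gt0// ler_expR lnV ?posrE//.
  by case: (Wre_bounds x y0).
by rewrite cos_max.
Qed.

(** Limits at the real axis are taken along sequences of points [(X n, Y n)] of
    the open half-plane. *)
Section boundary_values.
Variables (X Y : nat -> R) (x0 : R).
Hypothesis Xx0 : X n @[n --> \oo] --> x0.
Hypothesis Y0 : Y n @[n --> \oo] --> (0 : R).
Hypothesis Ygt0 : forall n, 0 < Y n.

Lemma cvg_lg : x0 != 0 -> lg (X n) (Y n) @[n --> \oo] --> ln `|x0|.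
Proof.
move=> x00.
have -> : ln `|x0| = ln (x0 ^+ 2 + 0 ^+ 2) / 2.
  rewrite expr0n/= addr0 -(real_normK (num_real x0)) lnXn ?normr_gt0//.
  lra.
apply: cvgMl; apply: continuous_cvg.
  by apply: continuous_ln; rewrite expr0n/= addr0 exprn_even_gt0//=.
by apply: cvgD; rewrite expr2; apply: cvgM.
Qed.

Lemma cvg_ag_gt0 : 0 < x0 -> ag (X n) (Y n) @[n --> \oo] --> (0 : R).
Proof.
move=> x00; rewrite -(subrr (pi / 2)); apply: cvgB; first exact: cvg_cst.
apply: (cvg_comp (fun n => X n / Y n) atan); last exact: cvgy_atan.
have h : (Y n)^-1 @[n --> \oo] --> +oo%R.
  apply/(gtr0_cvgV0 (f := fun n => (Y n)^-1)).
    by apply: nearW => n; rewrite invr_gt0.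
  by apply: cvg_trans Y0; apply: near_eq_cvg; apply: nearW => n /=; rewrite invrK.
have x20 : 0 < x0 / 2 by rewrite divr_gt0.
apply/cvgryPge => A; near=> n.
apply: (@le_trans _ _ ((x0 / 2) * (Y n)^-1)).
  rewrite -ler_pdivrMl//; near: n.
  by move/cvgryPge : h; exact.
rewrite ler_pM2r ?invr_gt0//; near: n.
apply: (cvgr_ge _ Xx0); lra.
Unshelve. all: end_near. Qed.

End boundary_values.

Lemma agN x y : ag (- x) y = pi - ag x y.
Proof. by rewrite /ag mulNr atanN; lra. Qed.

Lemma cvg_ag (X Y : nat -> R) x0 :
  X n @[n --> \oo] --> x0 -> Y n @[n --> \oo] --> (0 : R) ->
  (forall n, 0 < Y n) -> x0 != 0 ->
  ag (X n) (Y n) @[n --> \oo] --> (if x0 < 0 then pi else 0 : R).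
Proof.
move=> Xx0 Y0 Ygt0 x00; have [xn|xp] := ltP x0 0; last first.
  by apply: cvg_ag_gt0 Xx0 Y0 Ygt0 _; rewrite lt_neqAle eq_sym x00.
rewrite (_ : (fun n => _) = (fun n => pi - ag (- X n) (Y n))); last first.
  by apply/funext => n; rewrite agN subKr.
rewrite -[X in _ --> X]subr0; apply: cvgB; first exact: cvg_cst.
apply: (@cvg_ag_gt0 (fun n => - X n) _ (- x0)) => //; last by rewrite oppr_gt0.
exact: cvgN.
Qed.

(** The continuous density, up to the factor [pi^-1], of the law whose Stieltjes
    transform is computed below. *)
Definition rho (s : R) : R := sin (pi * s) * expR (- (xlnx s + xlnx (1 - s))).

Lemma measurable_rho : measurable_fun setT rho.
Proof.
have mx (f : R -> R) : measurable_fun setT f -> measurable_fun setT (fun x => xlnx (f x)).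
  move=> mf; apply: measurable_funM => //.
  exact: (measurableT_comp (f := @ln R)).
apply: measurable_funM.
  apply: (measurableT_comp (f := @sin R)); last exact: measurable_funM.
  by apply: continuous_measurable_fun; exact: continuous_sin.
apply: measurableT_comp => //; apply: measurableT_comp => //.
by apply: measurable_funD; apply: mx => //; exact: measurable_funB.
Qed.

Lemma rho_ge0 s : 0 <= s <= 1 -> 0 <= rho s.
Proof.
move=> /andP[s0 s1]; have p0 := @pi_gt0 R.
rewrite mulr_ge0 ?expR_ge0// sin_ge0_pi// mulr_ge0 ?(ltW p0)//=.
by rewrite -[leRHS]mulr1 ler_pM2l.
Qed.

(** At [x0] the arguments of [z] and [1 + z] tend to 0 or [pi] according to the
    signs of [x0] and [1 + x0]. The imaginary part of [W] therefore tends to 0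
    for [0 < x0], to [pi * x0] for [-1 < x0 < 0] and to [- pi] for [x0 < -1], and
    [V] has a nonzero limit in the middle case only. *)
Section boundary_values_W.
Variables (X Y : nat -> R) (x0 : R).
Hypothesis Xx0 : X n @[n --> \oo] --> x0.
Hypothesis Y0 : Y n @[n --> \oo] --> (0 : R).
Hypothesis Ygt0 : forall n, 0 < Y n.
Hypothesis x00 : x0 != 0.
Hypothesis x01 : 1 + x0 != 0.

Let X1 : 1 + X n @[n --> \oo] --> 1 + x0.
Proof. by apply: cvgD => //; exact: cvg_cst. Qed.

Let angle (z : R) : R := if z < 0 then pi else 0.

Lemma cvg_Wre : Wre (X n) (Y n) @[n --> \oo] -->
  x0 * ln `|x0| - (1 + x0) * ln `|1 + x0|.
Proof.
have -> : x0 * ln `|x0| - (1 + x0) * ln `|1 + x0| =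
  x0 * ln `|x0| - 0 * angle x0 - ((1 + x0) * ln `|1 + x0| - 0 * angle (1 + x0)).
  by rewrite !mul0r !subr0.
apply: cvgB; apply: cvgB; apply: cvgM => //; try exact: cvg_lg; exact: cvg_ag.
Qed.

Lemma cvg_Wim : Wim (X n) (Y n) @[n --> \oo] -->
  x0 * angle x0 - (1 + x0) * angle (1 + x0).
Proof.
have -> : x0 * angle x0 - (1 + x0) * angle (1 + x0) =
  0 * ln `|x0| + x0 * angle x0 - (0 * ln `|1 + x0| + (1 + x0) * angle (1 + x0)).
  by rewrite !mul0r !add0r.
apply: cvgB; apply: cvgD; apply: cvgM => //; try exact: cvg_lg; exact: cvg_ag.
Qed.

Lemma cvg_V_right : 0 < x0 -> V (X n) (Y n) @[n --> \oo] --> (0 : R).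
Proof.
move=> xp; have := cvg_Wim; rewrite /angle !ltNge !ltW//= ?addr_gt0//=.
rewrite !mulr0 subr0 => h.
rewrite -(mulr0 (expR (x0 * ln `|x0| - (1 + x0) * ln `|1 + x0|))) -(sin0 R).
apply: cvgM; apply: continuous_cvg => //;
  [exact: continuous_expR|exact: cvg_Wre|exact: continuous_sin].
Qed.

Lemma cvg_V_left : -1 < x0 < 0 -> V (X n) (Y n) @[n --> \oo] --> - rho (- x0).
Proof.
move=> /andP[xl xr]; have := cvg_Wim; rewrite /angle xr ltNge.
have x1 : 0 < 1 + x0 by lra.
rewrite (ltW x1)/= mulr0 subr0 => h.
have -> : - rho (- x0) =
    expR (x0 * ln `|x0| - (1 + x0) * ln `|1 + x0|) * sin (x0 * pi).
  rewrite /rho mulrN sinN (mulrC pi) mulNr opprK [LHS]mulrC; congr (expR _ * _).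
  by rewrite /xlnx ltr0_norm// gtr0_norm// opprK; ring.
apply: cvgM; apply: continuous_cvg => //;
  [exact: continuous_expR|exact: cvg_Wre|exact: continuous_sin].
Qed.

Lemma cvg_V_far_left : x0 < -1 -> V (X n) (Y n) @[n --> \oo] --> (0 : R).
Proof.
move=> xl; have := cvg_Wim; rewrite /angle.
have -> : x0 < 0 by lra.
have -> : 1 + x0 < 0 by lra.
rewrite -mulrBl (_ : x0 - _ = -1) ?mulN1r => [h|]; last by ring.
rewrite -(mulr0 (expR (x0 * ln `|x0| - (1 + x0) * ln `|1 + x0|))).
rewrite -[X in _ * X]oppr0 -(sinpi R) -sinN.
apply: cvgM; apply: continuous_cvg => //;
  [exact: continuous_expR|exact: cvg_Wre|exact: continuous_sin].
Qed.

Lemma cvg_U_right : 0 < x0 -> U (X n) (Y n) @[n --> \oo] -->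
  expR (xlnx x0 - xlnx (1 + x0)).
Proof.
move=> xp; have := cvg_Wim; rewrite /angle !ltNge !ltW//= ?addr_gt0//=.
rewrite !mulr0 subr0 => h.
have -> : expR (xlnx x0 - xlnx (1 + x0)) =
    expR (x0 * ln `|x0| - (1 + x0) * ln `|1 + x0|) * cos 0.
  by rewrite cos0 mulr1 !gtr0_norm ?addr_gt0.
apply: cvgM; apply: continuous_cvg => //;
  [exact: continuous_expR|exact: cvg_Wre|exact: continuous_cos].
Qed.

End boundary_values_W.

Section measurability.
Context {d : measure_display} {T : measurableType d}.
Variables (D : set T) (f g : T -> R).
Hypotheses (mf : measurable_fun D f) (mg : measurable_fun D g).

Lemma measurable_sqrD : measurable_fun D (fun z => f z ^+ 2 + g z ^+ 2).
Proof. by apply: measurable_funD; exact: measurable_funX. Qed.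

Lemma measurable_lg : measurable_fun D (fun z => lg (f z) (g z)).
Proof.
apply: measurable_funM => //; apply: (measurableT_comp (f := @ln R)) => //.
exact: measurable_sqrD.
Qed.

Lemma measurable_ag : measurable_fun D (fun z => ag (f z) (g z)).
Proof.
apply: measurable_funB => //; apply: (measurableT_comp (f := @atan R)).
  apply: continuous_measurable_fun; exact: continuous_atan.
by apply: measurable_funM => //; exact: measurable_inv.
Qed.

End measurability.

Section measurability2.
Context {d : measure_display} {T : measurableType d}.
Variables (D : set T) (f g : T -> R).
Hypotheses (mf : measurable_fun D f) (mg : measurable_fun D g).

Let mf1 : measurable_fun D (fun z => 1 + f z).
Proof. exact: measurable_funD. Qed.

Let ml := measurable_lg mf mg. Let ml1 := measurable_lg mf1 mg.
Let ma := measurable_ag mf mg. Let ma1 := measurable_ag mf1 mg.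

Lemma measurable_Wre : measurable_fun D (fun z => Wre (f z) (g z)).
Proof. by apply: measurable_funB; apply: measurable_funB; exact: measurable_funM. Qed.

Lemma measurable_Wim : measurable_fun D (fun z => Wim (f z) (g z)).
Proof. by apply: measurable_funB; apply: measurable_funD; exact: measurable_funM. Qed.

Lemma measurable_U : measurable_fun D (fun z => U (f z) (g z)).
Proof.
apply: measurable_funM; first exact: measurableT_comp measurable_Wre.
apply: (measurableT_comp (f := @cos R)) measurable_Wim.
by apply: continuous_measurable_fun; exact: continuous_cos.
Qed.

Lemma measurable_V : measurable_fun D (fun z => V (f z) (g z)).
Proof.
apply: measurable_funM; first exact: measurableT_comp measurable_Wre.
apply: (measurableT_comp (f := @sin R)) measurable_Wim.
by apply: continuous_measurable_fun; exact: continuous_sin.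
Qed.

Lemma measurable_Ux : measurable_fun D (fun z => Ux (f z) (g z)).
Proof.
have mp := measurable_funB ml ml1; have mq := measurable_funB ma ma1.
by apply: measurable_funB; apply: measurable_funM => //;
  [exact: measurable_U|exact: measurable_V].
Qed.

Lemma measurable_Vx : measurable_fun D (fun z => Vx (f z) (g z)).
Proof.
have mp := measurable_funB ml ml1; have mq := measurable_funB ma ma1.
by apply: measurable_funD; apply: measurable_funM => //;
  [exact: measurable_U|exact: measurable_V].
Qed.

End measurability2.


(** * Integrals over half circles and the Stieltjes representation *)

Section half_circles.
Variable l : R.
Hypothesis l0 : 0 < l.

Notation mu := (@lebesgue_measure R).

Definition px (s th : R) : R := l + (l + s) * cos th.
Definition py (s th : R) : R := (l + s) * sin th.

Lemma py_gt0 s th : - l < s -> 0 < th < pi -> 0 < py s th.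
Proof. by move=> s0 th0; rewrite mulr_gt0 ?sin_gt0_pi//; lra. Qed.

Let dpx_s (s th : R) : is_derive s 1 (px ^~ th) (cos th).
Proof.
rewrite (_ : (px ^~ th) = (fun s => l + cos th * (l + s))).
  have D := is_deriveD_pt (is_derive_cst l s 1) (is_deriveZ_pt (cos th)
    (is_deriveD_pt (is_derive_cst l s 1) (is_derive_id s 1))).
  by apply: (is_derive_eq D); rewrite !add0r mulr1.
by apply/funext => z; rewrite /px mulrC.
Qed.

Let dpy_s (s th : R) : is_derive s 1 (py ^~ th) (sin th).
Proof.
rewrite (_ : (py ^~ th) = (fun s => sin th * (l + s))).
  by apply: is_derive_eq; rewrite /GRing.scale/= !add0r mulr1.
by apply/funext => z; rewrite /py mulrC.
Qed.

Let dpx_th (s th : R) : is_derive th 1 (px s) (- ((l + s) * sin th)).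
Proof.
have D := is_deriveD_pt (is_derive_cst l th 1)
  (is_deriveZ_pt (l + s) (is_derive_cos th)).
by apply: (is_derive_eq D); rewrite add0r mulrN.
Qed.

Let dpy_th (s th : R) : is_derive th 1 (py s) ((l + s) * cos th).
Proof. exact: is_deriveZ_pt (is_derive_sin th). Qed.

(** The radial derivative of [U] at the point of angle [th] of the half circle of
    radius [l + s]. By the Cauchy-Riemann equations it is also the angular
    derivative of [V] divided by [l + s]. *)
Definition dUds s th := cos th * Ux (px s th) (py s th) - sin th * Vx (px s th) (py s th).

Let measurable_px : measurable_fun setT (fun z : R * R => px z.1 z.2).
Proof.
apply: measurable_funD => //; apply: measurable_funM.
  exact: measurable_funD.
apply: (measurableT_comp (f := @cos R)) => //.
by apply: continuous_measurable_fun; exact: continuous_cos.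
Qed.

Let measurable_py : measurable_fun setT (fun z : R * R => py z.1 z.2).
Proof.
apply: measurable_funM; first exact: measurable_funD.
apply: (measurableT_comp (f := @sin R)) => //.
by apply: continuous_measurable_fun; exact: continuous_sin.
Qed.

Let measurable_dUds : measurable_fun setT (fun z : R * R => dUds z.1 z.2).
Proof.
apply: measurable_funB; apply: measurable_funM.
- apply: (measurableT_comp (f := @cos R)) => //.
  by apply: continuous_measurable_fun; exact: continuous_cos.
- exact: measurable_Ux.
- apply: (measurableT_comp (f := @sin R)) => //.
  by apply: continuous_measurable_fun; exact: continuous_sin.
- exact: measurable_Vx.
Qed.

Let sin_ge (th dl : R) : 0 < dl < pi / 2 -> dl <= th <= pi - dl -> sin dl <= sin th.
Proof.
move=> /andP[dl0 dl2] /andP[h1 h2].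
have mono (a : R) : dl <= a <= pi / 2 -> sin dl <= sin a.
  move=> /andP[a1 a2]; rewrite le_eqVlt in a1; case/predU1P : a1 => [->//|a1].
  by rewrite ltW// ltr_sin// in_itv/=; apply/andP; split; lra.
have [h|h] := leP th (pi / 2); first by apply: mono; rewrite h1.
have -> : sin th = sin (pi - th) by rewrite addrC sinDpi sinN opprK.
by apply: mono; apply/andP; split; lra.
Qed.

(** On a compact set of radii and for angles at distance [dl] from the real
    axis, [y] is at least [(l + a) * sin dl] and [x^2 + y^2] is bounded; this
    bounds the logarithms in [pp], the only possibly large factors. *)
Let dUds_bounded (a b dl : R) : - l < a -> a <= b -> 0 < dl < pi / 2 ->
  exists M : R, forall s th, a <= s <= b -> dl <= th <= pi - dl -> `|dUds s th| <= M.
Proof.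
move=> la ab dl0.
have sdl : 0 < sin dl by apply: sin_gt0_pi; have := @pi_gt0 R; lra.
pose m := ln (((l + a) * sin dl) ^+ 2); pose B := ln ((2 * l + b + 1) ^+ 2 + (l + b) ^+ 2).
pose L : R := `|m| + `|B|.
exists (2 * (expR 1 * (2 * L) + expR 1 * (2 * pi))) => s th /andP[as_ sb] th0.
have sth := sin_ge dl0 th0.
have y0 : 0 < py s th by rewrite mulr_gt0//; lra.
have lgL (x : R) : `|x| <= 2 * l + b + 1 -> `|lg x (py s th)| <= L.
  move=> xB; have N0 := sqrD_gt0 x y0.
  have h1 : m <= ln (x ^+ 2 + py s th ^+ 2).
    rewrite ler_ln ?posrE//; last by rewrite exprn_gt0// mulr_gt0//; lra.
    have e1 : (l + a) * sin dl <= py s th by rewrite ler_pM// ?(ltW sdl)//; lra.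
    rewrite ler_wpDl ?sqr_ge0// lerXn2r ?nnegrE ?(ltW y0)//.
    by rewrite mulr_ge0// ?(ltW sdl)//; lra.
  have h2 : ln (x ^+ 2 + py s th ^+ 2) <= B.
    rewrite ler_ln ?posrE// ?lerD//.
    - rewrite -(real_normK (num_real x)) lerXn2r// nnegrE.
      by apply: le_trans xB.
    - have e1 : py s th <= l + b.
        rewrite /py -[leRHS]mulr1 ler_pM ?sin_le1//; try lra.
      by rewrite lerXn2r ?nnegrE ?(ltW y0)//; lra.
    - by rewrite ltr_wpDl ?sqr_ge0// exprn_gt0//; lra.
  have := ler_norm m; have := ler_norm (- m); have := ler_norm B.
  have := ler_norm (- B); rewrite !normrN /lg => *.
  have n0 : 0 <= `|m| by []; have n1 : 0 <= `|B| by [].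
  by rewrite ler_norml /L; apply/andP; split; lra.
have pxB : `|px s th| <= 2 * l + b.
  rewrite /px (le_trans (ler_normD _ _))// normrM (gtr0_norm l0) ger0_norm; last lra.
  have := cos_max th => c1.
  have : (l + s) * `|cos th| <= (l + s) * 1 by rewrite ler_wpM2l//; lra.
  lra.
have pL : `|pp (px s th) (py s th)| <= 2 * L.
  rewrite (le_trans (ler_normB _ _))// mulrDl mul1r lerD// lgL//; first lra.
  by rewrite (le_trans (ler_normD _ _))// normr1; lra.
have qL : `|qq (px s th) (py s th)| <= 2 * pi.
  have := ag_ge0 (px s th) (py s th); have := ag_le_pi (px s th) (py s th).
  have := ag_ge0 (1 + px s th) (py s th); have := ag_le_pi (1 + px s th) (py s th).
  by rewrite /qq ler_norml => *; apply/andP; split; lra.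
have UL := normU_le (px s th) y0; have VL := normV_le (px s th) y0.
have UxL : `|Ux (px s th) (py s th)| <= expR 1 * (2 * L) + expR 1 * (2 * pi).
  by rewrite (le_trans (ler_normB _ _))//; apply: lerD; rewrite normrM ler_pM.
have VxL : `|Vx (px s th) (py s th)| <= expR 1 * (2 * L) + expR 1 * (2 * pi).
  by rewrite addrC (le_trans (ler_normD _ _))//; apply: lerD; rewrite normrM ler_pM.
rewrite (le_trans (ler_normB _ _))// !normrM [leRHS]mulrDl mul1r.
apply: lerD.
  by rewrite -[leRHS]mul1r ler_pM ?cos_max.
by rewrite -[leRHS]mul1r ler_pM ?sin_max.
Qed.

Let is_derive_dUds (s th : R) : - l < s -> 0 < th < pi ->
  is_derive s 1 (fun s => U (px s th) (py s th)) (dUds s th).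
Proof. by move=> s0 th0; exact: (@is_derive_U (px ^~ th) (py ^~ th) s _ _ (py_gt0 s0 th0) (dpx_s s th) (dpy_s s th)). Qed.

Let is_derive_dVdth (s th : R) : - l < s -> 0 < th < pi ->
  is_derive th 1 (fun th => V (px s th) (py s th)) ((l + s) * dUds s th).
Proof.
move=> s0 th0; apply: (is_derive_eq (is_derive_V (py_gt0 s0 th0) (dpx_th s th) (dpy_th s th))).
by rewrite /dUds; ring.
Qed.

(** Integrate the radial derivative in the radius and then in the angle, or, as
    the angular derivative of [V], in the angle first. *)
Lemma half_circle_increment (a b dl : R) : - l < a -> a < b -> 0 < dl < pi / 2 ->
  (\int[mu]_(th in `[dl, (pi - dl)%R]) (U (px b th) (py b th) - U (px a th) (py a th))%:E =
   \int[mu]_(s in `[a, b]) ((V (px s (pi - dl)) (py s (pi - dl)) - V (px s dl) (py s dl))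
     / (l + s))%:E)%E.
Proof.
move=> la ab /andP[dl0 dl2].
have [|M dUM] := dUds_bounded la (ltW ab) (dl := dl); first by rewrite dl0.
have itv th : dl <= th <= pi - dl -> 0 < th < pi by move=> /andP[? ?]; apply/andP; split; lra.
transitivity (\int[mu]_(th in `[dl, (pi - dl)%R]) \int[mu]_(s in `[a, b]) (dUds s th)%:E)%E.
  apply: eq_integral => th; rewrite inE/= in_itv/= => /itv th0.
  have D s : a <= s <= b -> is_derive s 1 (fun s => U (px s th) (py s th)) (dUds s th).
    by move=> /andP[as_ _]; apply: is_derive_dUds => //; lra.
  rewrite (integral_is_derive ab D)//.
  - move=> s /andP[as_ _]; have ls : - l < s by lra.
    apply: cvgB; apply: cvgM; try exact: cvg_cst.
    + exact: (@continuous_Ux (px ^~ th) (py ^~ th) s _ _ (py_gt0 ls th0) (dpx_s s th) (dpy_s s th)).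
    + exact: (@continuous_Vx (px ^~ th) (py ^~ th) s _ _ (py_gt0 ls th0) (dpx_s s th) (dpy_s s th)).
etransitivity.
  apply/esym; apply: (@bounded_fubini_setM _ _ _ _ _ mu mu _ _ dUds M) => //=.
  - by rewrite lebesgue_measure_itv/= lte_fin ab -EFinB ltry.
  - by rewrite lebesgue_measure_itv/=; case: ifP => _; rewrite -?EFinB ltry.
  - exact: measurable_funTS.
apply: eq_integral => s; rewrite inE/= in_itv/= => /andP[as_ _].
have ls : - l < s by lra.
have D th : dl <= th <= pi - dl ->
    is_derive th 1 (fun th => (l + s)^-1 * V (px s th) (py s th)) (dUds s th).
  move=> /itv th0; apply: (is_derive_eq (is_deriveZ_pt _ (is_derive_dVdth ls th0))).
  by rewrite mulKf// gt_eqF//; lra.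
rewrite (integral_is_derive _ D).
- by rewrite -mulrBr mulrC.
- lra.
- move=> th /itv th0; apply: cvgB; apply: cvgM.
  + exact: continuous_cos.
  + exact: (continuous_Ux (py_gt0 ls th0) (dpx_th s th) (dpy_th s th)).
  + exact: continuous_sin.
  + exact: (continuous_Vx (py_gt0 ls th0) (dpx_th s th) (dpy_th s th)).
Qed.

Let cut (n : nat) : R := pi / 2 * (n.+2%:R)^-1.

Let cut0 n : 0 < cut n < pi / 2.
Proof.
have p0 := @pi_gt0 R; have h : 0 < pi / 2 :> R by lra.
by rewrite /cut mulr_gt0 ?invr_gt0// gtr_pMr// invf_lt1 ?ltr1n.
Qed.

Let cvg_cut : cut n @[n --> \oo] --> (0 : R).
Proof.
rewrite -(mulr0 (pi / 2)); apply: cvgMr.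
apply/gtr0_cvgV0; first exact: nearW.
have := @cvgr_idn R; rewrite -(cvg_shiftn 2).
by under eq_fun do rewrite addn2.
Qed.

Let U_boundedM s th : - l < s -> 0 < th < pi -> `|U (px s th) (py s th)| <= expR 1.
Proof. by move=> s0 th0; apply: normU_le; exact: py_gt0. Qed.

Let measurable_Upx (s : R) (D : set R) :
  measurable_fun D (fun th => U (px s th) (py s th)).
Proof.
apply: measurable_funTS; apply: measurable_U.
- apply: measurable_funD => //; apply: measurable_funM => //.
  by apply: continuous_measurable_fun; exact: continuous_cos.
- apply: measurable_funM => //.
  by apply: continuous_measurable_fun; exact: continuous_sin.
Qed.

Let measurable_Vpx (th : R) (D : set R) :
  measurable_fun D (fun s => V (px s th) (py s th)).
Proof.
apply: measurable_funTS; apply: measurable_V.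
- by apply: measurable_funD => //; apply: measurable_funM => //; exact: measurable_funD.
- by apply: measurable_funM => //; exact: measurable_funD.
Qed.

Let cvg_px_right (s : R) : px s (cut n) @[n --> \oo] --> l + (l + s).
Proof.
apply: cvgD; first exact: cvg_cst.
rewrite -[X in _ --> X]mulr1 -(cos0 R); apply: cvgMr.
by apply: continuous_cvg => //; exact: continuous_cos.
Qed.

Let cvg_px_left (s : R) : px s (pi - cut n) @[n --> \oo] --> - s.
Proof.
rewrite (_ : - s = l + (l + s) * cos (pi - 0)); last by rewrite subr0 cospi; ring.
apply: cvgD; first exact: cvg_cst.
apply: cvgMr; apply: continuous_cvg; first exact: continuous_cos.
by apply: cvgB => //; exact: cvg_cst.
Qed.

Let cvg_py_right (s : R) : py s (cut n) @[n --> \oo] --> (0 : R).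
Proof.
rewrite -(mulr0 (l + s)) -(sin0 R); apply: cvgMr.
by apply: continuous_cvg => //; exact: continuous_sin.
Qed.

Let cvg_py_left (s : R) : py s (pi - cut n) @[n --> \oo] --> (0 : R).
Proof.
rewrite (_ : (fun n => _) = (fun n => py s (cut n))); first exact: cvg_py_right.
by apply/funext => n; rewrite /py (addrC pi) sinDpi sinN opprK.
Qed.

(** The angle [dl] tends to 0: the end points become the real points
    [l + (l + s)], where [V] vanishes, and [- s], where [V] is [- rho s] on the
    unit interval and vanishes elsewhere. The two exceptional values 0 and 1 of
    [s], where a logarithm is singular, form a null set. *)
Lemma half_circle_increment_closed (a b : R) : - l < a < 0 -> 1 < b ->
  (\int[mu]_(th in `]0%R, pi[) (U (px b th) (py b th) - U (px a th) (py a th))%:E =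
   - \int[mu]_(s in `[0%R, 1%R]) (rho s / (l + s))%:E)%E.
Proof.
move=> /andP[la a0] b1.
have p0 := @pi_gt0 R.
have ab : a < b by lra.
have lb : - l < b by lra.
have cutpi n : 0 < cut n < pi by have /andP[? ?] := cut0 n; apply/andP; split; lra.
have cutpi' n : 0 < pi - cut n < pi by have /andP[? ?] := cut0 n; apply/andP; split; lra.
pose f th := U (px b th) (py b th) - U (px a th) (py a th).
have mf D : measurable_fun D f by exact: measurable_funB.
have cvg1 : (\int[mu]_(th in `[cut n, (pi - cut n)%R]) (f th)%:E)%E @[n --> \oo]
    --> (\int[mu]_(th in `]0%R, pi[) (f th)%:E)%E.
  rewrite (_ : (fun n => _) = (fun n => \int[mu]_(th in `]0%R, pi[)
      (f th * \1_(`[cut n, pi - cut n]) th)%:E)%E); last first.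
    apply/funext => n; rewrite [LHS]integral_mkcond [RHS]integral_mkcond.
    apply: eq_integral => th _; rewrite !patchE !mem_setE !in_itv/= indicE mem_setE in_itv/=.
    case: ifPn => [/andP[c1 c2]|_]; last by rewrite mulr0; case: ifP.
    have /andP[? ?] := cutpi n.
    by rewrite mulr1 (lt_le_trans _ c1)//= (le_lt_trans c2)//; lra.
  apply: (@bounded_cvg_integral _ _ _ _ _ _ _ (expR 1 + expR 1)) => //.
  - by rewrite /= lebesgue_measure_itv/= lte_fin p0 -EFinB ltry.
  - by move=> n; apply: measurable_funM; [exact: mf|exact: measurable_indic].
  - exact: mf.
  - move=> n th; rewrite /= in_itv/= => th0.
    rewrite normrM -[leRHS]mulr1 ler_pM//.
      by rewrite (le_trans (ler_normB _ _))// lerD// U_boundedM.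
    by rewrite indicE; case: (_ \in _); rewrite ?normr1 ?normr0.
  - apply/aeW => th; rewrite /= in_itv/= => /andP[t0 t1].
    apply: cvg_near_cst; near=> n.
    rewrite indicE mem_set ?mulr1//= in_itv/=; apply/andP; split.
      by near: n; apply: (cvgr_le _ cvg_cut).
    rewrite lerBrDl -lerBrDr; near: n; apply: (cvgr_le _ cvg_cut); lra.
pose g n s := (V (px s (pi - cut n)) (py s (pi - cut n)) - V (px s (cut n)) (py s (cut n)))
     / (l + s).
pose gl s := - (rho s / (l + s)) * \1_(`[0, 1]) s.
have cvg2 : (\int[mu]_(s in `[a, b]) (g n s)%:E)%E @[n --> \oo] -->
    (\int[mu]_(s in `[a, b]) (gl s)%:E)%E.
  apply: (@bounded_cvg_integral _ _ _ _ _ _ _ ((expR 1 + expR 1) * (l + a)^-1)) => //.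
  - by rewrite /= lebesgue_measure_itv/= lte_fin ab -EFinB ltry.
  - move=> n; apply: measurable_funM.
      by apply: measurable_funB; exact: measurable_Vpx.
    by apply: measurable_inv; exact: measurable_funD.
  - apply: measurable_funM => //; apply: measurableT_comp => //.
    apply: measurable_funM; first exact: measurable_funTS measurable_rho.
    by apply: measurable_inv; exact: measurable_funD.
  - move=> n s; rewrite /= in_itv/= => /andP[as_ _].
    have ls : - l < s by lra.
    rewrite normrM ler_pM//.
      by rewrite (le_trans (ler_normB _ _))// lerD// normV_le// py_gt0.
    rewrite gtr0_norm ?invr_gt0; last lra.
    by rewrite lef_pV2 ?posrE; lra.
  - have N : mu.-negligible [set 0; 1].
      exists [set 0; 1]; split => //; first exact: measurableU.
      by apply: countable_lebesgue_measure0; apply: finite_set_countable.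
    apply: (negligibleS _ N) => s /=; apply: contraPP => /not_orP[s0 s1].
    move=> H; apply: H; rewrite in_itv/= => /andP[as_ sb].
    have ls : - l < s by lra.
    rewrite /gl -mulNr mulrAC; apply: cvgMl; rewrite -[X in _ --> X]subr0.
    have pos_r n : 0 < py s (cut n) by exact: py_gt0.
    have pos_l n : 0 < py s (pi - cut n) by exact: py_gt0.
    apply: cvgB; last first.
      by apply: (@cvg_V_right
        (fun n => px s (cut n)) (fun n => py s (cut n)) (l + (l + s))) => //;
        rewrite ?gt_eqF//; lra.
    have [sn|sp|//] := ltgtP s 0.
      rewrite indicE memNset ?mulr0; last by rewrite /= in_itv/= leNgt sn.
      by apply: (@cvg_V_right
        (fun n => px s (pi - cut n)) (fun n => py s (pi - cut n)) (- s)) => //;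
        rewrite ?gt_eqF//; lra.
    have [s1n|s1p|//] := ltgtP s 1; last first.
      rewrite indicE memNset ?mulr0; last by rewrite /= in_itv/= [_ <= 1]leNgt s1p andbF.
      by apply: (@cvg_V_far_left
        (fun n => px s (pi - cut n)) (fun n => py s (pi - cut n)) (- s)) => //;
        rewrite ?lt_eqF//; lra.
    rewrite indicE mem_set ?mulr1/= ?in_itv/= ?(ltW sp) ?(ltW s1n)//.
    rewrite -[X in rho X]opprK.
    apply: (@cvg_V_left
      (fun n => px s (pi - cut n)) (fun n => py s (pi - cut n)) (- s)) => //.
    - by rewrite lt_eqF//; lra.
    - by rewrite gt_eqF//; lra.
    - by apply/andP; split; lra.
apply: (cvg_unique _ cvg1); first exact: ereal_hausdorff.
rewrite (_ : (- _)%E = (\int[mu]_(s in `[a, b]) (gl s)%:E)%E).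
  apply: cvg_trans cvg2; apply: near_eq_cvg; apply: nearW => n.
  by rewrite half_circle_increment.
rewrite -integral_ge0N; last first.
  move=> s; rewrite /= in_itv/= => /andP[s0 s1]; rewrite lee_fin.
  by rewrite divr_ge0 ?rho_ge0 ?s0//; lra.
rewrite [LHS]integral_mkcond [RHS]integral_mkcond; apply: eq_integral => s _.
rewrite !patchE !mem_setE !in_itv/= /gl indicE mem_setE in_itv/=.
case: ifPn => [/andP[s0 s1]|_]; last by rewrite mulr0; case: ifP.
by rewrite mulr1 EFinN (le_trans (ltW a0) s0) (le_trans s1 (ltW b1)).
Unshelve. all: end_near. Qed.

(** Let the radius go from 0 to infinity: the integral over the half circle
    starts from [pi] times the value at the centre, and tends to 0 because
    [`|U|] is at most [y^-1]. *)
Lemma stieltjes_rho :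
  (\int[mu]_(s in `[0%R, 1%R]) (rho s / (l + s))%:E =
   (pi * expR (xlnx l - xlnx (1 + l)))%:E)%E.
Proof.
have p0 := @pi_gt0 R.
(* The radii are [l / (n + 2)] and [l + n + 2]; the interval [a n, b n] contains
   [0, 1] for every [n]. *)
pose a n : R := l * (n.+2%:R)^-1 - l; pose b n : R := n.+2%:R.
have n2 n : 0 < (n.+2%:R : R)^-1 < 1 by rewrite invr_gt0 ltr0n/= invf_lt1 ?ltr1n.
have an n : - l < a n < 0.
  have /andP[? ?] := n2 n; rewrite /a ltrDr mulr_gt0//= subr_lt0.
  by rewrite gtr_pMr.
have inv0 : (n.+2%:R : R)^-1 @[n --> \oo] --> (0 : R).
  apply/gtr0_cvgV0; first exact: nearW.
  have := @cvgr_idn R; rewrite -(cvg_shiftn 2).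
  by under eq_fun do rewrite addn2.
set K := RHS.
have cvg1 : (\int[mu]_(th in `]0%R, pi[)
    (U (px (b n) th) (py (b n) th) - U (px (a n) th) (py (a n) th))%:E)%E
    @[n --> \oo] --> (\int[mu]_(th in `]0%R, pi[)
     (0 - expR (xlnx l - xlnx (1 + l)))%:E)%E.
  apply: (@bounded_cvg_integral _ _ _ _ _ _ _ (expR 1 + expR 1)) => //.
  - by rewrite /= lebesgue_measure_itv/= lte_fin p0 -EFinB ltry.
  - by move=> n; apply: measurable_funB; exact: measurable_Upx.
  - move=> n th; rewrite /= in_itv/= => th0; have /andP[? ?] := an n.
    rewrite (le_trans (ler_normB _ _))// lerD// U_boundedM//.
    by rewrite /b (lt_trans (_ : - l < 0)) ?oppr_lt0.
  - apply/aeW => th; rewrite /= in_itv/= => th0.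
    have sth := sin_gt0_pi th0.
    apply: cvgB.
      apply: norm_cvg0; apply: (@squeeze_cvgr _ _ _ _ (cst 0)
        (fun n => (sin th)^-1 * (n.+2%:R)^-1)).
      + apply: nearW => n; rewrite normr_ge0/=.
        have lb : - l < b n by rewrite /b (lt_trans (_ : - l < 0)) ?oppr_lt0.
        rewrite (le_trans (normU_le_inv _ (py_gt0 lb th0)))//.
        rewrite /py invfM mulrC ler_pM2l ?invr_gt0//.
        by rewrite lef_pV2 ?posrE /b ?ltr0n// ?lerDr ?addr_gt0// ltW.
      + exact: cvg_cst.
      + by rewrite -[X in _ --> X](mulr0 (sin th)^-1); exact: cvgMr.
    apply: (@cvg_U_right (fun n => px (a n) th) (fun n => py (a n) th) l) => //.
    + rewrite -[X in _ --> X]addr0; apply: cvgD; first exact: cvg_cst.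
      rewrite -(mul0r (cos th)); apply: cvgMl.
      rewrite (_ : (fun n => _) = (fun n => l * (n.+2%:R)^-1)).
        by rewrite -[X in _ --> X](mulr0 l); exact: cvgMr.
      by apply/funext => n; rewrite /a addrC subrK.
    + rewrite -(mul0r (sin th)); apply: cvgMl.
      rewrite (_ : (fun n => _) = (fun n => l * (n.+2%:R)^-1)).
        by rewrite -[X in _ --> X](mulr0 l); exact: cvgMr.
      by apply/funext => n; rewrite /a addrC subrK.
    + by move=> n; apply: py_gt0 => //; case/andP: (an n).
    + by rewrite gt_eqF.
    + by rewrite gt_eqF// addr_gt0.
have : (- (\int[mu]_(s in `[0%R, 1%R]) (rho s / (l + s))%:E) = - K)%E.
  rewrite (_ : - K = \int[mu]_(th in `]0%R, pi[)
     (0 - expR (xlnx l - xlnx (1 + l)))%:E)%E; last first.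
    rewrite integral_cst//= lebesgue_measure_itv/= lte_fin p0 -EFinB subr0.
    by rewrite sub0r /K -EFinM mulNr mulrC.
  apply/esym; apply: (cvg_unique _ cvg1); first exact: ereal_hausdorff.
  apply: cvg_near_cst; apply: nearW => n.
  by rewrite half_circle_increment_closed// /b ltr1n.
by move=> /(congr1 -%E); rewrite !oppeK.
Qed.

End half_circles.
End upper_half_plane.

(** * Laws of nonnegative variables from their Laplace transforms *)

Lemma measurable_expRN {R : realType} (c : R) (D : set R) :
  measurable_fun D (fun x => (expR (- (c * x)))%:E).
Proof.
apply/measurable_EFinP; apply: measurable_funTS.
apply: measurableT_comp => //; apply: measurableT_comp => //.
Qed.

Lemma measurable_fun_integral_set {d1 d2 : measure_display}
    {T1 : measurableType d1} {T2 : measurableType d2} {R : realType}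
    (m2 : {sigma_finite_measure set T2 -> \bar R})
    (f : T1 -> T2 -> R) (B : set T2) :
  measurable B -> measurable_fun setT (fun z => f z.1 z.2) ->
  (forall x y, B y -> (0 <= f x y)) ->
  measurable_fun setT (fun x => \int[m2]_(y in B) (f x y)%:E)%E.
Proof.
move=> mB mf f0.
pose F z : \bar R := (f z.1 z.2 * \1_B z.2)%:E.
rewrite (_ : (fun x => _) = fun x => (\int[m2]_y F (x, y))%E); last first.
  apply/funext => x; rewrite [LHS]integral_mkcond; apply: eq_integral => y _.
  by rewrite patchE /F/= indicE; case: ifPn => _; rewrite ?mulr1// mulr0.
apply: (measurable_fun_fubini_tonelli_F F) => //.
- apply/measurable_EFinP; apply: measurable_funM => //.
  apply: (measurableT_comp (f := (\1_B : T2 -> R))) => //; exact: measurable_indic.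
- move=> [x y]; rewrite /F/= lee_fin indicE.
  have [|_] := boolP (y \in _); last by rewrite mulr0.
  by rewrite inE mulr1; exact: f0.
Qed.

Arguments measurable_fun_integral_set {d1 d2 T1 T2 R} m2 f.

Section laws_from_laplace_transforms.
Context {R : realType}.

(** The total mass is the monotone limit of the Laplace transform at 0. *)
Lemma laplace_mass_le1 (nu : {measure set (measurableTypeR R) -> \bar R}) :
  nu `]-oo, 0[%classic = 0%E ->
  (forall l : R, 0 < l ->
     (\int[nu]_(x in `[0%R, +oo[) (expR (- (l * x)))%:E <= 1)%E) ->
  (nu setT <= 1)%E.
Proof.
move=> nu0 h.
have -> : nu setT = nu `[0, +oo[%classic.
  rewrite -(setvU `]-oo, 0[%classic) setCitvl measureU//=.
  - by rewrite -[RHS]adde0; congr (_ + _)%E.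
  - by rewrite setIC -setCitvl setICr.
have -> : nu `[0, +oo[%classic = (\int[nu]_(x in `[0%R, +oo[) (1%:E))%E.
  by rewrite integral_cst// mul1e.
pose g (n : nat) (x : R) : \bar R := (expR (- (n.+1%:R^-1 * x)))%:E.
have gcvg x : g n x @[n --> \oo] --> 1%:E.
  apply: cvg_EFin; first exact: nearW.
  rewrite -(expR0 R) -oppr0; apply: continuous_cvg; first exact: continuous_expR.
  apply: cvgN; rewrite -(mul0r x); apply: cvgMl; exact: cvg_harmonic.
rewrite (eq_integral (fun x : measurableTypeR R => limn (g ^~ x))); last first.
  by move=> x _; apply/esym/cvg_lim => //; exact: gcvg.
have := @cvg_monotone_convergence _ (measurableTypeR R) _ nu `[0%R, +oo[%classic (measurable_itv _) g.
move=> H; apply: cvge_le (H _ _ _).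
- apply: nearW => n; apply: h; by rewrite invr_gt0.
- move=> n; exact: measurable_expRN.
- by move=> n x _; rewrite lee_fin expR_ge0.
- move=> x; rewrite /= in_itv/= andbT => x0 m n mn.
  rewrite lee_fin ler_expR lerN2 ler_wpM2r// lef_pV2 ?posrE//.
  by rewrite ler_nat.
Qed.

Lemma laplace_unique_le1 (mu nu : {measure set (measurableTypeR R) -> \bar R}) :
  (mu setT <= 1)%E ->
  mu `]-oo, 0[%classic = 0%E -> nu `]-oo, 0[%classic = 0%E ->
  (forall l : R, 0 < l ->
    (\int[mu]_(x in `[0%R, +oo[) (expR (- (l * x)))%:E =
     \int[nu]_(x in `[0%R, +oo[) (expR (- (l * x)))%:E)%E) ->
  forall A, measurable A -> mu A = nu A.
Proof.
move=> mu1 mu0 nu0 h A mA.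
have fin1 (m : {measure set (measurableTypeR R) -> \bar R}) : (m setT <= 1 -> m setT < +oo)%E.
  by move=> m1; apply: le_lt_trans m1 _; rewrite ltry.
apply: laplace_unique => //; first exact: fin1.
apply: fin1; apply: laplace_mass_le1 => // l l0; rewrite -h//.
apply: le_trans mu1; rewrite -[leRHS]mul1e -integral_cst//.
apply: (@le_trans _ _ (\int[mu]_(x in `[0%R, +oo[) cst 1 x))%E.
  apply: ge0_le_integral => //.
  - exact: measurable_expRN.
  - move=> x; rewrite /= in_itv/= andbT => x0.
    by rewrite lee_fin expR_le1 oppr_le0 mulr_ge0// ltW.
by rewrite !integral_cst// !mul1e; apply: le_measure => //; rewrite inE.
Qed.

End laws_from_laplace_transforms.

Section laplace_of_variables.
Context {R : realType} {d : measure_display} {T : measurableType d}.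
Variable P : probability T R.

Lemma expectationE (X : T -> R) : ('E_P[X] = \int[P]_w (X w)%:E)%E.
Proof. by rewrite unlock. Qed.

Lemma ge0_integral_law (d' : measure_display) (U : measurableType d')
    (X : T -> U) (nu : {measure set U -> \bar R}) (f : U -> \bar R) :
  measurable_fun setT X -> (forall A, measurable A -> P (X @^-1` A) = nu A) ->
  measurable_fun setT f -> (forall x, 0 <= f x)%E ->
  (\int[P]_w f (X w) = \int[nu]_x f x)%E.
Proof.
move=> mX Xnu mf f0; transitivity (\int[pushforward P X]_x f x)%E.
  by rewrite ge0_integral_pushforward.
by apply: eq_measure_integral => A mA _; rewrite -Xnu.
Qed.

Lemma laplace_law (X : T -> R) (nu : {measure set (measurableTypeR R) -> \bar R}) :
  measurable_fun setT X -> (forall w, 0 <= X w) ->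
  nu `]-oo, 0[%classic = 0%E ->
  (forall l : R, 0 < l -> ('E_P[fun w => expR (- l * X w)] =
     \int[nu]_(x in `[0%R, +oo[) (expR (- (l * x)))%:E)%E) ->
  forall A : set (measurableTypeR R), measurable A -> P (X @^-1` A) = nu A.
Proof.
move=> mX X0 nu0 h A mA.
have XT : X @^-1` `[0, +oo[ = setT.
  by apply/seteqP; split => // w _; rewrite /= in_itv/= X0.
rewrite -[LHS]/(pushforward P (X : T -> measurableTypeR R) A).
apply: laplace_unique_le1 => //.
- by rewrite /= /pushforward preimage_setT probability_setT.
- rewrite /= /pushforward (_ : _ @^-1` _ = set0) ?measure0//.
  by rewrite -subset0 => w; rewrite /= in_itv/= ltNge X0.
- move=> l l0; rewrite -h// ge0_integral_pushforward//.
  + by rewrite XT expectationE; apply: eq_integral => w _; rewrite /= mulNr.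
  + exact: measurable_expRN.
Qed.

End laplace_of_variables.

Section laplace_exponents.
Context {R : realType}.
Notation mu := (@lebesgue_measure R).

Lemma gamma_process_laplace (d : measure_display) (T : measurableType d)
    (P : probability T R) (gam : subordinator P) (l t : R) :
  standard_gamma_process gam -> 0 <= l -> 0 <= t ->
  'E_P[fun w => expR (- l * gam t w)]%E = (expR (- (t * ln (1 + l))))%:E.
Proof.
move=> hgam l0 t0; rewrite hgam//.
rewrite (_ : (\int[_]_(_ in _) _)%E = (ln (1 + l))%:E)//.
rewrite -[X in 1 + X]divr1 -(frullani l0 ltr01).
by apply: eq_integral => x _; rewrite mulr1 -EFinM mulNr mulrA mulrAC.
Qed.

Lemma powRxx (x : R) : 0 <= x -> x `^ x = expR (xlnx x).
Proof.
rewrite le_eqVlt => /predU1P[<-|x0]; first by rewrite powRr0 /xlnx mul0r expR0.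
by rewrite /powR gt_eqF.
Qed.

Lemma uniform_levy_exponent (dG : measure_display) (TG : measurableType dG)
    (PG : probability TG R) (G : {RV PG >-> R}) (l : R) :
  has_law PG G (uniform_prob (@ltr01 R)) -> 0 <= l ->
  (\int[mu]_(x in `]0%R, +oo[) ((1 - expR (- l * x))%:E *
      ((x^-1)%:E * 'E_PG[fun w => expR (- x * G w)])) =
   (xlnx (1 + l) - xlnx l)%:E)%E.
Proof.
move=> [mG hG] l0.
have EG x : ('E_PG[fun w => expR (- x * G w)] =
    \int[mu]_(g in `]0%R, 1%R]) (expR (- (x * g)))%:E)%E.
  have me : measurable_fun setT (fun g : R => (expR (- (x * g)))%:E).
    exact: measurable_expRN.
  transitivity (\int[uniform_prob (@ltr01 R)]_g (expR (- (x * g)))%:E)%E.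
    rewrite expectationE.
    rewrite -(ge0_integral_law (nu := uniform_prob (@ltr01 R)) mG hG me); last by move=> g; rewrite lee_fin expR_ge0.
    by apply: eq_integral => w _ /=; rewrite mulNr.
  rewrite integral_uniform//.
  rewrite subr0 invr1 mul1e integral_itv_obnd_cbnd//.
  exact: measurable_funTS.
rewrite -integral_ln1Dl//.
transitivity (\int[mu]_(x in `]0%R, +oo[) \int[mu]_(g in `]0%R, 1%R])
   ((1 - expR (- (l * x))) * x^-1 * expR (- (x * g)))%:E)%E.
  apply: eq_integral => x; rewrite inE/= in_itv/= andbT => x0.
  rewrite EG muleA -EFinM -ge0_integralZl; [|by []| | |].
  - by apply: eq_integral => g _; rewrite -EFinM mulNr.
  - exact: measurable_expRN.
  - by move=> g _; rewrite lee_fin expR_ge0.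
  - rewrite lee_fin mulr_ge0// ?invr_ge0 ?(ltW x0)// subr_ge0 expR_le1 mulNr oppr_le0.
    by rewrite mulr_ge0// ltW.
etransitivity.
  apply: (@ge0_fubini_setM _ _ _ _ _ mu mu _ _ (fun x g =>
    ((1 - expR (- (l * (x : R)))) * x^-1 * expR (- (x * (g : R))))%:E)) => //.
  - apply/measurable_EFinP; apply: measurable_funTS.
    apply: measurable_funM; last first.
      apply: measurableT_comp => //; apply: measurableT_comp => //.
      exact: measurable_funM.
    apply: measurable_funM; last exact: measurable_inv.
    apply: measurable_funB => //.
    apply: measurableT_comp => //; apply: measurableT_comp => //.
    exact: measurable_funM.
  - move=> x g; rewrite /= in_itv/= andbT => x0 _; rewrite lee_fin.
    rewrite !mulr_ge0// ?expR_ge0// ?invr_ge0 ?(ltW x0)// subr_ge0 expR_le1 oppr_le0.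
    by rewrite mulr_ge0// ltW.
apply: eq_integral => g; rewrite inE/= in_itv/= => /andP[g0 _].
exact: frullani.
Qed.

End laplace_exponents.

(** * The density of the uniform subordinator at time 1 *)

Section density_of_Gamma1.
Context {R : realType}.
Notation mu := (@lebesgue_measure R).

Lemma rho_le (y : R) : 0 <= y <= 1 -> rho y <= expR 1.
Proof.
move=> /andP[y0 y1].
have x1 (z : R) : 0 <= z -> z - 1 <= xlnx z.
  rewrite le_eqVlt => /predU1P[<-|]; last exact: xlnx_geN.
  by rewrite /xlnx mul0r sub0r oppr_le0.
rewrite /rho -[leRHS]mul1r ler_pM ?expR_ge0 ?sin_le1//.
  rewrite sin_ge0_pi// mulr_ge0 ?(ltW (pi_gt0 R))//=.
  by rewrite -[leRHS]mulr1 ler_pM2l// pi_gt0.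
rewrite ler_expR; have := x1 _ y0; have := x1 (1 - y); lra.
Qed.

Lemma rhoE (y : R) : 0 <= y <= 1 ->
  rho y = sin (pi * y) / (y `^ y * (1 - y) `^ (1 - y)).
Proof.
move=> /andP[y0 y1]; rewrite !powRxx//; last by rewrite subr_ge0.
by rewrite -expRD -expRN.
Qed.

(** Literally the density of the theorem; [fGamE] expresses it with [rho]. *)
Definition fGam (x : R) : R := pi^-1 *
  (\int[lebesgue_measure]_(y in `[0, 1])
     (expR (- (x * y)) * sin (pi * y) / (y `^ y * (1 - y) `^ (1 - y)))) *
  \1_(`[0, +oo[) x.

Definition laplace_rho (x : R) : \bar R :=
  (\int[mu]_(y in `[0%R, 1%R]) (expR (- (x * y)) * rho y)%:E)%E.

Lemma laplace_rho_ge0 x : (0 <= laplace_rho x)%E.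
Proof.
apply: integral_ge0 => y; rewrite /= in_itv/= => y01.
by rewrite lee_fin mulr_ge0 ?expR_ge0 ?rho_ge0.
Qed.

Lemma laplace_rho_fin x : 0 <= x -> laplace_rho x \is a fin_num.
Proof.
move=> x0; apply: integrable_fin_num => //.
apply: (@bounded_integrable _ _ _ _ _ _ (expR 1)) => //.
- by rewrite /= lebesgue_measure_itv/= lte_fin ltr01 -EFinB ltry.
- apply: measurable_funTS; apply: measurable_funM; last exact: measurable_rho.
  by apply/measurable_EFinP; exact: measurable_expRN.
- move=> y; rewrite /= in_itv/= => /andP[y0 y1].
  have y01 : 0 <= y <= 1 by rewrite y0.
  have r0 := rho_ge0 y01; have r1 := rho_le y01.
  have e0 := expR_ge0 (- (x * y)).
  rewrite ger0_norm; last exact: mulr_ge0.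
  rewrite -[leRHS]mul1r; apply: ler_pM => //.
  by rewrite expR_le1 oppr_le0 mulr_ge0.
Qed.

Lemma measurable_laplace_rho : measurable_fun setT laplace_rho.
Proof.
apply: (measurable_fun_integral_set mu (fun x y : R => expR (- (x * y)) * rho y)) => //.
- apply: measurable_funM; last exact: measurableT_comp measurable_rho _.
  by apply: measurableT_comp => //; apply: measurableT_comp => //; exact: measurable_funM.
- by move=> x y; rewrite /= in_itv/= => y01; rewrite mulr_ge0 ?expR_ge0 ?rho_ge0.
Qed.

Lemma fGamE x : fGam x = pi^-1 * fine (laplace_rho x) * \1_(`[0, +oo[) x.
Proof.
rewrite /fGam /Rintegral; congr (_ * fine _ * _).
apply: eq_integral => y; rewrite inE/= in_itv/= => y01.
by rewrite rhoE// mulrA.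
Qed.

Lemma fGam_pos x : 0 <= x -> (fGam x)%:E = ((pi^-1)%:E * laplace_rho x)%E.
Proof.
move=> x0; rewrite fGamE indicE mem_set ?mulr1/= ?in_itv/= ?x0//.
by rewrite EFinM fineK// laplace_rho_fin.
Qed.

Lemma fGam_ge0 x : 0 <= fGam x.
Proof.
rewrite fGamE !mulr_ge0 ?invr_ge0 ?pi_ge0 ?fine_ge0 ?laplace_rho_ge0//.
Qed.

Lemma measurable_fGam : measurable_fun setT fGam.
Proof.
rewrite (_ : fGam = fun x => pi^-1 * fine (laplace_rho x) * \1_(`[0, +oo[) x).
  apply: measurable_funM => //; apply: measurable_funM => //.
  by apply: measurableT_comp => //; exact: measurable_laplace_rho.
by apply/funext => x; exact: fGamE.
Qed.

Let mrho D : measurable_fun D (@rho R).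
Proof. exact: measurable_funTS measurable_rho. Qed.

(** By Tonelli, integrals against [fGam] reduce to integrals of exponentials. *)
Lemma integral_fGam (I : interval R) (k : R -> R) :
  [set` I] `<=` `[0, +oo[ -> measurable_fun setT k -> (forall x, 0 <= k x) ->
  (\int[mu]_(x in [set` I]) (k x * fGam x)%:E =
   (pi^-1)%:E * \int[mu]_(y in `[0%R, 1%R]) ((rho y)%:E *
      \int[mu]_(x in [set` I]) (k x * expR (- (x * y)))%:E))%E.
Proof.
move=> I0 mk k0.
transitivity (\int[mu]_(x in [set` I]) ((pi^-1)%:E * \int[mu]_(y in `[0%R, 1%R])
    (k x * expR (- (x * y)) * rho y)%:E))%E.
  apply: eq_integral => x; rewrite inE => /I0; rewrite /= in_itv/= andbT => x0.
  rewrite EFinM fGam_pos// muleCA -ge0_integralZl//.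
  - by congr (_ * _)%E; apply: eq_integral => y _; rewrite -EFinM mulrA.
  - apply/measurable_EFinP; apply: measurable_funM; last exact: mrho.
    by apply/measurable_EFinP; exact: measurable_expRN.
  - move=> y; rewrite /= in_itv/= => y01.
    by rewrite lee_fin mulr_ge0 ?expR_ge0 ?rho_ge0.
  - by rewrite lee_fin.
rewrite ge0_integralZl//; last 3 first.
- apply: measurable_funTS.
  apply: (measurable_fun_integral_set mu (fun x y : R => k x * expR (- (x * y)) * rho y)) => //.
  + apply: measurable_funM; last exact: measurableT_comp measurable_rho _.
    apply: measurable_funM; first exact: measurableT_comp.
    by apply: measurableT_comp => //; apply: measurableT_comp => //; exact: measurable_funM.
  + move=> x y; rewrite /= in_itv/= => y01.
    by rewrite mulr_ge0 ?(rho_ge0 y01)// mulr_ge0// expR_ge0.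
- move=> x Ix; apply: integral_ge0 => y; rewrite /= in_itv/= => y01.
  by rewrite lee_fin mulr_ge0 ?(rho_ge0 y01)// mulr_ge0// expR_ge0.
- by rewrite lee_fin invr_ge0 pi_ge0.
congr (_ * _)%E; etransitivity.
  apply: (@ge0_fubini_setM _ _ _ _ _ mu mu _ _ (fun x y =>
    (k (x : R) * expR (- (x * (y : R))) * rho y)%:E)) => //.
  - apply/measurable_EFinP; apply: measurable_funTS; apply: measurable_funM.
      apply: measurable_funM; first exact: measurableT_comp.
      by apply: measurableT_comp => //; apply: measurableT_comp => //; exact: measurable_funM.
    exact: measurableT_comp measurable_rho _.
  - move=> x y Ix; rewrite /= in_itv/= => y01.
    by rewrite lee_fin mulr_ge0 ?(rho_ge0 y01)// mulr_ge0// expR_ge0.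
apply: eq_integral => y; rewrite inE/= in_itv/= => y01.
rewrite -ge0_integralZl; [|by []| | |].
- by apply: eq_integral => x _; rewrite -EFinM mulrC.
- apply/measurable_EFinP; apply: measurable_funM; first exact: measurable_funTS.
  apply: measurable_funTS; apply: measurableT_comp => //.
  by apply: measurableT_comp => //; exact: measurable_funM.
- by move=> x _; rewrite lee_fin mulr_ge0 ?expR_ge0.
- by rewrite lee_fin rho_ge0.
Qed.

Lemma laplace_fGam (l : R) : 0 < l ->
  (\int[mu]_(x in `[0%R, +oo[) (expR (- (l * x)) * fGam x)%:E =
   (expR (xlnx l - xlnx (1 + l)))%:E)%E.
Proof.
move=> l0.
rewrite (integral_fGam (k := fun x => expR (- (l * x))))//; last first.
  by apply/measurable_EFinP; exact: measurable_expRN.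
rewrite [X in (_ * X)%E](_ : _ =
    (\int[mu]_(y in `[0%R, 1%R]) (rho y / (l + y))%:E)%E).
  by rewrite stieltjes_rho// -EFinM mulKf// gt_eqF// pi_gt0.
apply: eq_integral => y; rewrite inE/= in_itv/= => /andP[y0 y1].
rewrite [X in (_ * X)%E](_ : _ = ((l + y)^-1)%:E) ?EFinM//.
rewrite -integral_expRN_itvy; last by rewrite ltr_wpDr.
by apply: eq_integral => x _; rewrite -expRD mulrDl opprD (mulrC x).
Qed.

(** The right-hand side, a Laplace transform at [x], will be compared with the
    one of [1 / D]. *)
Lemma tail_fGam (x : R) : 0 <= x ->
  (\int[mu]_(u in `]x, +oo[) (fGam u)%:E =
   \int[mu]_(y in `]0%R, 1%R]) (expR (- (x * y)) * (rho y / (pi * y)))%:E)%E.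
Proof.
move=> x0.
have := @integral_fGam `]x, +oo[ (cst 1).
under eq_integral do rewrite mul1r.
move=> ->//; last first.
  by move=> u; rewrite /= !in_itv/= !andbT => /ltW; exact: le_trans.
have mF : measurable_fun setT (fun y => ((rho y)%:E *
    \int[mu]_(u in `]x, +oo[) (cst 1 u * expR (- (u * y)))%:E)%E).
  apply: emeasurable_funM; first by apply/measurable_EFinP; exact: measurable_rho.
  apply: (measurable_fun_integral_set mu (fun y u : R => 1 * expR (- (u * y)))) => //.
    apply: measurable_funM => //; apply: measurableT_comp => //.
    by apply: measurableT_comp => //; exact: measurable_funM.
rewrite -[X in (_ * X)%E]integral_itv_obnd_cbnd; last exact: measurable_funTS.
rewrite -ge0_integralZl; last 4 first.
- by [].
- exact: measurable_funTS.
- move=> y; rewrite /= in_itv/= => /andP[y0 y1]; rewrite mule_ge0//.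
    by rewrite lee_fin rho_ge0// (ltW y0).
  by apply: integral_ge0 => u _; rewrite lee_fin mulr_ge0// expR_ge0.
- by rewrite lee_fin invr_ge0 pi_ge0.
apply: eq_integral => y; rewrite inE/= in_itv/= => /andP[y0 y1].
rewrite [X in (_ * (_ * X))%E](_ : _ = (expR (- (x * y)) / y)%:E).
  by rewrite -!EFinM invfM; congr EFin; ring.
under eq_integral do rewrite mul1r.
exact: integral_expRN_tail.
Qed.

Lemma fGam_has_law (d : measure_display) (T : measurableType d)
    (P : probability T R) (X : T -> R) :
  measurable_fun setT X -> (forall w, 0 <= X w) ->
  (forall l : R, 0 < l -> ('E_P[fun w => expR (- l * X w)] =
    (expR (xlnx l - xlnx (1 + l)))%:E)%E) ->
  has_density P X fGam.
Proof.
move=> mX X0 h; split; [exact: measurable_fGam|exact: fGam_ge0|split => //].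
move=> A mA.
pose nu : {measure set (measurableTypeR R) -> \bar R} :=
  density_measure mu measurable_fGam fGam_ge0.
apply: (@laplace_law _ _ _ P X nu) => //.
- rewrite /= /density_measure integral0_eq// => x; rewrite /= in_itv/= => x0.
  by rewrite fGamE indicE memNset ?mulr0//= in_itv/= andbT leNgt x0.
- move=> l l0; rewrite h// ge0_integral_density//.
  + by rewrite -laplace_fGam//; apply: eq_integral => x _; rewrite EFinM.
  + exact: measurable_expRN.
Qed.

End density_of_Gamma1.

(** * The density of the cofactor of an exponential variable *)

Lemma probability_setI_eq1 {R : realType} {d : measure_display}
    {T : measurableType d} (P : probability T R) (A F : set T) :
  measurable A -> measurable F -> P F = 1%E -> P (A `&` F) = P A.
Proof.
move=> mA mF PF; rewrite [RHS](measureDI P mA mF) -[LHS]add0e; congr (_ + _)%E.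
apply/esym/(@subset_measure0 _ _ _ P _ (~` F)) => //.
- exact: measurableD.
- exact: measurableC.
- by rewrite [LHS](probability_setC P mF) PF subee.
Qed.

Section density_of_D.
Context {R : realType} {d : measure_display} {T : measurableType d}.
Variables (P : probability T R) (E D : {RV P >-> R}).
Hypothesis lawE : has_law P E (exponential_prob 1).
Hypothesis indep : independent_pair P E D.
Hypothesis lawED : has_density P (fun w => E w * D w) fGam.
Notation mu := (@lebesgue_measure R).

Definition fD (x : R) : R :=
  sin (pi / x) / (pi * (x - 1) `^ (1 - x^-1)) * \1_(`[1, +oo[) x.

Let mE : measurable_fun setT E. Proof. by []. Qed.
Let mD : measurable_fun setT D. Proof. by []. Qed.

Lemma exponential_tail (c : R) : 0 <= c ->
  P (E @^-1` `]c, +oo[) = (expR (- c))%:E.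
Proof.
move=> c0; rewrite lawE.2//.
have := integral_expRN_tail c ltr01; rewrite divr1 mulr1 => <-.
rewrite /exponential_prob.
apply: eq_integral => x; rewrite inE/= in_itv/= andbT => cx.
rewrite exponential_pdfE; last by rewrite (le_trans c0)// ltW.
by rewrite mul1r mulN1r mulr1.
Qed.

Lemma exponential_neg : P (E @^-1` `]-oo, 0[) = 0%E.
Proof.
rewrite lawE.2// /exponential_prob integral0_eq// => x; rewrite /= in_itv/= => x0.
by rewrite lt0_exponential_pdf.
Qed.

(** Given [D], the product exceeds [x] when [E] exceeds [x / D] if [0 < D], and
    almost never otherwise because [0 <= E] almost surely. *)
Lemma tail_ED (x : R) : 0 <= x ->
  P [set w | x < E w * D w] =
  (\int[P]_(w in [set w | (0 < D w)%R]) (expR (- (x * (D w)^-1)))%:E)%E.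
Proof.
move=> x0.
pose S := [set z : R * R | x < z.2 * z.1].
have mS : measurable S.
  have mm : measurable_fun setT (fun z : R * R => z.2 * z.1) by exact: measurable_funM.
  rewrite (_ : S = (fun z : R * R => z.2 * z.1) @^-1` `]x, +oo[).
    by rewrite -[X in measurable X]setTI; exact: mm.
  by apply/seteqP; split => z; rewrite /S/= in_itv/= andbT.
have mED : measurable_fun setT (fun w => (D w, E w)) by exact: measurable_fun_pair.
have lawprod : (distribution P D \x distribution P E)%E S =
    pushforward P (fun w => (D w, E w)) S.
  apply: product_measure_unique => // A B mA mB.
  rewrite /= /distribution /pushforward/= muleC -indep//.
  by congr (P _); apply/seteqP; split => w [? ?].
rewrite -[LHS]/(pushforward P (fun w => (D w, E w)) S) -lawprod /product_measure1.
have mDpos : measurable [set w | (0 < D w)%R].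
  rewrite (_ : [set _ | _] = D @^-1` `]0, +oo[); last first.
    by apply/seteqP; split => z; rewrite /= in_itv/= andbT.
  by rewrite -[X in measurable X]setTI; exact: mD.
rewrite {1}/distribution ge0_integral_pushforward//; last first.
  exact: (measurable_fun_xsection (distribution P E)).
rewrite preimage_setT [RHS]integral_mkcond; apply: eq_integral => w _.
rewrite patchE; case: ifPn => [|Dw]; rewrite /= /pushforward.
  rewrite inE/= => D0; rewrite -exponential_tail; last by rewrite divr_ge0// ltW.
  congr (P _); apply/seteqP; split => v; rewrite /= /xsection/= inE /S/= in_itv/= andbT.
    by rewrite ltr_pdivrMr.
  by rewrite ltr_pdivrMr.
apply: (@subset_measure0 _ _ _ P _ (E @^-1` `]-oo, 0[%classic)) => //.
- by rewrite -[X in measurable X]setTI; apply: mE => //; exact: measurable_xsection.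
- by rewrite -[X in measurable X]setTI; exact: mE.
- move=> v; rewrite /= /xsection/= inE /S/= in_itv/= => h.
  rewrite notin_setE/= in Dw; move/negP: Dw; rewrite -leNgt => Dw.
  rewrite ltNge; apply/negP => Ev.
  by move: (lt_le_trans h (mulr_ge0_le0 Ev Dw)); rewrite ltNge x0.
- exact: exponential_neg.
Qed.

Let fG_tail (x : R) : 0 <= x -> P [set w | x < E w * D w] =
   (\int[mu]_(y in `]0%R, 1%R]) (expR (- (x * y)) * (rho y / (pi * y)))%:E)%E.
Proof.
move=> x0; rewrite -tail_fGam//.
have [_ _ [_ h]] := lawED; rewrite -h//; congr (P _).
by apply/seteqP; split => w; rewrite /= in_itv/= andbT.
Qed.

(** The density of [D^-1]. *)
Definition gD (y : R) : R := rho y / (pi * y) * \1_(`]0, 1]) y.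

Lemma gD_ge0 y : 0 <= gD y.
Proof.
rewrite /gD indicE; have [|_] := boolP (y \in _); last by rewrite mulr0.
rewrite inE/= in_itv/= mulr1 => /andP[y0 y1].
by rewrite divr_ge0 ?rho_ge0 ?(ltW y0)// mulr_ge0 ?pi_ge0 ?(ltW y0).
Qed.

Lemma measurable_gD : measurable_fun setT gD.
Proof.
apply: measurable_funM => //; apply: measurable_funM; first exact: measurable_rho.
by apply: measurable_inv; exact: measurable_funM.
Qed.

Let mDpos : measurable [set w | (0 < D w)%R].
Proof.
rewrite (_ : [set _ | _] = D @^-1` `]0, +oo[); last first.
  by apply/seteqP; split => z; rewrite /= in_itv/= andbT.
by rewrite -[X in measurable X]setTI; exact: mD.
Qed.

Let H w : measurableTypeR R := (D w)^-1.

Let mH : measurable_fun setT H. Proof. exact: measurable_inv. Qed.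

Let nu : {measure set (measurableTypeR R) -> \bar R} :=
  density_measure mu measurable_gD gD_ge0.

(** Positivity of [D] is not known yet, so [D^-1] is studied under the
    restriction of [P] to [0 < D]; [tail_ED] and [fG_tail] are two expressions of
    its Laplace transform. *)
Lemma law_invD (A : set (measurableTypeR R)) : measurable A ->
  P ([set w | (0 < D w)%R] `&` H @^-1` A) = nu A.
Proof.
move=> mA.
pose D1 := \1_[set w | (0 < D w)%R] : T -> R.
have mD1 : measurable_fun setT D1 by exact: measurable_indic.
have D10 w : 0 <= D1 w by [].
pose PD := density_measure P mD1 D10.
have PDE B : measurable B -> PD B = P ([set w | (0 < D w)%R] `&` B).
  by move=> mB; rewrite /PD /density_measure integral_indic.
have mHA B : measurable B -> measurable (H @^-1` B).
  by move=> mB; rewrite -[X in measurable X]setTI; exact: mH.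
have mHA' := mHA A mA.
rewrite -(PDE _ mHA') -[LHS]/(pushforward PD H A).
apply: laplace_unique_le1 => //.
- rewrite -[X in (X <= _)%E]/(PD (H @^-1` setT)) PDE ?preimage_setT//.
  by rewrite setIT probability_le1.
- have mneg : measurable (H @^-1` `]-oo, 0[) by apply: mHA; exact: measurable_itv.
  rewrite -[LHS]/(PD (H @^-1` `]-oo, 0[)) (PDE _ mneg) (_ : _ `&` _ = set0) ?measure0//.
  rewrite -subset0 => w; rewrite /= in_itv/= => -[h1 h2].
  by move: h2; rewrite ltNge invr_ge0 ltW.
- rewrite /nu /= /density_measure integral0_eq// => x; rewrite /= in_itv/= => x0.
  by rewrite /gD indicE memNset ?mulr0//= in_itv/= ltNge ltW.
- move=> l l0; rewrite [RHS]ge0_integral_density//; last exact: measurable_expRN.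
  rewrite ge0_integral_pushforward//; last exact: measurable_expRN.
  rewrite ge0_integral_density; last 3 first.
  + by apply: mHA; exact: measurable_itv.
  + by apply: measurable_funTS; apply: measurableT_comp => //; exact: measurable_expRN.
  + by move=> w _; rewrite lee_fin expR_ge0.
  transitivity (\int[P]_(w in [set w | (0 < D w)%R]) (expR (- (l * (D w)^-1)))%:E)%E.
    rewrite [LHS]integral_mkcond [RHS]integral_mkcond; apply: eq_integral => w _.
    rewrite !patchE /D1 indicE.
    have [Dw|_] := boolP (w \in [set w | (0 < D w)%R]); last by rewrite mule0; case: ifP.
    rewrite mem_set ?mule1// /= in_itv/= andbT invr_ge0.
    by rewrite inE/= in Dw; rewrite ltW.
  rewrite -tail_ED ?(ltW l0)// fG_tail ?(ltW l0)//.
  rewrite [LHS]integral_mkcond [RHS]integral_mkcond; apply: eq_integral => y _.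
  rewrite !patchE !mem_setE !in_itv/= -EFinM /gD indicE mem_setE in_itv/= andbT.
  case: ifPn => [/andP[y0 _]|_]; first by rewrite (ltW y0) mulr1.
  by rewrite !mulr0; case: ifP.
Qed.

(** Take [x = 0] in [tail_ED]: [0 < D] has the probability of [0 < E * D]. *)
Lemma D_pos : P [set w | (0 < D w)%R] = 1%E.
Proof.
have := tail_ED (lexx 0); rewrite (eq_integral (cst 1%E)); last first.
  by move=> w _; rewrite /= mul0r oppr0 expR0.
rewrite integral_cst// mul1e => <-.
have [_ _ [mED h]] := lawED.
have -> : [set w | 0 < E w * D w] = ~` ((fun w => E w * D w) @^-1` `]-oo, 0]).
  by apply/seteqP; split => w; rewrite /= in_itv/= ltNge => /negP.
have m0 : measurable ((fun w => E w * D w) @^-1` `]-oo, 0]).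
  by rewrite -[X in measurable X]setTI; exact: mED.
rewrite probability_setC//.
rewrite (_ : P _ = 0%E) ?sube0//; rewrite h//.
rewrite -integral_itv_bndo_bndc.
  rewrite integral0_eq// => x; rewrite /= in_itv/= => x0.
  by rewrite fGamE indicE memNset ?mulr0//= in_itv/= andbT leNgt x0.
by apply/measurable_EFinP; apply: measurable_funTS; exact: measurable_fGam.
Qed.

Lemma fD_ge0 x : 0 <= fD x.
Proof.
rewrite /fD indicE; have [|_] := boolP (x \in _); last by rewrite mulr0.
rewrite inE/= in_itv/= andbT mulr1 => x1.
have x0 : 0 < x by apply: lt_le_trans x1.
rewrite divr_ge0 ?mulr_ge0 ?powR_ge0 ?pi_ge0// sin_ge0_pi// divr_ge0 ?pi_ge0 ?(ltW x0)//=.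
by rewrite ler_pdivrMr// ler_peMr// pi_ge0.
Qed.

Lemma measurable_fD : measurable_fun setT fD.
Proof.
(* At [x = 1] the power is [0 `^ 0 = 1]; elsewhere it is an exponential. *)
rewrite (_ : fD = fun x => sin (pi / x) / (pi * (if x == 1 then 1 else
    expR ((1 - x^-1) * ln (x - 1)))) * \1_(`[1, +oo[) x); last first.
  apply/funext => x; rewrite /fD /powR subr_eq0.
  by case: eqVneq => [->|//]; rewrite invr1 subrr eqxx.
have mi : measurable_fun setT (fun x : R => x^-1) by exact: measurable_inv.
apply: measurable_funM => //; apply: measurable_funM.
  apply: (measurableT_comp (f := @sin R)); last exact: measurable_funM.
  by apply: continuous_measurable_fun; exact: continuous_sin.
apply: measurable_inv; apply: measurable_funM => //.
have mi1 : measurable_fun setT (fun x : R => 1 - x^-1) by exact: measurable_funB.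
apply: measurable_fun_ifT.
- exact: measurable_fun_eqr.
- exact: measurable_cst.
- apply: measurableT_comp => //; apply: measurable_funM => //.
  by apply: (measurableT_comp (f := @ln R)) => //; exact: measurable_funB.
Qed.

Lemma fD_gD (x : R) : 1 < x -> fD x = gD x^-1 * (x ^+ 2)^-1.
Proof.
move=> x1; have x0 : 0 < x by apply: lt_trans x1.
have xi : 0 < x^-1 < 1 by rewrite invr_gt0 x0 invf_lt1.
have /andP[xi0 xi1] := xi.
rewrite /fD /gD !indicE !mem_set ?mulr1/= ?in_itv/= ?(ltW x1) ?xi0 ?(ltW xi1)//.
rewrite /rho (_ : - _ = ln x - (1 - x^-1) * ln (x - 1)); last first.
  have -> : 1 - x^-1 = (x - 1) / x by field; rewrite gt_eqF.
  rewrite /xlnx lnV ?posrE// ln_div ?posrE ?subr_gt0//; field; by rewrite gt_eqF.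
rewrite expRD lnK ?posrE// expRN /powR gt_eqF ?subr_gt0//.
have e0 := expR_gt0 ((1 - x^-1) * ln (x - 1)); have p0 := @pi_gt0 R.
set z := sin (pi / x); set e := expR _ in e0 *.
clearbody z e; move: (pi : R) p0 => p p0; by field; rewrite !gt_eqF.
Qed.

Let lawD_of_D (A : set R) : measurable A ->
  P (D @^-1` A) = P ([set w | (0 < D w)%R] `&` D @^-1` A).
Proof.
move=> mA; have mDA : measurable (D @^-1` A).
  by rewrite -[X in measurable X]setTI; exact: mD.
by rewrite setIC probability_setI_eq1// D_pos.
Qed.

(** The change of variable [y = x^-1] is made on compact intervals away from 1,
    on which [rho x^-1] only involves logarithms of positive numbers. *)
Lemma law_D_itv (a b : R) : 1 < a -> a <= b ->
  P (D @^-1` `[a, b]) = (\int[mu]_(x in `[a, b]) (fD x)%:E)%E.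
Proof.
move=> a1 ab.
have a0 : 0 < a by apply: lt_trans a1.
have b0 : 0 < b by apply: lt_le_trans ab.
rewrite lawD_of_D//.
have -> : [set w | 0 < D w] `&` D @^-1` `[a, b] =
    [set w | 0 < D w] `&` H @^-1` `[b^-1, a^-1].
  apply/seteqP; split => w [/= D0]; rewrite !in_itv/= /H !lef_pV2 ?posrE//.
    by move=> /andP[-> ->].
  by move=> /andP[-> ->].
rewrite law_invD; last exact: measurable_itv.
rewrite /nu /= /density_measure.
pose G y := rho y / (pi * y) : R.
have GE : (\int[mu]_(y in `[(b^-1)%R, (a^-1)%R]) (gD y)%:E = \int[mu]_(y in `[(b^-1)%R, (a^-1)%R]) (G y)%:E)%E.
  apply: eq_integral => y; rewrite inE/= in_itv/= => /andP[y0 y1].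
  rewrite /gD indicE mem_set ?mulr1//= in_itv/=; apply/andP; split.
    by apply: lt_le_trans y0; rewrite invr_gt0.
  by rewrite (le_trans y1)// ltW// invf_lt1.
rewrite GE; have [<-|ab'] := eqVneq a b.
  by rewrite !set_itv1 !integral_set1.
have {}ab' : a < b by rewrite lt_neqAle ab'.
have dinv (x : R) : 0 < x -> is_derive x 1 (fun x : R => x^-1) (- 1 / x ^+ 2).
  by move=> x0; apply: is_deriveV_pt; rewrite gt_eqF.
have invE (x : R) : 0 < x -> ((fun x : R => x^-1)^`())%classic x = - 1 / x ^+ 2.
  by move=> x0; rewrite derive1E; apply: derive_val; exact: dinv.
have cinv (x : R) : 0 < x -> ((fun x : R => x^-1)^`())%classic y @[y --> x] --> - 1 / x ^+ 2.
  move=> x0; have c : - 1 / y ^+ 2 @[y --> x] --> - 1 / x ^+ 2.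
    apply: cvgMr; apply: cvgV; first by rewrite expf_neq0// gt_eqF.
    by rewrite expr2; under eq_fun do rewrite expr2; apply: cvgM.
  apply: cvg_trans c; apply: near_eq_cvg; near=> y.
  rewrite invE//; near: y; exact: lt_nbhsr.
have xlnx_c (z : R) : 0 < z -> {for z, continuous (@xlnx R)}.
  move=> z0; apply: (is_derive_continuous (a := 1 * ln z + z * (1 / z))).
  by apply: is_deriveM_pt; apply: is_derive_ln_pt.
rewrite (@integration_by_substitution_decreasing _ (fun x : R => x^-1) G a b ab).
- apply: eq_integral => x; rewrite inE/= in_itv/= => /andP[ax xb].
  have x1 : 1 < x by apply: lt_le_trans ax.
  have x0 : 0 < x by apply: lt_trans x1.
  rewrite /= fD_gD// /gD indicE mem_set ?mulr1/= ?in_itv/= ?invr_gt0 ?x0 ?invf_le1 ?(ltW x1)//.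
  by rewrite !fctE/= invE// /G mulNr opprK mul1r.
- move=> x y; rewrite !in_itv/= => /andP[ax _] /andP[ay _] xy.
  by rewrite ltf_pV2 ?posrE ?(lt_le_trans a0).
- move=> x; rewrite in_itv/= => /andP[ax _].
  by rewrite /continuous_at invE; [apply: cinv|]; exact: lt_trans ax.
- by apply: (cvgP (- 1 / a ^+ 2)); apply: cvg_at_right_filter; exact: cinv.
- by apply: (cvgP (- 1 / b ^+ 2)); apply: cvg_at_left_filter; exact: cinv.
- split.
  + move=> x; rewrite in_itv/= => /andP[ax _].
    by case: (dinv x (lt_trans a0 ax)).
  + by apply: cvg_at_right_filter; apply: (is_derive_continuous (dinv a a0)).
  + by apply: cvg_at_left_filter; apply: (is_derive_continuous (dinv b b0)).
- apply: continuous_in_subspaceT => y; rewrite inE/= in_itv/= => /andP[y0 y1].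
  have {}y0 : 0 < y by apply: lt_le_trans y0; rewrite invr_gt0.
  have {}y1 : y < 1 by rewrite (le_lt_trans y1)// invf_lt1.
  apply: cvgM; last first.
    by apply: cvgV; [rewrite gt_eqF// mulr_gt0// pi_gt0|apply: cvgMr].
  apply: cvgM.
    by apply: continuous_cvg; [exact: continuous_sin|apply: cvgMr].
  apply: continuous_cvg; first exact: continuous_expR.
  apply: cvgN; apply: cvgD; first exact: xlnx_c.
  apply: continuous_cvg; first by apply: xlnx_c; rewrite subr_gt0.
  by apply: cvgB => //; exact: cvg_cst.
Unshelve. all: end_near. Qed.

(** Neither side charges the values up to 1, so a ray [c, +oo[ has the mass of
    the part of it above [M = max c 1], an increasing union of the compact
    intervals of [law_D_itv]. *)
Lemma law_D : has_density P D fD.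
Proof.
split; [exact: measurable_fD|exact: fD_ge0|split => // A mA].
pose nD : {measure set (measurableTypeR R) -> \bar R} :=
  density_measure mu measurable_fD fD_ge0.
have mDA (B : set (measurableTypeR R)) : measurable B -> measurable (D @^-1` B).
  by move=> mB; rewrite -[X in measurable X]setTI; exact: mD.
have low1 : pushforward P (D : T -> measurableTypeR R) `]-oo, 1]%classic = 0%E.
  rewrite /pushforward.
  rewrite lawD_of_D//.
  rewrite (_ : _ `&` _ = [set w | 0 < D w] `&` H @^-1` `[1, +oo[); last first.
    apply/seteqP; split => w [/= D0]; rewrite !in_itv/= andbT /H.
      by rewrite invf_ge1.
    by rewrite invf_ge1.
  rewrite law_invD; last exact: measurable_itv.
  rewrite /nu /= /density_measure -integral_itv_obnd_cbnd; last first.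
    by apply/measurable_EFinP; exact: measurable_funTS measurable_gD.
  rewrite integral0_eq// => y; rewrite /= in_itv/= andbT => y1.
  by rewrite /gD indicE memNset ?mulr0//= in_itv/= => /andP[_]; rewrite leNgt y1.
have low2 : nD `]-oo, 1]%classic = 0%E.
  rewrite /nD /= /density_measure -integral_itv_bndo_bndc; last first.
    by apply/measurable_EFinP; exact: measurable_funTS measurable_fD.
  rewrite integral0_eq// => y; rewrite /= in_itv/= => y1.
  by rewrite /fD indicE memNset ?mulr0//= in_itv/= andbT leNgt y1.
pose I (c : R) n := `[(Num.max c 1 + n.+1%:R^-1), (Num.max c 1 + n.+1%:R)]%classic : set R.
have ray (m : {measure set (measurableTypeR R) -> \bar R}) (c : R) :
    m `]-oo, 1]%classic = 0%E ->
    m (I c n) @[n --> \oo] --> m `]c, +oo[%classic.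
  move=> m0; set M := Num.max c 1.
  have -> : m `]c, +oo[%classic = m `]M, +oo[%classic.
    have cM : c <= M by rewrite /M le_max lexx.
    have -> : `]c, +oo[%classic = `]c, M]%classic `|` `]M, +oo[%classic :> set R.
      by apply: (@itv_bndbnd_setU _ R (BRight c) (BRight M)); rewrite bnd_simp.
    rewrite measureU//; last first.
      apply/seteqP; split => // x [/=]; rewrite !in_itv/= andbT => /andP[_ xM].
      by rewrite ltNge xM.
    rewrite [X in (X + _)%E](_ : _ = 0%E) ?add0e//.
    have [c1|c1] := ltP 1 c.
      rewrite (_ : M = c); last by apply/max_idPl; exact: ltW.
      by rewrite set_itvoc0 measure0.
    apply/eqP; rewrite eq_le measure_ge0 andbT -m0.
    apply: le_measure; rewrite ?inE; try exact: measurable_itv.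
    by move=> x /=; rewrite !in_itv/= /M (max_idPr c1) => /andP[].
  rewrite (_ : `]M, +oo[%classic = \bigcup_n I c n).
    apply: nondecreasing_cvg_mu.
    - by move=> n; exact: measurable_itv.
    - by apply: bigcup_measurable => n _; exact: measurable_itv.
    - apply/nondecreasing_seqP => n; rewrite subsetEset => x.
      rewrite /I/= !in_itv/= => /andP[x1 x2]; apply/andP; split.
        by apply: le_trans x1; rewrite lerD2l lef_pV2 ?posrE// ler_nat.
      by apply: (le_trans x2); rewrite lerD2l ler_nat.
  apply/seteqP; split => [x|x [n _]]; rewrite /I/= !in_itv/= andbT -/M.
    move=> Mx; have xM0 : 0 < x - M by rewrite subr_gt0.
    exists (Num.truncn (x - M) + Num.truncn (x - M)^-1)%N => //=.
    rewrite in_itv/=; apply/andP; split.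
      rewrite -lerBrDl invf_ple ?posrE//; apply/ltW; apply: (lt_le_trans (truncnS_gt _)).
      by rewrite ler_nat ltnS leq_addl.
    rewrite -lerBlDl; apply/ltW; apply: (lt_le_trans (truncnS_gt _)).
    by rewrite ler_nat ltnS leq_addr.
  by move=> /andP[+ _]; apply: lt_le_trans; rewrite ltrDl invr_gt0.
pose mDl := pushforward P (D : T -> measurableTypeR R).
rewrite -[LHS]/(mDl A) -[RHS]/(nD A).
apply: (@measure_unique _ R (measurableTypeR R) (@RGenOInfty.G R)
  (fun k : nat => `]- k%:R, +oo[%classic) (@RGenOInfty.measurableE R)) => //.
- move=> _ _ [a ->] [b ->]; exists (Num.max a b).
  by apply/seteqP; split => x /=; rewrite !in_itv/= !andbT gt_max => /andP.
- by move=> k; eexists.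
- rewrite -subTset => x _; exists (Num.truncn `|x|).+1 => //=.
  rewrite in_itv/= andbT ltrNl.
  by apply: le_lt_trans (truncnS_gt `|x|); rewrite -normrN ler_norm.
- move=> _ [c ->].
  have h1 := ray _ c low1.
  have h2 := ray _ c low2.
  apply: (cvg_unique (@ereal_hausdorff R) (h1 mD)).
  apply: (cvg_trans _ h2); apply: near_eq_cvg; apply: nearW => n.
  rewrite /nD /mDl /pushforward /= /density_measure /I; apply/esym/law_D_itv.
    rewrite (@le_lt_trans _ _ (Num.max c 1))// ?le_max ?lexx ?orbT//.
    by rewrite ltrDl invr_gt0.
  by rewrite lerD2l (@le_trans _ _ 1)// ?invf_le1// ler1n.
- move=> k; rewrite /mDl /pushforward; apply: (le_lt_trans (probability_le1 _ _)).
    by apply: mDA; exact: measurable_itv.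
  exact: ltry.
Qed.

End density_of_D.

Section uniform_subordinator.
Context {R : realType} {dG : measure_display} {TG : measurableType dG}.
Context {PG : probability TG R} {G : {RV PG >-> R}}.
Context {d : measure_display} {T : measurableType d} {P : probability T R}.
Variable Gam : subordinator P.
Hypothesis hG : has_law PG G (uniform_prob (@ltr01 R)).
Hypothesis hGam : driftless_with_levy_density P Gam
  (fun x : R => ((x^-1)%:E * 'E_PG[fun w => expR (- x * G w)])%E).

Lemma uniform_subordinator_laplace (l t : R) : 0 <= l -> 0 <= t ->
  'E_P[fun w => expR (- l * Gam t w)]%E =
  (expR (- (t * (xlnx (1 + l) - xlnx l))))%:E.
Proof. by move=> l0 t0; rewrite hGam// uniform_levy_exponent. Qed.

Lemma uniform_subordinator_laplace_powR (l t : R) : 0 <= l -> 0 <= t ->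
  'E_P[fun w => expR (- l * Gam t w)]%E =
  ((l `^ l / (1 + l) `^ (1 + l)) `^ t)%:E.
Proof.
move=> l0 t0; rewrite uniform_subordinator_laplace// !powRxx ?addr_ge0//.
by rewrite -expRB -expRM -mulrN opprB mulrC.
Qed.

Lemma subordinator_ge0 (t : R) w : 0 <= t -> 0 <= Gam t w.
Proof. by move=> t0; rewrite -(sub_start Gam w); exact: sub_nondecreasing. Qed.

Lemma uniform_subordinator_density : has_density P (Gam 1) fGam.
Proof.
apply: fGam_has_law.
- exact: sub_measurable.
- by move=> w; exact: subordinator_ge0.
- by move=> l l0; rewrite uniform_subordinator_laplace ?(ltW l0)// mul1r opprB.
Qed.

Lemma cofactor_density (dD : measure_display) (TD : measurableType dD)
    (PD : probability TD R) (E D : {RV PD >-> R}) :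
  has_law PD E (exponential_prob 1) -> independent_pair PD E D ->
  same_law P (Gam 1) PD (fun w => E w * D w) -> has_density PD D fD.
Proof.
move=> lawE indep [mG mED GED]; apply: (law_D lawE indep).
have [mf f0 [_ h]] := uniform_subordinator_density.
by split => //; split => // A mA; rewrite -GED// h.
Qed.

End uniform_subordinator.

(** * Dyadic Riemann-Stieltjes sums *)

Section dyadic_sums.
Context {R : realType}.
Variable t : R.
Hypothesis t0 : 0 < t.

Definition dyadic n k : R := t * (k%:R / 2 ^+ n).

Definition dyadic_cell n k : set R := `]dyadic n k, dyadic n k.+1]%classic.

Lemma dyadic0 n : dyadic n 0 = 0.
Proof. by rewrite /dyadic mul0r mulr0. Qed.

Lemma dyadicS n k : dyadic n k.+1 = dyadic n k + t / 2 ^+ n.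
Proof. by rewrite /dyadic -natr1 mulrDl mulrDr mul1r. Qed.

Lemma ltr_dyadic n j k : (dyadic n j < dyadic n k) = (j < k)%N.
Proof. by rewrite /dyadic ltr_pM2l// ltr_pM2r ?ltr_nat// invr_gt0 exprn_gt0. Qed.

Lemma ler_dyadic n j k : (dyadic n j <= dyadic n k) = (j <= k)%N.
Proof. by rewrite leNgt ltr_dyadic -leqNgt. Qed.

Lemma dyadic_double n k : dyadic n.+1 k.*2 = dyadic n k.
Proof.
rewrite /dyadic -muln2 natrM exprS; congr (_ * _).
by rewrite [2 * _]mulrC -mulf_div divff ?mulr1.
Qed.

Lemma dyadic_max n : dyadic n (2 ^ n) = t.
Proof. by rewrite /dyadic natrX divff ?mulr1// expf_neq0. Qed.

Lemma dyadic_cell_refine n k u : dyadic_cell n k u ->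
  dyadic_cell n.+1 k.*2 u \/ dyadic_cell n.+1 k.*2.+1 u.
Proof.
rewrite /dyadic_cell /= !in_itv/= -doubleS !dyadic_double => /andP[-> ->].
by rewrite andbT; have [|] := leP u (dyadic n.+1 k.*2.+1); [left|right].
Qed.

Lemma dyadic_cell_cover n u : 0 < u <= t ->
  exists2 k, (k < 2 ^ n)%N & dyadic_cell n k u.
Proof.
move=> ut; elim: n => [|n [k kn /dyadic_cell_refine[ku|ku]]].
- by exists 0%N; rewrite // /dyadic_cell/= in_itv/= dyadic0 (dyadic_max 0).
- by exists k.*2; rewrite // expnS mul2n ltn_double.
- exists k.*2.+1; rewrite // expnS mul2n -doubleS.
  by rewrite (leq_trans (n := k.+1.*2))// ?leq_double// doubleS.
Qed.

Lemma dyadic_cell_uniq n j k u :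
  dyadic_cell n j u -> dyadic_cell n k u -> j = k.
Proof.
rewrite /dyadic_cell /= !in_itv/= => /andP[ju uj] /andP[ku uk].
apply/eqP; rewrite eqn_leq -[(j <= k)%N]ltnS -[(k <= j)%N]ltnS.
by rewrite -!(ltr_dyadic n) (lt_le_trans ju uk) (lt_le_trans ku uj).
Qed.

Lemma dyadic_cell_sub n k : (k < 2 ^ n)%N -> dyadic_cell n k `<=` `]0, t]%classic.
Proof.
move=> kn u; rewrite /dyadic_cell /= !in_itv/= => /andP[ku uk].
rewrite (le_lt_trans _ ku) ?(le_trans uk)// -1?[X in _ <= X](dyadic_max n) ?ler_dyadic//.
by rewrite -(dyadic0 n) ler_dyadic.
Qed.

Section sums.
Variables (m : {measure set (measurableTypeR R) -> \bar R}).
Variables (C : nat -> nat -> R) (h : R -> \bar R).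
Hypothesis C0 : forall n k, (k < 2 ^ n)%N -> 0 <= C n k.
Hypothesis Cmono : forall n k, (k < 2 ^ n)%N ->
  C n k <= C n.+1 k.*2 /\ C n k <= C n.+1 k.*2.+1.
Hypothesis Ch : forall u (k : nat -> nat), 0 < u <= t ->
  (forall n, (k n < 2 ^ n)%N /\ dyadic_cell n (k n) u) ->
  (C n (k n))%:E @[n --> \oo] --> h u.

Let step n u : R := \sum_(k < 2 ^ n) C n k * \1_(dyadic_cell n k) u.

Let stepE n k u : (k < 2 ^ n)%N -> dyadic_cell n k u -> step n u = C n k.
Proof.
move=> kn ku; rewrite /step (bigD1 (Ordinal kn))//= indicE mem_set// mulr1.
rewrite big1 ?addr0// => j jk; rewrite indicE memNset ?mulr0// => ju.
by move/eqP: jk; apply; apply/val_inj => /=; exact: dyadic_cell_uniq ju ku.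
Qed.

(** The sums are the integrals of step functions, which increase because
    refining the partition increases the coefficients, so that monotone
    convergence applies to an arbitrary measure. The value [h u] may be +oo. *)
Lemma cvg_dyadic_sums :
  (\sum_(k < 2 ^ n) (C n k)%:E * m (dyadic_cell n k))%E @[n --> \oo] -->
  (\int[m]_(u in `]0%R, t]) h u)%E.
Proof.
have mI : measurable (`]0, t]%classic : set (measurableTypeR R)) by exact: measurable_itv.
have mC n k : measurable (dyadic_cell n k : set (measurableTypeR R)) by exact: measurable_itv.
have mind n k (D : set R) :
    measurable_fun D (fun u : R => \1_(dyadic_cell n k) u : R).
  apply: measurable_funTS.
  exact: (@measurable_realfun.measurable_indic _ _ R setT _ (mC n k)).
have mstep n : measurable_fun `]0, t] (fun u : measurableTypeR R => (step n u)%:E).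
  apply/measurable_EFinP; apply: measurable_sum => k.
  exact: measurable_funM.
have step0 n u : `]0, t]%classic u -> (0 <= (step n u)%:E)%E.
  by rewrite /= in_itv/= => /(dyadic_cell_cover n)[k kn ku]; rewrite (stepE kn)// lee_fin C0.
have stepnd u : `]0, t]%classic u -> nondecreasing_seq (fun n => (step n u)%:E).
  rewrite /= in_itv/= => ut; apply/nondecreasing_seqP => n; rewrite lee_fin.
  have [k kn ku] := dyadic_cell_cover n ut.
  have kn2 : (k.*2 < 2 ^ n.+1)%N by rewrite expnS mul2n ltn_double.
  have kn3 : (k.*2.+1 < 2 ^ n.+1)%N.
    by rewrite expnS mul2n (leq_trans (n := k.+1.*2))// leq_double.
  rewrite (stepE kn)//; case: (dyadic_cell_refine ku) => ku'.
    by rewrite (stepE kn2)//; case: (Cmono kn).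
  by rewrite (stepE kn3)//; case: (Cmono kn).
have := @cvg_monotone_convergence _ _ R m _ mI _ mstep step0 stepnd.
have -> : (\int[m]_(u in `]0%R, t]) limn (fun n => (step n u)%:E) =
           \int[m]_(u in `]0%R, t]) h u)%E.
  apply: eq_integral => u; rewrite inE/= in_itv/= => ut; apply/cvg_lim => //.
  have /choice[k kP] : forall n, exists k, (k < 2 ^ n)%N /\ dyadic_cell n k u.
    by move=> n; have [k] := dyadic_cell_cover n ut; exists k.
  apply: cvg_trans (Ch ut kP); apply: near_eq_cvg; apply: nearW => n.
  by have [kn ku] := kP n; rewrite (stepE kn).
apply: cvg_trans; apply: near_eq_cvg; apply: nearW => n.
rewrite /step; under eq_integral do rewrite -sumEFin.
rewrite ge0_integral_sum//.
- apply: eq_bigr => k _; under eq_integral do rewrite EFinM.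
  rewrite ge0_integralZl ?lee_fin ?C0//.
  + by rewrite integral_indic// setIidl//; exact: dyadic_cell_sub.
  + by apply/measurable_EFinP; exact: mind.
- move=> k; apply/measurable_EFinP.
  exact: measurable_funM.
- by move=> k u _; rewrite lee_fin mulr_ge0 ?C0.
Qed.

End sums.
End dyadic_sums.

Section dyadic_limits.
Context {R : realType}.

Lemma cvg_divr_exp2 (t : R) : t / 2 ^+ n @[n --> \oo] --> 0.
Proof.
rewrite -[0](mulr0 t); apply: cvgMr.
under eq_fun do rewrite -exprVn.
by apply: cvg_expr; rewrite ger0_norm ?invf_lt1 ?ltr1n.
Qed.

Lemma cvg_dyadic_right (t u : R) (k : nat -> nat) :
  (forall n, dyadic_cell t n (k n) u) -> dyadic t n (k n).+1 @[n --> \oo] --> u.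
Proof.
move=> ku; apply: (squeeze_cvgr (f := fun=> u) (h := fun n => u + t / 2 ^+ n)).
- apply: nearW => n; have := ku n; rewrite /dyadic_cell /= in_itv/= => /andP[k1 ->].
  by rewrite dyadicS lerD2r ltW.
- exact: cvg_cst.
- by rewrite -[X in _ --> X]addr0; apply: cvgD; [exact: cvg_cst|exact: cvg_divr_exp2].
Qed.

Lemma cvg_dyadic_left (t u : R) (k : nat -> nat) :
  (forall n, dyadic_cell t n (k n) u) -> dyadic t n (k n) @[n --> \oo] --> u.
Proof.
move=> ku; have -> : (fun n => dyadic t n (k n)) =
    (fun n => dyadic t n (k n).+1 - t / 2 ^+ n).
  by apply/funext => n; rewrite dyadicS addrK.
rewrite -[X in _ --> X]subr0; apply: cvgB; [exact: cvg_dyadic_right|exact: cvg_divr_exp2].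
Qed.

(** In the extended reals the inverse of 0 is +oo, the limit of the coefficients
    of [1 / (t - u)] at [u = t]. *)
Lemma cvg_inve (q : nat -> R) (v : R) : (forall n, 0 < q n) ->
  q n @[n --> \oo] --> v -> ((q n)^-1)%:E @[n --> \oo] --> ((v%:E)^-1)%E.
Proof.
move=> q0 qv; rewrite inver; case: eqP => [v0|/eqP v0].
  rewrite cvgeryP; apply/gtr0_cvgV0; first by apply: nearW => n; rewrite invr_gt0.
  by rewrite inv_funK -v0.
by apply: cvg_EFin; [exact: nearW|exact: cvgV].
Qed.

(** [1 / u] is decreasing, so the sums at right end points are lower sums. *)
Lemma cvg_dyadic_sums_inv_right (t : R) (m : {measure set (measurableTypeR R) -> \bar R}) :
  0 < t ->
  (\sum_(k < 2 ^ n) ((dyadic t n k.+1)^-1)%:E * m (dyadic_cell t n k))%E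
    @[n --> \oo] --> (\int[m]_(u in `]0%R, t]) (u%:E)^-1)%E.
Proof.
move=> t0; have dgt0 n k : 0 < dyadic t n k.+1 by rewrite -(dyadic0 t n) ltr_dyadic.
apply: (@cvg_dyadic_sums _ _ t0 m (fun n k => (dyadic t n k.+1)^-1)).
- by move=> n k _; rewrite invr_ge0 ltW.
- move=> n k _; rewrite !lef_pV2 ?posrE// -!(dyadic_double t n) doubleS.
  by rewrite !ler_dyadic.
- move=> u k _ ku; apply: cvg_inve => //.
  by apply: cvg_dyadic_right => n; case: (ku n).
Qed.

(** [1 / (t - u)] is increasing, so the lower sums are those at left end points;
    the left end point of the cell [k] is at distance [dyadic t n (2 ^ n - k)]
    from [t]. *)
Lemma cvg_dyadic_sums_inv_left (t : R) (m : {measure set (measurableTypeR R) -> \bar R}) :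
  0 < t ->
  (\sum_(k < 2 ^ n) ((dyadic t n (2 ^ n - k))^-1)%:E * m (dyadic_cell t n k))%E
    @[n --> \oo] --> (\int[m]_(u in `]0%R, t]) ((t - u)%:E)^-1)%E.
Proof.
move=> t0.
have dgt0 n k : (k < 2 ^ n)%N -> 0 < dyadic t n (2 ^ n - k).
  by move=> kn; rewrite -(dyadic0 t n) ltr_dyadic// subn_gt0.
apply: (@cvg_dyadic_sums _ _ t0 m (fun n k => (dyadic t n (2 ^ n - k))^-1)).
- by move=> n k kn; rewrite invr_ge0 ltW// dgt0.
- move=> n k kn.
  have kn2 : (k.*2.+1 < 2 ^ n.+1)%N.
    by rewrite expnS mul2n (leq_trans (n := k.+1.*2))// leq_double.
  rewrite !lef_pV2 ?posrE ?dgt0// ?(ltnW kn2)//.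
  have -> : dyadic t n (2 ^ n - k) = dyadic t n.+1 (2 ^ n.+1 - k.*2).
    by rewrite -dyadic_double doubleB -mul2n -expnS.
  by rewrite !ler_dyadic// leqnn leq_sub2l.
- move=> u k ut ku; apply: cvg_inve => [n|]; first by case: (ku n) => /dgt0.
  have -> : (fun n => dyadic t n (2 ^ n - k n)) = (fun n => t - dyadic t n (k n)).
    apply/funext => n; case: (ku n) => /ltnW kn _.
    rewrite -[X in X - _](dyadic_max t n) /dyadic natrB//.
    by rewrite mulrBl mulrBr.
  apply: cvgB; first exact: cvg_cst.
  by apply: cvg_dyadic_left => n; case: (ku n).
Qed.

Lemma lebesgue_dyadic_cell (t : R) n k : 0 < t ->
  lebesgue_measure (dyadic_cell t n k) = (t / 2 ^+ n)%:E.
Proof.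
move=> t0; rewrite /dyadic_cell lebesgue_measure_itv/= lte_fin ltr_dyadic// ltnSn.
by rewrite -EFinD dyadicS addrAC subrr add0r.
Qed.

Lemma cvg_dyadic_sums_ln (l : R) : 0 <= l ->
  (\sum_(k < 2 ^ n) ln (1 + l / dyadic 1 n k.+1) / 2 ^+ n) @[n --> \oo] -->
  xlnx (1 + l) - xlnx l.
Proof.
move=> l0.
have dgt0 n k : 0 < dyadic (1 : R) n k.+1 by rewrite -(dyadic0 1 n) ltr_dyadic.
have gt0 (x : R) : 0 < x -> 0 < 1 + l / x.
  by move=> x0; rewrite ltr_pwDl// divr_ge0// ltW.
have h : (\sum_(k < 2 ^ n) (ln (1 + l / dyadic 1 n k.+1))%:E *
    (@lebesgue_measure R) (dyadic_cell 1 n k))%E @[n --> \oo] -->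
    (\int[lebesgue_measure]_(u in `]0%R, 1%R]) (ln (1 + l / u))%:E)%E.
  apply: (@cvg_dyadic_sums _ _ ltr01 (@lebesgue_measure R)
    (fun n k => ln (1 + l / dyadic 1 n k.+1))).
  - by move=> n k _; rewrite ln_ge0// lerDl divr_ge0// ltW.
  - move=> n k _; rewrite !ler_ln ?posrE ?gt0// !lerD2l !ler_wpM2l ?lef_pV2 ?posrE//.
      by rewrite -(dyadic_double _ n) doubleS ler_dyadic.
    by rewrite -(dyadic_double _ n) ler_dyadic.
  - move=> u k /andP[u0 _] ku; apply: cvg_EFin; first exact: nearW.
    apply: continuous_cvg; first by apply: continuous_ln; exact: gt0.
    apply: cvgD; first exact: cvg_cst.
    apply: cvgMr; apply: cvgV; first by rewrite gt_eqF.
    by apply: cvg_dyadic_right => n; case: (ku n).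
rewrite integral_ln1Dl// in h.
have {h}/fine_cvgP[_] : (\sum_(k < 2 ^ n) ln (1 + l / dyadic 1 n k.+1) / 2 ^+ n)%:E
    @[n --> \oo] --> (xlnx (1 + l) - xlnx l)%:E.
  apply: cvg_trans h; apply: near_eq_cvg; apply: nearW => n; rewrite -sumEFin.
  by apply: eq_bigr => k _; rewrite lebesgue_dyadic_cell// mul1r EFinM.
by [].
Qed.

End dyadic_limits.

(** * Expectations of products of functions of independent variables *)

Section independent_products.
Context {R : realType} {d : measure_display} {T : measurableType d}.
Variables (P : probability T R) (n : nat) (X : 'I_n -> T -> R).
Hypothesis mX : forall k, measurable_fun setT (X k).
Hypothesis indep : independent_RVs P X.

Let unit_fun (f : R -> R) := measurable_fun setT f /\ forall x, 0 <= f x <= 1.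

Let intP (f : R -> R) k := (\int[P]_w (f (X k w))%:E)%E.

Let intP_fin f k : unit_fun f -> intP f k \is a fin_num /\ (0 <= intP f k)%E.
Proof.
move=> [mf f01]; have i0 : (0 <= intP f k)%E.
  by apply: integral_ge0 => w _; rewrite lee_fin; case/andP: (f01 (X k w)).
split => //; rewrite ge0_fin_numE// (@le_lt_trans _ _ (\int[P]_w 1)%E)//.
  apply: ge0_le_integral => //.
  - by move=> w _; rewrite lee_fin; case/andP: (f01 (X k w)).
  - by apply/measurable_EFinP; exact: measurableT_comp.
  - by move=> w _; rewrite lee_fin; case/andP: (f01 (X k w)).
rewrite integral_cst// mul1e.
exact: (le_lt_trans (probability_le1 P measurableT) (ltry _)).
Qed.

Let intP_indic (A : set R) k : measurable A -> intP (\1_A) k = P (X k @^-1` A).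
Proof.
move=> mA; rewrite -[in RHS](setIT (X k @^-1` A)) -integral_indic//.
by rewrite -[X in measurable X]setTI; exact: mX.
Qed.

(** If the factor of index [j] can be taken out when it is an indicator, then the
    law of [X j] under the measure of density [W], the product of the other
    factors, is a multiple of its law under [P]. *)
Let factor_indic (j : 'I_n) (f : R -> R) (g : 'I_n -> R -> R) :
  unit_fun f -> (forall k, unit_fun (g k)) ->
  (forall A : set R, measurable A ->
    \int[P]_w (\1_A (X j w) * \prod_(k | k != j) g k (X k w))%:E =
    intP (\1_A) j * \prod_(k | k != j) intP (g k) k)%E ->
  (\int[P]_w (f (X j w) * \prod_(k | k != j) g k (X k w))%:E =
    intP f j * \prod_(k | k != j) intP (g k) k)%E.
Proof.
move=> [mf f01] ug hA.
pose W w := \prod_(k | k != j) g k (X k w) : R.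
have W0 w : 0 <= W w.
  by apply: prodr_ge0 => k _; case: (ug k) => _ /(_ (X k w)) /andP[].
have mW : measurable_fun setT W.
  rewrite /W; under eq_fun do rewrite -big_filter.
  by apply: measurable_prod => k _; apply: measurableT_comp => //; case: (ug k).
have [cfin c0] : (\prod_(k | k != j) intP (g k) k \is a fin_num /\
    0 <= \prod_(k | k != j) intP (g k) k)%E.
  split; first by apply: prode_fin_num => k _; case: (intP_fin k (ug k)).
  by apply: prode_ge0 => k _; case: (intP_fin k (ug k)).
have c0' : 0 <= fine (\prod_(k | k != j) intP (g k) k)%E by exact: fine_ge0.
have mXj : measurable_fun setT (X j) := mX j.
pose kappa0 : {measure set (measurableTypeR R) -> \bar R} :=
  pushforward (density_measure P mW W0) (X j : T -> measurableTypeR R).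
pose kappa := kappa0 mXj.
pose c : {nonneg R} := NngNum c0'.
pose kappa0' : {measure set (measurableTypeR R) -> \bar R} :=
  mscale c (pushforward P (X j : T -> measurableTypeR R)).
pose kappa' := kappa0' mXj.
have mfE : measurable_fun setT (fun x : measurableTypeR R => (f x)%:E).
  exact/measurable_EFinP.
have f0 (x : R) : (0 <= (f x)%:E)%E by rewrite lee_fin; case/andP: (f01 x).
transitivity (\int[kappa]_x (f x)%:E)%E.
  rewrite ge0_integral_pushforward//.
  rewrite preimage_setT ge0_integral_density//.
  - exact: (measurableT_comp mfE mXj).
  - by move=> w _; exact: f0.
transitivity (\int[kappa']_x (f x)%:E)%E; last first.
  rewrite ge0_integral_mscale// ge0_integral_pushforward// preimage_setT.
  by rewrite muleC /= fineK.
apply: eq_measure_integral => A mA _.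
rewrite /kappa /kappa' /kappa0 /kappa0' /= /mscale /pushforward /= /density_measure fineK//.
have mXA : measurable (X j @^-1` A).
  by rewrite -[X in measurable X]setTI; exact: mX.
rewrite muleC; transitivity (intP (\1_A) j * \prod_(k | k != j) intP (g k) k)%E; last first.
  by rewrite intP_indic.
rewrite -hA// integral_mkcond; apply: eq_integral => w _.
rewrite patchE indicE -[_ \in A]/(w \in X j @^-1` A) /W.
by case: (w \in _); rewrite ?mul1r ?mul0r.
Qed.

(** For indicators this is the definition of independence; the functions [f k]
    replace them one at a time, those of index below [m] after [m] steps. *)
Lemma independent_expectation_prod (f : 'I_n -> R -> R) :
  (forall k, measurable_fun setT (f k)) -> (forall k x, 0 <= f k x <= 1) ->
  (\int[P]_w (\prod_(k < n) f k (X k w))%:E =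
   \prod_(k < n) \int[P]_w (f k (X k w))%:E)%E.
Proof.
move=> mf f01.
pose g (A : 'I_n -> set R) m (k : 'I_n) : R -> R := if (k < m)%N then f k else \1_(A k).
have indic01 (A : set R) x : 0 <= (\1_A x : R) <= 1.
  by rewrite indicE; case: (_ \in _); rewrite ?lexx ler01.
have key m : (m <= n)%N -> forall A, (forall k, measurable (A k)) ->
    (\int[P]_w (\prod_(k < n) g A m k (X k w))%:E = \prod_(k < n) intP (g A m k) k)%E.
  elim: m => [_|m IH mn] A mA.
    have mXA k : measurable (X k @^-1` A k).
      by rewrite -[X in measurable X]setTI; exact: mX.
    transitivity (P (\bigcap_(k in [set: 'I_n]) X k @^-1` A k)).
      rewrite -[in RHS](setIT (\bigcap_(k in _) _)) -integral_indic//; last first.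
        by apply: fin_bigcap_measurable.
      apply: eq_integral => w _; congr EFin; rewrite indicE.
      have [wA|wA] := boolP (w \in _).
        rewrite big1// => k _; rewrite /g ltn0 indicE mem_set//.
        by move: wA; rewrite inE; exact.
      have [k kA] : exists k, ~ A k (X k w).
        by apply/existsNP => h; move: wA; rewrite notin_setE; apply => k _; exact: h.
      by rewrite (bigD1 k)//= /g ltn0 indicE memNset// mul0r.
    rewrite indep//; apply: eq_bigr => k _.
    by rewrite /g ltn0 intP_indic.
  pose j := Ordinal mn.
  have ug B (k : 'I_n) : measurable B -> unit_fun (if (k < m.+1)%N then f k else \1_B).
    by move=> mB; case: ifP => _; split.
  rewrite (bigD1 j)//=.
  under eq_integral do rewrite (bigD1 j)//=.
  have gj : g A m.+1 j = f j by rewrite /g /= ltnSn.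
  rewrite gj; apply: factor_indic; [by split|by move=> k; exact: ug|].
  move=> B mB.
  pose A' k := if k == j then B else A k.
  have mA' k : measurable (A' k) by rewrite /A'; case: ifP.
  have g'j : g A' m j = \1_B by rewrite /g /= ltnn /A' eqxx.
  have g'k k : k != j -> g A' m k = g A m.+1 k.
    move=> kj; rewrite /g /A' (negbTE kj) [in RHS]ltnS [in RHS]leq_eqVlt.
    by move: kj; rewrite -val_eqE/= => /negbTE ->.
  have := IH (ltnW mn) A' mA'; rewrite (bigD1 j)//= g'j.
  under eq_bigr => k kj do rewrite g'k//.
  move=> <-; apply: eq_integral => w _; rewrite [in RHS](bigD1 j)//= g'j.
  by congr (_ * _)%:E; apply: eq_bigr => k kj; rewrite g'k.
have := key n (leqnn n) (fun=> setT) (fun=> measurableT).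
under eq_integral => w _ do under eq_bigr => k _ do rewrite /g ltn_ord.
by under eq_bigr => k _ do rewrite /g ltn_ord.
Qed.

End independent_products.

(** * The Wiener-Gamma representation *)

Section wiener_gamma.
Context {R : realType} {d : measure_display} {T : measurableType d}.
Context {P : probability T R}.
Variable gam : subordinator P.
Hypothesis hgam : standard_gamma_process gam.
Variable t : R.
Hypothesis t0 : 0 < t.

Let incr n k w := gam (dyadic t n k.+1) w - gam (dyadic t n k) w.

Let dyadic_ge0 n k : 0 <= dyadic t n k.
Proof. by rewrite -(dyadic0 t n) ler_dyadic. Qed.

Let incr_ge0 n k w : 0 <= incr n k w.
Proof. by rewrite subr_ge0 sub_nondecreasing ?ler_dyadic. Qed.

Let measurable_incr n k : measurable_fun setT (incr n k).
Proof. by apply: measurable_funB; exact: sub_measurable. Qed.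

Lemma stieltjes_dyadic_cell n k w :
  lebesgue_stieltjes_measure (Defs.sub_path gam w) (dyadic_cell t n k) = (incr n k w)%:E.
Proof.
rewrite /lebesgue_stieltjes_measure /measure_extension/=.
rewrite measurable_mu_extE//; last exact: is_ocitv.
rewrite /= /dyadic_cell wlength_itv_bnd ?ler_dyadic//.
by rewrite /Defs.sub_path !(max_idPr _) ?dyadic_ge0.
Qed.

Lemma dyadic_sum_laplace n (c : nat -> R) : (forall k, (k < 2 ^ n)%N -> 0 <= c k) ->
  (\int[P]_w (expR (- (\sum_(k < 2 ^ n) c k * incr n k w)))%:E =
   (expR (- (t * \sum_(k < 2 ^ n) ln (1 + c k) / 2 ^+ n)))%:E)%E.
Proof.
move=> c0.
(* The truncation at 0 changes nothing on the increments, and makes the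
     functions bounded by 1 on the whole line. *)
pose f (k : 'I_(2 ^ n)) (x : R) := expR (- (c k * Num.max 0 x)).
have fE k w : f k (incr n k w) = expR (- c k * incr n k w).
  by rewrite /f (max_idPr (incr_ge0 n k w)) mulNr.
have mf k : measurable_fun setT (f k).
  apply: measurableT_comp => //; apply: measurableT_comp => //.
  by apply: measurable_funM => //; exact: measurable_maxr.
have f01 k x : 0 <= f k x <= 1.
  by rewrite expR_ge0 expR_le1 oppr_le0 mulr_ge0 ?c0// le_max lexx.
transitivity (\int[P]_w (\prod_(k < 2 ^ n) f k (incr n k w))%:E)%E.
  apply: eq_integral => w _; rewrite -sumrN expR_sum.
  by congr EFin; apply: eq_bigr => k _; rewrite fE mulNr.
rewrite (@independent_expectation_prod _ _ _ P _ (fun k => incr n k))//; last first.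
  apply: (sub_independent gam (t := dyadic t n)); first by rewrite dyadic0.
  by move=> i j ij; rewrite ler_dyadic.
have tn0 : 0 <= t / 2 ^+ n by rewrite divr_ge0// ltW.
have intf k : (\int[P]_w (f k (incr n k w))%:E =
    (expR (- (t * (ln (1 + c k) / 2 ^+ n))))%:E)%E.
  have [mi mg ig] := sub_stationary gam (dyadic_ge0 n k) tn0.
  have inE w : incr n k w = gam (dyadic t n k + t / 2 ^+ n) w - gam (dyadic t n k) w.
    by rewrite /incr dyadicS.
  under eq_integral do rewrite inE.
  have mfE : measurable_fun setT (fun x : measurableTypeR R => (f k x)%:E).
    by apply/measurable_EFinP; exact: mf.
  have f0 (x : R) : (0 <= (f k x)%:E)%E by rewrite lee_fin; case/andP: (f01 k x).
  pose nu0 : {measure set (measurableTypeR R) -> \bar R} :=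
    pushforward P (gam (t / 2 ^+ n) : T -> measurableTypeR R).
  pose nu := nu0 mg.
  rewrite (@ge0_integral_law _ _ _ P _ (measurableTypeR R) _ nu (fun x => (f k x)%:E))//.
  rewrite /nu /nu0 ge0_integral_pushforward// preimage_setT.
  transitivity ('E_P[fun w => (expR (- c k * gam (t / 2 ^+ n) w))%R])%E.
    rewrite expectationE; apply: eq_integral => w _.
    by rewrite /= /f (max_idPr _) ?mulNr//; exact: subordinator_ge0.
  rewrite gamma_process_laplace ?c0//.
  by rewrite [ln _ / _]mulrC mulrA.
under eq_bigr do rewrite intf.
rewrite prodEFin -expR_sum; congr (expR _)%:E.
by rewrite mulr_sumr sumrN.
Qed.

(** Both integrals at once: [C n k] is the coefficient of the cell [k] in the
    dyadic sums of [h]. The hypothesis [Cln] says that, up to their order, the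
    factors of the Laplace transform of a sum are those of [1 / u]. *)
Section representation.
Context {d' : measure_display} {T' : measurableType d'} {P' : probability T' R}.
Variable X : T' -> R.
Hypothesis mX : measurable_fun setT X.
Hypothesis X0 : forall w, 0 <= X w.
Hypothesis lapX : forall l : R, 0 < l -> 'E_P'[fun w => expR (- l * X w)]%E =
  (expR (- (t * (xlnx (1 + l) - xlnx l))))%:E.
Variables (C : nat -> nat -> R) (h : R -> \bar R).
Hypothesis C0 : forall n k, (k < 2 ^ n)%N -> 0 <= C n k.
Hypothesis Ch : forall m : {measure set (measurableTypeR R) -> \bar R},
  (\sum_(k < 2 ^ n) (C n k)%:E * m (dyadic_cell t n k))%E @[n --> \oo] -->
  (\int[m]_(u in `]0%R, t]) h u)%E.
Hypothesis Cln : forall (l : R) n, 0 < l ->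
  \sum_(k < 2 ^ n) ln (1 + l * (t * C n k)) / 2 ^+ n =
  \sum_(k < 2 ^ n) ln (1 + l / dyadic 1 n k.+1) / 2 ^+ n.

Let Y w := (t%:E * stieltjes_integral gam h t w)%E.
Let Yn n w : R := \sum_(k < 2 ^ n) (t * C n k) * incr n k w.

Let Yn_ge0 n w : 0 <= Yn n w.
Proof. by apply: sumr_ge0 => k _; rewrite !mulr_ge0 ?C0// ltW. Qed.

Let cvgYn w : (Yn n w)%:E @[n --> \oo] --> Y w.
Proof.
have := @Ch (lebesgue_stieltjes_measure (Defs.sub_path gam w)).
have tfin : t%:E \is a fin_num by [].
move=> /(cvgeZl tfin); apply: cvg_trans; apply: near_eq_cvg; apply: nearW => n.
rewrite ge0_sume_distrr; last first.
  move=> k _; rewrite [X in (_ * X)%E](stieltjes_dyadic_cell n k w).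
  by rewrite -EFinM lee_fin mulr_ge0// C0.
rewrite /Yn -sumEFin; apply: eq_bigr => k _.
by rewrite [X in (_ * (_ * X))%E](stieltjes_dyadic_cell n k w) -!EFinM mulrA.
Qed.

Let Y_ge0 w : (0 <= Y w)%E.
Proof.
by apply: (cvge_to_ge (@cvgYn w)); apply: nearW => n; rewrite lee_fin.
Qed.

Let measurable_Yn n : measurable_fun setT (Yn n).
Proof. by apply: measurable_sum => k; apply: measurable_funM. Qed.

Let measurable_Y : measurable_fun setT Y.
Proof.
apply: (@emeasurable_fun_cvg _ _ _ _ (fun n w => (Yn n w)%:E)).
- by move=> n; exact/measurable_EFinP.
- by move=> w _; exact: cvgYn.
Qed.

(** The integral [Y] may be infinite. Since [exp (- l * y)] tends to 0 when [y]
    tends to +oo, the limiting Laplace transform only sees the event [F]. *)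
Let F := [set w | (Y w < +oo)%E].

Let mF : measurable F.
Proof. by rewrite -[F]setTI; exact: emeasurable_fun_infty_o. Qed.

Let indF w : R := \1_F w.

Let mindF : measurable_fun setT indF.
Proof. exact: measurable_indic. Qed.

Let indF_ge0 w : 0 <= indF w. Proof. by rewrite /indF indicE. Qed.

Let cvg_expYn (l : R) w : 0 < l ->
  expR (- (l * Yn n w)) @[n --> \oo] --> expR (- (l * fine (Y w))) * indF w.
Proof.
move=> l0; rewrite /indF indicE; have [Yfin|Yinf] := boolP (w \in F).
  rewrite mulr1; apply: continuous_cvg; first exact: continuous_expR.
  apply: cvgN; apply: cvgMr.
  have Yfin' : Y w \is a fin_num by rewrite ge0_fin_numE//; move: Yfin; rewrite inE.
  have : (Yn n w)%:E @[n --> \oo] --> (fine (Y w))%:E by rewrite fineK//; exact: cvgYn.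
  by move=> /fine_cvgP[].
rewrite mulr0.
have : Y w = +oo%E.
  by apply/eqP; rewrite -leye_eq leNgt; apply: contra Yinf => Yw; rewrite inE.
move=> Yw; have := @cvgYn w; rewrite Yw cvgeryP => Yy.
have lYy : l * Yn n w @[n --> \oo] --> +oo.
  apply/cvgryPge => A; move/cvgryPge : Yy => /(_ (A / l)).
  by apply: filterS => n; rewrite ler_pdivrMr// mulrC.
exact: (cvg_comp _ _ lYy (@cvgr_expR R)).
Qed.

Let laplace_Y (l : R) : 0 < l ->
  (\int[P]_w (expR (- (l * fine (Y w))) * indF w)%:E =
   (expR (- (t * (xlnx (1 + l) - xlnx l))))%:E)%E.
Proof.
move=> l0.
have h1 : (\int[P]_w (expR (- (l * Yn n w)))%:E)%E @[n --> \oo] -->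
    (\int[P]_w (expR (- (l * fine (Y w))) * indF w)%:E)%E.
  apply: (@bounded_cvg_integral _ _ _ P setT (fun n w => expR (- (l * Yn n w))) _ 1) => //.
  - by rewrite [ltLHS]probability_setT ltry.
  - move=> n; apply: measurableT_comp => //; apply: measurableT_comp => //.
    exact: measurable_funM.
  - apply: measurable_funM => //.
    apply: measurableT_comp => //; apply: measurableT_comp => //.
    apply: measurable_funM => //.
    exact: measurableT_comp.
  - move=> n w _; rewrite ger0_norm ?expR_ge0// expR_le1 oppr_le0.
    by rewrite mulr_ge0// ltW.
  - by apply/aeW => w _; exact: cvg_expYn.
apply: (cvg_unique (@ereal_hausdorff R) h1).
have h2 : (expR (- (t * \sum_(k < 2 ^ n) ln (1 + l / dyadic 1 n k.+1) / 2 ^+ n)))%:E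
    @[n --> \oo] --> (expR (- (t * (xlnx (1 + l) - xlnx l))))%:E.
  apply: cvg_EFin; first exact: nearW.
  apply: continuous_cvg; first exact: continuous_expR.
  by apply: cvgN; apply: cvgMr; apply: cvg_dyadic_sums_ln; exact: ltW.
apply: (cvg_trans _ h2); apply: near_eq_cvg; apply: nearW => n.
rewrite -(Cln n l0) -(@dyadic_sum_laplace n (fun k => l * (t * C n k))); last first.
  by move=> k kn; rewrite !mulr_ge0 ?C0// ltW.
apply: eq_integral => w _; rewrite /Yn mulr_sumr.
by congr (expR (- _))%:E; apply: eq_bigr => k _; rewrite -mulrA.
Qed.

(** The law [nu] of [Y] restricted to [F] has the Laplace transform of [X]; by
    uniqueness it is the law of [X], so [F] has probability 1. *)
Lemma dyadic_representation : same_law P' (fun w => (X w)%:E) P Y.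
Proof.
split; [exact/measurable_EFinP|exact: measurable_Y|move=> A mA].
pose nu0 : {measure set (measurableTypeR R) -> \bar R} :=
  pushforward (density_measure P mindF indF_ge0) (fine \o Y : T -> measurableTypeR R).
have mfY : measurable_fun setT (fine \o Y : T -> measurableTypeR R).
  exact: measurableT_comp.
pose nu := nu0 mfY.
have nuE (B : set R) : measurable B ->
    nu B = P (F `&` [set w | B (fine (Y w))]).
  move=> mB; rewrite /nu /nu0 /= /pushforward /density_measure.
  rewrite integral_indic//.
  by rewrite -[X in measurable X]setTI; exact: (mfY measurableT B mB).
have lawX : forall B : set (measurableTypeR R), measurable B -> P' (X @^-1` B) = nu B.
  apply: laplace_law => //.
  - rewrite nuE; last exact: measurable_itv.
    rewrite (_ : _ `&` _ = set0) ?measure0// -subset0 => w [_] /=.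
    by rewrite in_itv/= ltNge fine_ge0.
  - move=> l l0; rewrite lapX// -laplace_Y//.
    rewrite /nu /nu0 ge0_integral_pushforward//; last exact: measurable_expRN.
    rewrite (_ : _ @^-1` _ = setT); last first.
      by apply/seteqP; split => // w _ /=; rewrite in_itv/= fine_ge0.
    rewrite ge0_integral_density//.
    + exact: (measurableT_comp (measurable_expRN l (D := setT)) mfY).
    + by move=> w _; rewrite lee_fin expR_ge0.
have PF : P F = 1%E.
  rewrite -(setIT F) -[X in P (F `&` X)]/[set w | setT (fine (Y w))] -nuE//.
  by rewrite -lawX// preimage_setT probability_setT.
have mEA : measurable (EFin @^-1` A : set R).
  rewrite -[X in measurable X]setTI.
  have mE : measurable_fun setT (EFin \o (@id R)) by exact/measurable_EFinP.
  exact: (mE measurableT A mA).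
rewrite -[LHS]/(P' (X @^-1` (EFin @^-1` A))) lawX// nuE//.
have mYA : measurable (Y @^-1` A).
  by rewrite -[X in measurable X]setTI; exact: measurable_Y.
have -> : F `&` [set w | (EFin @^-1` A) (fine (Y w))] = Y @^-1` A `&` F.
  have fineY w : F w -> (fine (Y w))%:E = Y w by move=> Fw; rewrite fineK// ge0_fin_numE.
  by apply/seteqP; split => w /= []; [move=> Fw; rewrite fineY|move=> YA Fw; rewrite fineY].
exact: probability_setI_eq1.
Qed.

End representation.
End wiener_gamma.

Lemma wiener_gamma_right {R : realType} {d d' : measure_display}
    {T : measurableType d} {T' : measurableType d'}
    {P : probability T R} {P' : probability T' R}
    (gam : subordinator P) (t : R) (X : T' -> R) :
  standard_gamma_process gam -> 0 < t ->
  measurable_fun setT X -> (forall w, 0 <= X w) ->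
  (forall l : R, 0 < l -> 'E_P'[fun w => expR (- l * X w)]%E =
    (expR (- (t * (xlnx (1 + l) - xlnx l))))%:E) ->
  same_law P' (fun w => (X w)%:E)
    P (fun w => t%:E * stieltjes_integral gam (fun u => u%:E^-1) t w)%E.
Proof.
move=> hgam t0 mX X0 lapX.
apply: (@dyadic_representation _ _ _ _ _ hgam _ t0 _ _ _ _ mX X0 lapX
  (fun n k => (dyadic t n k.+1)^-1)).
- by move=> n k _; rewrite invr_ge0 mulr_ge0 ?divr_ge0// ltW.
- by move=> m; exact: cvg_dyadic_sums_inv_right.
- move=> l n l0; apply: eq_bigr => k _.
  rewrite /dyadic mul1r invfM [t * _]mulrA divff ?mul1r//; exact: lt0r_neq0.
Qed.

Lemma wiener_gamma_left {R : realType} {d d' : measure_display}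
    {T : measurableType d} {T' : measurableType d'}
    {P : probability T R} {P' : probability T' R}
    (gam : subordinator P) (t : R) (X : T' -> R) :
  standard_gamma_process gam -> 0 < t ->
  measurable_fun setT X -> (forall w, 0 <= X w) ->
  (forall l : R, 0 < l -> 'E_P'[fun w => expR (- l * X w)]%E =
    (expR (- (t * (xlnx (1 + l) - xlnx l))))%:E) ->
  same_law P' (fun w => (X w)%:E)
    P (fun w => t%:E * stieltjes_integral gam (fun u => (t - u)%:E^-1) t w)%E.
Proof.
move=> hgam t0 mX X0 lapX.
apply: (@dyadic_representation _ _ _ _ _ hgam _ t0 _ _ _ _ mX X0 lapX
  (fun n k => (dyadic t n (2 ^ n - k))^-1)).
- by move=> n k _; rewrite invr_ge0 mulr_ge0 ?divr_ge0// ltW.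
- by move=> m; exact: cvg_dyadic_sums_inv_left.
- move=> l n l0; rewrite [RHS](reindex_inj rev_ord_inj)/=; apply: eq_bigr => k _.
  rewrite subnSK// /dyadic mul1r invfM [t * _]mulrA divff ?mul1r//.
  exact: lt0r_neq0.
Qed.

Theorem theorem3p8 (R : realType)
    (dG : measure_display) (TG : measurableType dG) (PG : probability TG R)
    (G : {RV PG >-> R})
    (hG : has_law PG G (uniform_prob (@ltr01 R)))
    (d : measure_display) (T : measurableType d) (P : probability T R)
    (Gam : subordinator P)
    (hGam : driftless_with_levy_density P Gam
       (fun x : R => ((x^-1)%:E * 'E_PG[fun w => expR (- x * G w)])%E)) :
  (forall lambda t : R, 0 <= lambda -> 0 <= t ->
     'E_P[fun w => expR (- lambda * Gam t w)]%E =
     ((lambda `^ lambda / (1 + lambda) `^ (1 + lambda)) `^ t)%:E) /\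
  (has_density P (Gam 1)
     (fun x : R => pi^-1 *
        (\int[lebesgue_measure]_(y in `[0, 1])
            (expR (- (x * y)) * sin (pi * y)
               / (y `^ y * (1 - y) `^ (1 - y)))) *
        \1_(`[0, +oo[) x) /\
   forall (dD : measure_display) (TD : measurableType dD)
     (PD : probability TD R) (E D : {RV PD >-> R}),
     has_law PD E (exponential_prob 1) ->
     independent_pair PD E D ->
     same_law P (Gam 1) PD (fun w => E w * D w) ->
     has_density PD D
       (fun x : R => sin (pi / x) / (pi * (x - 1) `^ (1 - x^-1)) *
                     \1_(`[1, +oo[) x)) /\
  (forall (dg : measure_display) (Tg : measurableType dg)
     (Pg : probability Tg R) (gam : subordinator Pg),
     standard_gamma_process gam ->
     forall t : R, 0 < t ->
       same_law P (fun w => (Gam t w)%:E)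
         Pg (fun w => t%:E *
               stieltjes_integral gam (fun u => u%:E^-1) t w)%E /\
       same_law Pg (fun w => t%:E *
               stieltjes_integral gam (fun u => u%:E^-1) t w)%E
         Pg (fun w => t%:E *
               stieltjes_integral gam (fun u => (t - u)%:E^-1) t w)%E).
Proof.
split=> [l t l0 t0|]; first exact: (uniform_subordinator_laplace_powR hG hGam).
split.
  split; first exact: (uniform_subordinator_density hG hGam).
  by move=> dD TD PD E D lawE indep; exact: (cofactor_density hG hGam).
move=> dg Tg Pg gam hgam t t0.
have mX := sub_measurable Gam (ltW t0).
have X0 w : 0 <= Gam t w by exact: subordinator_ge0 (ltW t0).
have lapX l : 0 < l -> 'E_P[fun w => expR (- l * Gam t w)]%E =
    (expR (- (t * (xlnx (1 + l) - xlnx l))))%:E.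
  by move=> l0; apply: uniform_subordinator_laplace hG hGam _ _ (ltW l0) (ltW t0).
have law_right := wiener_gamma_right hgam t0 mX X0 lapX.
have law_left := wiener_gamma_left hgam t0 mX X0 lapX.
split=> //; case: law_right law_left => [_ mr er] [_ ml el].
by split=> // A mA; rewrite -er// el.
Qed.
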